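(* Let $c:\mathbb{R}\to(0,\infty)$ be a smooth function with $\inf_x c(x)>0$, and let $\beta:\mathbb{R}^2\to\mathbb{R}$ be a smooth function (not necessarily non-negative) such that $$\beta,\ \partial_x\beta,\ \partial_{xx}\beta\in L^\infty_x(L^1_y).$$ Set $B(x;u)=\int_{\mathbb{R}}\beta(x,y)u(y)\,dy$. Let $T>0$ and let $u_1,u_2$ be two viscosity solutions of $$\partial_t u+c(x)\,\partial_x u\,A_0[u]+B(x;u)\,\partial_x u=0\quad\text{in }(0,T)\times\mathbb{R},$$ such that $\partial_x u_1,\partial_x u_2\in L^\infty$, and such that $u_1$ and $u_2$ are both continuous, bounded and satisfy $u_1(0,x)=u_2(0,x)$ for all $x\in\mathbb{R}$. Then $u_1=u_2$.
   Context: $x$ denotes the first argument of $\beta$ and $y$ the second. $A_0$ is the half-Laplacian, given on smooth functions by $A_0[u](x)=\int_{\mathbb{R}}\frac{u(x)-u(y)}{(x-y)^2}dy$ (principal value), and for $\delta>0$, $A_\delta$ and $A_{-\delta}$ denote the same integral restricted to $|x-y|\ge\delta$ and $|x-y|<\delta$ respectively. In the equation, $B(x;u)$ at time $t$ means $B(x;u(t,\cdot))$. An usc (resp. lsc) function $u$ is a viscosity sub-solution (resp. super-solution) of the equation if for any $T'>0$ (within the time interval considered), any $\phi\in C^{1,1}_b$ (bounded $C^{1,1}$ functions of $(t,x)$), any $0<\delta\le\infty$ and any point $(t_0,x_0)\in(0,T']\times\mathbb{R}$ of maximum (resp. minimum) of $u-\phi$ on $[0,T']\times\mathbb{R}$,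 $$\partial_t\phi(t_0,x_0)+\partial_x\phi(t_0,x_0)c(x_0)\big(A_{-\delta}[\phi(t_0)](x_0)+A_\delta[u(t_0)](x_0)\big)+B(x_0;u(t_0))\partial_x\phi(t_0,x_0)\le0\ (\text{resp. }\ge0).$$ A viscosity solution is a locally bounded function $u$ whose upper semicontinuous envelope $u^*$ is a sub-solution and whose lower semicontinuous envelope $u_*$ is a super-solution; a continuous viscosity solution is thus both a sub- and a super-solution. *)

(* Defs.v *)
From HB Require Import structures.
From mathcomp Require Import all_boot all_order all_algebra.
From mathcomp Require Import all_classical all_reals all_analysis.
From mathcomp Require Import ess_sup_inf.
Set Implicit Arguments.
Unset Strict Implicit.
Unset Printing Implicit Defensive.
Import Order.TTheory GRing.Theory Num.Theory.
Import numFieldNormedType.Exports.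
Local Open Scope classical_set_scope.
Local Open Scope ring_scope.

(* All iterated directional derivatives are Frechet differentiable everywhere;
   for V finite dimensional (here R or R * R) this is exactly C^oo. *)
Definition smooth (R : realType) (V : normedModType R) (f : V -> R) : Prop :=
  forall (vs : seq V) (p : V), differentiable (foldr (fun v g => 'D_v g) f vs) p.

(* Functions of two variables are functions on R * R; d1 and d2 are the partial
   derivatives in the first and in the second variable. *)
Definition d1 (R : realType) (f : R * R -> R) : R * R -> R := 'D_(1, 0) f.
Definition d2 (R : realType) (f : R * R -> R) : R * R -> R := 'D_(0, 1) f.

Definition leb2 (R : realType) :=
  (@lebesgue_measure R \x @lebesgue_measure R)%E.

Definition Linfty_L1 (R : realType) (f : R * R -> R) : Prop :=
  (ess_sup (@lebesgue_measure R)
     (fun x => \int[@lebesgue_measure R]_y `|f (x, y)|%:E) < +oo)%E.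

Definition test_function (R : realType) (D : set (R * R)) (phi : R * R -> R)
    : Prop :=
  [/\ smooth phi,
      compact (closure [set p | phi p != 0]) &
      closure [set p | phi p != 0] `<=` D].

(* d2 u, in the sense of distributions on D, is an element of L^oo(D) *)
Definition weak_d2_Linfty (R : realType) (D : set (R * R)) (u : R * R -> R)
    : Prop :=
  exists g : R * R -> R,
    [/\ measurable_fun D g,
        (ess_sup (@leb2 R) (fun p => `|(g \_ D) p|%:E) < +oo)%E &
        forall phi, test_function D phi ->
          \int[@leb2 R]_(p in D) (u p * d2 phi p) =
          - \int[@leb2 R]_(p in D) (g p * phi p)].

(* A_delta for 0 < delta <= +oo; A_{+oo} is an integral over the empty set *)
Definition A_out (R : realType) (delta : \bar R) (f : R -> R) (x : R) : R :=
  \int[@lebesgue_measure R]_(y in [set y | (delta <= `|x - y|%:E)%E])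
    ((f x - f y) / (x - y) ^+ 2).

(* A_{-delta} for 0 < delta <= +oo, as a principal value;
   A_{-oo} is the half-Laplacian A_0 *)
Definition A_in (R : realType) (delta : \bar R) (f : R -> R) (x : R) : R :=
  lim ((\int[@lebesgue_measure R]_(y in
          [set y | e <= `|x - y| /\ (`|x - y|%:E < delta)%E])
        ((f x - f y) / (x - y) ^+ 2)) @[e --> 0^'+]).

Definition B (R : realType) (beta : R * R -> R) (x : R) (f : R -> R) : R :=
  \int[@lebesgue_measure R]_y (beta (x, y) * f y).

Definition C11b (R : realType) (phi : R * R -> R) : Prop :=
  [/\ [bounded phi p | p in setT],
      forall p, differentiable phi p,
      lipschitz (d1 phi) &
      lipschitz (d2 phi)].

Definition strip (R : realType) (T : R) : set (R * R) :=
  [set p | 0 <= p.1 < T].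

Definition open_strip (R : realType) (T : R) : set (R * R) :=
  [set p | 0 < p.1 < T].

Definition lsc_in (R : realType) (D : set (R * R)) (u : R * R -> R) : Prop :=
  lower_semicontinuous (fun p : subspace D => (u p)%:E).

Definition usc_in (R : realType) (D : set (R * R)) (u : R * R -> R) : Prop :=
  lsc_in D (fun p => - u p).

(* Semicontinuous envelopes relative to D (the filter [within D (nbhs p)] does
   not exclude p); they are meaningful at points of D near which u is bounded. *)
Definition usc_env (R : realType) (D : set (R * R)) (u : R * R -> R)
    (p : R * R) : R :=
  fine (limf_esup (fun q => (u q)%:E) (within D (nbhs p))).

Definition lsc_env (R : realType) (D : set (R * R)) (u : R * R -> R)
    (p : R * R) : R :=
  fine (limf_einf (fun q => (u q)%:E) (within D (nbhs p))).

Definition hj_lhs (R : realType) (c : R -> R) (beta : R * R -> R)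
    (delta : \bar R) (phi u : R * R -> R) (t x : R) : R :=
  d1 phi (t, x)
  + d2 phi (t, x) * c x *
    (A_in delta (fun y => phi (t, y)) x + A_out delta (fun y => u (t, y)) x)
  + B beta x (fun y => u (t, y)) * d2 phi (t, x).

Definition viscosity_subsolution (R : realType) (c : R -> R)
    (beta : R * R -> R) (T : R) (u : R * R -> R) : Prop :=
  usc_in (strip T) u /\
  forall T' : R, 0 < T' < T ->
  forall phi : R * R -> R, C11b phi ->
  forall delta : \bar R, (0 < delta)%E ->
  forall t0 x0 : R, 0 < t0 <= T' ->
    (forall t x, 0 <= t <= T' ->
       u (t, x) - phi (t, x) <= u (t0, x0) - phi (t0, x0)) ->
    hj_lhs c beta delta phi u t0 x0 <= 0.

Definition viscosity_supersolution (R : realType) (c : R -> R)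
    (beta : R * R -> R) (T : R) (u : R * R -> R) : Prop :=
  lsc_in (strip T) u /\
  forall T' : R, 0 < T' < T ->
  forall phi : R * R -> R, C11b phi ->
  forall delta : \bar R, (0 < delta)%E ->
  forall t0 x0 : R, 0 < t0 <= T' ->
    (forall t x, 0 <= t <= T' ->
       u (t0, x0) - phi (t0, x0) <= u (t, x) - phi (t, x)) ->
    0 <= hj_lhs c beta delta phi u t0 x0.

Definition viscosity_solution (R : realType) (c : R -> R)
    (beta : R * R -> R) (T : R) (u : R * R -> R) : Prop :=
  [/\ [locally [bounded u p | p in strip T]],
      viscosity_subsolution c beta T (usc_env (strip T) u) &
      viscosity_supersolution c beta T (lsc_env (strip T) u)].

(* Main.v *)
Require Import Defs.
From HB Require Import structures.
From mathcomp Require Import all_boot all_order all_algebra.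
From mathcomp Require Import all_classical all_reals all_analysis.
From mathcomp Require Import measurable_realfun ess_sup_inf.
From mathcomp Require Import ring lra.
Import Order.TTheory GRing.Theory Num.Theory.
Import numFieldNormedType.Exports.
Local Open Scope classical_set_scope.
Local Open Scope ring_scope.

(** The equation transports u with the velocity c A_0[u] + B[u], and uniqueness
    is a comparison principle.  Since c may be unbounded, the usual doubling of
    variables must be arranged so that c is never multiplied by an error term
    far away; this rests on the following facts about a bounded continuous
    solution that is Lipschitz in x.

    Monotonicity.  A solution is nondecreasing in x
    ([contact_slope_ge0], [u_mono]).  Where a test function phi touches
    a subsolution from above with negative slope, adding to phi k times a bump
    with value and slope 0 at the contact point changes neither phi_t nor
    phi_x but lowers A_{-1} phi by k; since the slope times c is negative, the
    left-hand side of the subsolution inequality becomes arbitrarily large,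
    which is absurd.  Hence every contact slope lies in [0, L], where L is the
    Lipschitz constant.

    Confinement at infinity.  The penalty psi of [exists_penalty] is a modified
    ln(1 + x^2)/2: it vanishes on a large interval, tends to infinity, and
    A_0 psi >= 0 outside a compact set.  At a contact point far away its
    nonlocal contribution therefore has the good sign, and it is bounded where
    c is bounded ([penalty_int]).  As first consequences sup_x u(t, .) is
    nonincreasing and inf_x u(t, .) nondecreasing in t ([sup_decr]); together
    with monotonicity in x this gives the uniform right continuity of
    t |-> u(t, .) ([uniform_right_time]) and a one-sided control of the time
    oscillation near x = +oo and x = -oo ([tail_right], [tail_left]).

    Comparison on a short interval ([local_comp]).  Double both variables and
    look at a maximum point of
      u(t,x) - v(tau,y) - gam (t + tau) - theta(t - tau) - q(x - y) - a psi(x).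
    Let p1, p2 in [0, L] be the slopes at x and y and pt = theta'(t - tau).
    Multiply the inequality for u by p2 c(y), the one for v by p1 c(x), and
    combine: the nonlocal terms now carry the same weight, so that their
    difference is controlled by A_0 psi, and the terms with B are Lipschitz
    perturbations ([doubled_contact]).  What remains is pt (p2 c(y) - p1 c(x)),
    whose dangerous part is - pt a psi'(x) c(x).  Since theta is flat near 0,
    pt <> 0 forces t and tau apart, and then the tail estimates forbid pt and
    psi'(x) to have the same sign.  The outcome is
      u - v <= E0 + 2 (2 L C0 + 1) E0 (t - s)
    as soon as |u - v| <= E0 at time s, C0 being a bound for the L^1 norms of
    beta(x, .).

    Conclusion.  This is a discrete Gronwall inequality; continuous induction
    on t with the barrier eps exp(lam t) ([barrier_induction], [uniqueness])
    gives |u1 - u2| <= eps exp(lam t) for all eps > 0.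

    The weak hypothesis on the derivative enters through [u_lip]: tested
    against smooth bumps, it makes u Lipschitz in x in the classical sense. *)

Set Implicit Arguments.
Unset Strict Implicit.
Unset Printing Implicit Defensive.

(** * Functions of class C^{1,1} on the line *)
Section C11.
Variable R : realType.
Implicit Types f g : R -> R.

(** The derivative is carried as a second function, and C^{1,1} is expressed by
    the quadratic Taylor remainder: second differences are estimated directly
    from it, and it is stable under composition. *)
Definition C11_with (C : R) (f f' : R -> R) : Prop :=
  (forall x, `|f' x| <= C) /\
  (forall x h, `|f (x + h) - f x - f' x * h| <= C * h ^+ 2).

Definition C11 (f f' : R -> R) : Prop := exists C, C11_with C f f'.

Lemma C11_with_ge0 C f f' : C11_with C f f' -> 0 <= C.
Proof. by move=> [+ _] => /(_ 0); apply: le_trans. Qed.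

Lemma C11_gt0 f f' : C11 f f' -> exists2 C, 0 < C & C11_with C f f'.
Proof.
move=> [C fC]; have C0 := C11_with_ge0 fC; exists (C + 1); first by lra.
case: fC => f1 f2; split=> [x|x h].
  by rewrite (le_trans (f1 x))// lerDl.
by rewrite (le_trans (f2 x h))// ler_wpM2r ?sqr_ge0// lerDl.
Qed.

Lemma is_derive_quad f (l x C : R) : 0 < C ->
  (forall h, `|f (x + h) - f x - l * h| <= C * h ^+ 2) -> is_derive x 1 f l.
Proof.
move=> C0 f2.
have cv : h^-1 *: (f (h + x) - f x) @[h --> 0^'] --> l.
  apply/cvgrPdist_le => e e0.
  near=> h.
  have h0 : h != 0 by near: h; exact: nbhs_dnbhs_neq.
  have -> : l - h^-1 *: (f (h + x) - f x)
      = - (h^-1 * (f (x + h) - f x - l * h)).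
    rewrite /GRing.scale/= addrC (addrC x h); field.
    exact: h0.
  rewrite normrN normrM normfV ler_pdivrMl ?normr_gt0//.
  rewrite (le_trans (f2 h))// -normr_id -real_normK ?num_real//.
  rewrite expr2 normr_id mulrA [leRHS]mulrC ler_wpM2r//.
  rewrite -ler_pdivlMl// ltW//.
  near: h; apply: dnbhs0_lt; rewrite mulr_gt0// ?invr_gt0//.
have dv : derivable f x 1.
  apply/cvg_ex; exists l.
  have := cv; under eq_fun do rewrite -[X in f (X + _)](mulr1).
  by move=> H; exact: H.
apply: DeriveDef => //.
rewrite -derive1E /derive1; apply: cvg_lim => //.
Unshelve. all: by end_near. Qed.

Lemma C11_is_derive f f' (x : R) : C11 f f' -> is_derive x 1 f (f' x).
Proof. by move=> /C11_gt0[C C0 [_ f2]]; exact: is_derive_quad C0 (f2 x). Qed.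

Lemma C11_lip C f f' : C11_with C f f' -> forall x y, `|f x - f y| <= C * `|x - y|.
Proof.
move=> fC x y.
wlog xy : x y / x <= y.
  move=> H; have [/H//|/ltW/H] := leP x y.
  by rewrite distrC (distrC y).
have dr (z : R) : is_derive z 1 f (f' z) by apply: C11_is_derive; exists C.
move: xy; rewrite le_eqVlt => /predU1P[->|xy].
  by rewrite !subrr normr0 mulr0.
have [z _ e] := @MVT _ f f' x y xy (fun z _ => dr z)
  ltac:(by apply: derivable_within_continuous => z _; apply: ex_derive).
rewrite distrC e normrM (distrC x y) ler_wpM2r//.
by case: fC.
Qed.

Lemma C11_cont f f' : C11 f f' -> continuous f.
Proof.
move=> fC x; have dx := C11_is_derive x fC.
by apply: differentiable_continuous; apply/derivable1_diffP; exact: ex_derive.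
Qed.

Lemma C11_dlip C f f' : C11_with C f f' ->
  forall x y, `|f' x - f' y| <= 2 * C * `|x - y|.
Proof.
move=> [_ fC] x y.
have [->|xy] := eqVneq x y; first by rewrite !subrr normr0 mulr0.
have h0 : 0 < `|x - y| by rewrite normr_gt0 subr_eq0.
rewrite -(ler_pM2r h0) -normrM.
have A := fC x (y - x); have B := fC y (x - y).
rewrite !subrKC in A B.
have -> : (f' x - f' y) * (x - y) =
  (f y - f x - f' x * (y - x)) + (f x - f y - f' y * (x - y)) by ring.
rewrite (le_trans (ler_normD _ _))// (le_trans (lerD A B))//.
have E : `|x - y| * `|x - y| = (x - y) ^+ 2 by rewrite -expr2 real_normK ?num_real.
by rewrite -[leRHS]mulrA E -[y - x]opprB sqrrN; lra.
Qed.

Lemma C11_cst a : C11 (cst a) (cst 0).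
Proof. by exists 0; split=> [x|x h]; rewrite /cst/= ?normr0// !subrr mul0r subrr normr0 mul0r. Qed.

Lemma C11_lin a b : C11 (fun x => a * x + b) (cst a).
Proof.
exists `|a|; split=> // x h; rewrite /cst/=.
have -> : a * (x + h) + b - (a * x + b) - a * h = 0 by ring.
by rewrite normr0 mulr_ge0// sqr_ge0.
Qed.

Lemma C11D f f' g g' : C11 f f' -> C11 g g' ->
  C11 (fun x => f x + g x) (fun x => f' x + g' x).
Proof.
move=> [C [f1 f2]] [D [g1 g2]]; exists (C + D); split=> [x|x h].
  by rewrite (le_trans (ler_normD _ _))// lerD.
have -> : f (x + h) + g (x + h) - (f x + g x) - (f' x + g' x) * h =
  (f (x + h) - f x - f' x * h) + (g (x + h) - g x - g' x * h) by ring.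
by rewrite (le_trans (ler_normD _ _))// mulrDl lerD.
Qed.

Lemma C11Z a f f' : C11 f f' -> C11 (fun x => a * f x) (fun x => a * f' x).
Proof.
move=> [C [f1 f2]]; exists (`|a| * C); split=> [x|x h].
  by rewrite normrM ler_wpM2l.
by rewrite -!mulrBr -mulrA -mulrBr normrM -mulrA ler_wpM2l.
Qed.

Lemma C11N f f' : C11 f f' -> C11 (fun x => - f x) (fun x => - f' x).
Proof.
by move=> /(C11Z (-1)); under eq_fun do rewrite mulN1r;
  under [X in C11 _ X]eq_fun do rewrite mulN1r.
Qed.

Lemma C11B f f' g g' : C11 f f' -> C11 g g' ->
  C11 (fun x => f x - g x) (fun x => f' x - g' x).
Proof. by move=> fC /C11N; exact: C11D. Qed.

Lemma C11_comp f f' g g' : C11 g g' -> C11 f f' ->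
  C11 (fun x => g (f x)) (fun x => g' (f x) * f' x).
Proof.
move=> /C11_gt0[D D0 gD] /C11_gt0[C C0 fC].
have [g1 g2] := gD; have [f1 f2] := fC.
exists (D * C + D * C ^+ 2); split=> [x|x h].
  rewrite normrM (@le_trans _ _ (D * C))//; first by rewrite ler_pM.
  by rewrite lerDl mulr_ge0 ?sqr_ge0// ltW.
have [k kE] : exists k, f (x + h) = f x + k by exists (f (x + h) - f x); ring.
have kh : `|k| <= C * `|h|.
  have := C11_lip fC (x + h) x; rewrite kE.
  by rewrite (addrC (f x)) addrK (addrC x) addrK.
have -> : g (f (x + h)) - g (f x) - g' (f x) * f' x * h =
  (g (f x + k) - g (f x) - g' (f x) * k)
  + g' (f x) * (f (x + h) - f x - f' x * h) by rewrite kE; ring.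
rewrite (le_trans (ler_normD _ _))// mulrDl addrC lerD//.
  by rewrite normrM -mulrA ler_pM.
rewrite (le_trans (g2 _ _))// -mulrA ler_wpM2l ?(ltW D0)//.
rewrite -exprMn -(real_normK (num_real k)) -(real_normK (num_real (C * h))).
by rewrite lerXn2r ?nnegrE// normrM (gtr0_norm C0).
Qed.

Lemma C11_aff a b f f' : C11 f f' ->
  C11 (fun x => f (a * x + b)) (fun x => f' (a * x + b) * a).
Proof. by move=> fC; exact: (C11_comp fC (C11_lin a b)). Qed.

Lemma C11_shift b f f' : C11 f f' ->
  C11 (fun x => f (x - b)) (fun x => f' (x - b)).
Proof.
move=> /(C11_aff 1 (- b)).
by under eq_fun do rewrite mul1r; under [X in C11 _ X]eq_fun do rewrite mul1r mulr1.
Qed.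

Lemma C11_refl b f f' : C11 f f' ->
  C11 (fun x => f (b - x)) (fun x => - f' (b - x)).
Proof.
move=> /(C11_aff (-1) b).
by under eq_fun do rewrite mulN1r addrC; under [X in C11 _ X]eq_fun do rewrite mulN1r mulrN1 addrC.
Qed.

Definition clamp01 (s : R) : R := if s <= 0 then 0 else if s <= 1 then s else 1.
(** The Huber function: the C^{1,1} substitute for the positive part.  All
    penalties below are combinations of it, since it is flat on the left,
    affine on the right, and convex. *)
Definition hub (s : R) : R :=
  if s <= 0 then 0 else if s <= 1 then s ^+ 2 / 2 else s - 2^-1.

(** [hub] is the supremum of the affine functions k y - k^2/2, 0 <= k <= 1, with
    equality at k = [clamp01 y] ([hubE]); convexity makes both Taylor bounds of
    [C11_hub] immediate. *)
Lemma hub_conv k y : 0 <= k <= 1 -> k * y - k ^+ 2 / 2 <= hub y.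
Proof.
move=> /andP[k0 k1]; rewrite /hub; case: (leP y 0) => y0.
  have := mulr_ge0 k0 (_ : 0 <= - y); rewrite oppr_ge0 => /(_ y0).
  have := sqr_ge0 k; lra.
case: (leP y 1) => y1; first by have := sqr_ge0 (k - y); rewrite sqrrB; lra.
have : 0 <= (1 - k) * (y - 1) by apply: mulr_ge0; lra.
have := sqr_ge0 (1 - k); rewrite sqrrB; lra.
Qed.

Lemma hubE y : hub y = clamp01 y * y - clamp01 y ^+ 2 / 2.
Proof.
rewrite /hub /clamp01; case: (leP y 0) => y0; first by rewrite mul0r expr0n/= mul0r subr0.
by case: (leP y 1) => y1; [field | lra].
Qed.

Lemma clamp01_lip x y : `|clamp01 y - clamp01 x| <= `|y - x|.
Proof.
wlog xy : x y / x <= y.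
  move=> H; have [/H//|/ltW/H] := leP x y.
  by rewrite distrC (distrC x).
have -> : `|y - x| = y - x by rewrite ger0_norm// subr_ge0.
suff : 0 <= clamp01 y - clamp01 x <= y - x.
  by move=> /andP[h1 h2]; rewrite ger0_norm.
rewrite /clamp01; case: (leP x 0) => x0.
  case: (leP y 0) => y0; first by apply/andP; split; lra.
  by case: (leP y 1) => y1; apply/andP; split; lra.
rewrite (_ : y <= 0 = false); last by apply/negbTE; rewrite -ltNge; lra.
case: (leP x 1) => x1; first by case: (leP y 1) => y1; apply/andP; split; lra.
rewrite (_ : y <= 1 = false); last by apply/negbTE; rewrite -ltNge; lra.
by apply/andP; split; lra.
Qed.

Lemma clamp01_ge0 s : 0 <= clamp01 s.
Proof. by rewrite /clamp01; case: (leP s 0) => ?; [|case: (leP s 1) => ?]; lra. Qed.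
Lemma clamp01_le1 s : clamp01 s <= 1.
Proof. by rewrite /clamp01; case: (leP s 0) => ?; [|case: (leP s 1) => ?]; lra. Qed.

Lemma C11_hub : C11 hub clamp01.
Proof.
exists 1; split=> [x|x h].
  by rewrite ger0_norm ?clamp01_ge0 ?clamp01_le1.
have c1 := clamp01_ge0 x; have c2 := clamp01_le1 x.
have d1 := clamp01_ge0 (x + h); have d2 := clamp01_le1 (x + h).
have A := @hub_conv (clamp01 x) (x + h); rewrite c1 c2 in A.
have {}A := A isT.
have B := @hub_conv (clamp01 (x + h)) x; rewrite d1 d2 in B.
have {}B := B isT.
have L := clamp01_lip x (x + h).
have E1 := hubE x; have E2 := hubE (x + h).
set k := clamp01 x in E1 A L *; set k' := clamp01 (x + h) in E2 B L *.
rewrite (_ : x + h - x = h) in L; last by ring.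
have M : (k' - k) * h <= h ^+ 2.
  rewrite (le_trans (ler_norm _))// normrM.
  rewrite -(real_normK (num_real h)) expr2 ler_wpM2r//.
have H0 : k * (x + h) = k * x + k * h by ring.
have H1 : k' * (x + h) = k' * x + k' * h by ring.
rewrite mul1r ler_norml; apply/andP; split; last by lra.
by have := sqr_ge0 h; lra.
Qed.

Lemma clamp01_eq0 s : s <= 0 -> clamp01 s = 0.
Proof. by rewrite /clamp01 => ->. Qed.
Lemma hub_eq0 s : s <= 0 -> hub s = 0.
Proof. by rewrite /hub => ->. Qed.
Lemma hub_ge0 s : 0 <= hub s.
Proof. by have := @hub_conv 0 s; rewrite lexx ler01 => /(_ isT); rewrite mul0r expr0n/= mul0r subr0. Qed.
Lemma hub_ge s : s - 2^-1 <= hub s.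
Proof. by have := @hub_conv 1 s; rewrite lexx ler01 => /(_ isT); rewrite expr1n; lra. Qed.
Lemma hub_lin s : 1 <= s -> hub s = s - 2^-1.
Proof.
rewrite /hub; case: (leP s 0) => ?; first lra.
by case: (leP s 1) => h1 h2 //; have -> : s = 1 by [apply/le_anti; rewrite h1 h2]; lra.
Qed.
Lemma hub_quad s : 0 <= s <= 1 -> hub s = s ^+ 2 / 2.
Proof.
rewrite /hub => /andP[s0 s1]; rewrite s1; case: (leP s 0) => // h.
by have -> : s = 0 by [apply/le_anti; rewrite h s0]; rewrite expr0n/= mul0r.
Qed.
Lemma hub_gt0 s : 0 < s -> 0 < hub s.
Proof.
move=> s0; rewrite /hub; case: (leP s 0) => h; first lra.
case: (leP s 1) => h1; last lra.
by rewrite divr_gt0// exprn_gt0.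
Qed.
Lemma hub_nd s t : s <= t -> hub s <= hub t.
Proof.
move=> st; have := @hub_conv (clamp01 s) t.
rewrite clamp01_ge0 clamp01_le1 => /(_ isT); apply: le_trans.
rewrite hubE lerB// ler_wpM2l ?clamp01_ge0//.
Qed.
Lemma hub_le s : 0 <= s -> hub s <= s.
Proof.
move=> s0; rewrite hubE lerBlDr ler_wpDr ?divr_ge0 ?sqr_ge0//.
by rewrite ler_piMl// clamp01_le1.
Qed.

(** A bounded C^{1,1} truncation of the identity with value 0 and slope 1 at 0,
    above min(s, K): composing an unbounded test function with it keeps the
    contact point and the derivatives there. *)
Definition hcut (K s : R) : R := hub (s + K) - hub (s - K) - (K - 2^-1).
Definition dhcut (K s : R) : R := clamp01 (s + K) - clamp01 (s - K).

Lemma C11_hcut K : C11 (hcut K) (dhcut K).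
Proof.
have H1 := C11_shift (- K) C11_hub; have H2 := C11_shift K C11_hub.
have := C11B (C11B H1 H2) (C11_cst (K - 2^-1)).
rewrite /hcut /dhcut; under eq_fun do rewrite opprK.
by under [X in C11 _ X]eq_fun do rewrite /cst/= subr0 opprK.
Qed.

Lemma hcut0 K : 1 <= K -> hcut K 0 = 0.
Proof. by move=> K1; rewrite /hcut hub_lin ?hub_eq0; lra. Qed.
Lemma dhcut0 K : 1 <= K -> dhcut K 0 = 1.
Proof. move=> K1; rewrite /dhcut add0r sub0r (@clamp01_eq0 (- K)) ?subr0; last lra.
rewrite /clamp01; case: (leP K 0) => ?; first lra.
by case: (leP K 1) => // ?; apply/le_anti; apply/andP. Qed.
Lemma hcut_ge K s : 1 <= K -> Num.min s K <= hcut K s.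
Proof.
move=> K1; have a := hub_ge (s + K); have b := hub_ge0 (s - K).
rewrite /hcut ge_min; have [sK|sK] := leP s K.
  rewrite (@hub_eq0 (s - K)); last lra.
  by apply/orP; left; lra.
apply/orP; right; rewrite (@hub_lin (s + K)); last lra.
have := @hub_le (s - K); lra.
Qed.
Lemma hcut_bnd K s : 1 <= K -> `|hcut K s| <= 3 * K.
Proof.
move=> K1; rewrite ler_norml /hcut.
have a := hub_ge0 (s + K); have b := hub_ge (s - K).
have c := hub_ge (s + K); have d := hub_ge0 (s - K).
have [h1|h1] := leP s (- K).
  by rewrite (@hub_eq0 (s + K)) ?(@hub_eq0 (s - K)); lra.
have e := @hub_le (s + K); have [h2|h2] := leP s K.
  by rewrite (@hub_eq0 (s - K)); lra.
have f := @hub_le (s - K); lra.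
Qed.

Definition ehub (s : R) : R := hub s + hub (- s).
Definition dehub (s : R) : R := clamp01 s - clamp01 (- s).
Lemma C11_ehub : C11 ehub dehub.
Proof.
have := C11D C11_hub (C11_refl 0 C11_hub); rewrite /ehub /dehub.
by under eq_fun do rewrite sub0r; under [X in C11 _ X]eq_fun do rewrite sub0r.
Qed.
Lemma ehub_ge0 s : 0 <= ehub s.
Proof. by rewrite addr_ge0 ?hub_ge0. Qed.
Lemma ehub0 : ehub 0 = 0.
Proof. by rewrite /ehub oppr0 hub_eq0 ?addr0. Qed.
Lemma ehub_lt s d : 0 < d <= 1 -> ehub s < d ^+ 2 / 2 -> `|s| < d.
Proof.
move=> /andP[d0 d1]; rewrite ltr_norml /ehub => H.
have [sd|sd] := leP d s.
  have := hub_nd sd; rewrite hub_quad; last lra.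
  have := hub_ge0 (- s); lra.
have [sd'|sd'] := leP d (- s).
  have := hub_nd sd'; rewrite hub_quad; last lra.
  have := hub_ge0 s; lra.
by apply/andP; split; lra.
Qed.

End C11.

(** * The half-Laplacian as an integral of second differences *)
Section integrals.
Variable R : realType.
Local Notation mu := (@lebesgue_measure R).
Implicit Types f g k : R -> R.

Definition refl (a : R) : measurableTypeR R -> measurableTypeR R := fun z => a - z.
Definition trans (a : R) : measurableTypeR R -> measurableTypeR R := fun z => a + z.

Lemma measurable_refl a : measurable_fun setT (refl a).
Proof. by apply: measurable_funB. Qed.
Lemma measurable_trans a : measurable_fun setT (trans a).
Proof. by apply: measurable_funD. Qed.

HB.instance Definition _ a := isMeasurableFun.Build _ _ _ _ (refl a) (measurable_refl a).
HB.instance Definition _ a := isMeasurableFun.Build _ _ _ _ (trans a) (measurable_trans a).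

Lemma lebesgue_measure_refl (a : R) (A : set R) : measurable A ->
  pushforward mu (refl a) A = mu A.
Proof.
move=> mA; apply/esym.
apply: (@lebesgue_measure_unique R (pushforward mu (refl a))) => //= _ [[x y]] _ <-.
rewrite /pushforward.
have -> : refl a @^-1` `]x, y] = `[a - y, a - x[%classic.
  by apply/seteqP; split=> z /=; rewrite /refl !in_itv/= => /andP[p q]; apply/andP; split; lra.
rewrite !lebesgue_measure_itv/= !lte_fin ltrD2l ltrN2.
by case: ifP => // _; rewrite -!EFinD; congr EFin; ring.
Qed.

Lemma lebesgue_measure_trans (a : R) (A : set R) : measurable A ->
  pushforward mu (trans a) A = mu A.
Proof.
move=> mA; apply/esym.
apply: (@lebesgue_measure_unique R (pushforward mu (trans a))) => //= _ [[x y]] _ <-.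
rewrite /pushforward.
have -> : trans a @^-1` `]x, y] = `]x - a, y - a]%classic.
  by apply/seteqP; split=> z /=; rewrite /trans !in_itv/= => /andP[p q]; apply/andP; split; lra.
rewrite !lebesgue_measure_itv/= !lte_fin ltrD2r.
by case: ifP => // _; rewrite -!EFinD; congr EFin; ring.
Qed.

Section inv.
Variable phi : {mfun measurableTypeR R >-> measurableTypeR R}.
Hypothesis phiI : forall A : set R, measurable A -> pushforward mu phi A = mu A.

Lemma ge0_int_inv (D : set R) (f : R -> \bar R) : measurable D ->
  measurable_fun D f -> {in D, forall y, (0 <= f y)%E} ->
  (\int[mu]_(y in D) f y = \int[mu]_(z in phi @^-1` D) f (phi z))%E.
Proof.
move=> mD mf f0.
have E := @ge0_integral_pushforward _ _ (measurableTypeR R) (measurableTypeR R) R phi (@measurable_funPT _ _ _ _ phi) mu D f mD mf f0.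
rewrite [RHS](_ : _ = (\int[pushforward mu phi]_(y in D) f y)%E); last exact/esym/E.
apply: (@eq_measure_integral _ (measurableTypeR R)) => A mA AS; exact/esym/phiI.
Qed.

Lemma int_inv (D : set R) (f : R -> \bar R) : measurable D ->
  measurable_fun D f ->
  (\int[mu]_(y in D) f y = \int[mu]_(z in phi @^-1` D) f (phi z))%E.
Proof.
move=> mD mf; rewrite [LHS]integralE [RHS]integralE.
rewrite (_ : (fun z => f (phi z)) = f \o phi)//.
rewrite (funepos_comp f phi) (funeneg_comp f phi).
congr (_ - _)%E.
  by apply: ge0_int_inv => //; exact: measurable_funepos.
by apply: ge0_int_inv => //; exact: measurable_funeneg.
Qed.

(** Change of variables for a map that preserves Lebesgue measure; it is applied
    to the reflection z |-> x - z and to the translations. *)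
Lemma Rint_inv (D : set R) f : measurable D -> measurable_fun D f ->
  \int[mu]_(y in D) f y = \int[mu]_(z in phi @^-1` D) f (phi z).
Proof.
move=> mD mf; rewrite /Rintegral; congr fine; apply: int_inv => //.
exact/measurable_EFinP.
Qed.

Lemma integrable_inv (D : set R) f : measurable D -> measurable_fun setT f ->
  mu.-integrable (phi @^-1` D) (fun z => (f (phi z))%:E) ->
  mu.-integrable D (EFin \o f).
Proof.
move=> mD mf /integrableP[_ H].
have mf' : measurable_fun D (EFin \o f).
  by apply/measurable_EFinP; exact: measurable_funTS.
apply/integrableP; split => //.
rewrite ge0_int_inv//=.
apply/measurable_EFinP; apply: measurableT_comp => //.
exact: measurable_funTS.
Qed.
End inv.

Lemma int_inv2 (d : R) : 0 < d ->
  (\int[mu]_(z in `[d, +oo[) ((z ^+ 2)^-1)%:E = (d^-1)%:E)%E.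
Proof.
move=> d0.
have der (x : R) : 0 < x -> is_derive x 1 (fun z : R => - z^-1) ((x ^+ 2)^-1).
  move=> x0; apply: is_derive_eq; first by apply: is_deriveN; apply: is_deriveV; rewrite gt_eqF.
  by rewrite /GRing.scale/= mulr1 opprK.
rewrite (@ge0_continuous_FTC2y R _ (fun z => - z^-1) d 0).
- by rewrite sub0e -EFinN opprK.
- by move=> x dx; rewrite invr_ge0 sqr_ge0.
- apply: continuous_in_subspaceT => x /set_mem /=; rewrite in_itv/= andbT => dx.
  apply: cvgV; last exact: exprn_continuous.
  by rewrite expf_neq0// gt_eqF//; lra.
- rewrite -oppr0; apply: cvgN.
  apply/gtr0_cvgV0; last exact: cvg_id.
  by near=> x; near: x; exact: nbhs_pinfty_gt.
- move=> x dx; have x0 : 0 < x by lra.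
  by have := der x x0 => ?; exact: ex_derive.
- apply: cvg_at_right_filter; apply: cvgN; apply: cvgV; first by rewrite gt_eqF.
  exact: cvg_id.
- move=> x; rewrite in_itv/= andbT => dx; have x0 : 0 < x by lra.
  by rewrite derive1E; have := der x x0 => ?; rewrite derive_val.
Unshelve. all: by end_near. Qed.

Lemma measurable_inv2 : measurable_fun (`]0, +oo[ : set R) (fun z : R => (z ^+ 2)^-1).
Proof.
apply: open_continuous_measurable_fun; first exact: interval_open.
move=> x /set_mem; rewrite /= in_itv/= andbT => x0.
by apply: cvgV; [rewrite expf_neq0// gt_eqF|exact: exprn_continuous].
Qed.

Lemma measurable_ker (S : set R) k : measurable S -> S `<=` `]0, +oo[ ->
  measurable_fun setT k -> measurable_fun S (fun z => k z / z ^+ 2).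
Proof.
move=> mS S0 mk; apply: measurable_funM; first exact: measurable_funTS.
by apply: measurable_funS measurable_inv2.
Qed.

Lemma integrable_ker (d C : R) k : 0 < d -> measurable_fun setT k ->
  (forall z, `|k z| <= C) ->
  mu.-integrable `[d, +oo[ (fun z => (k z / z ^+ 2)%:E).
Proof.
move=> d0 mk kC.
have C0 : 0 <= C by apply: le_trans (kC 0).
have sub : (`[d, +oo[ : set R) `<=` `]0, +oo[.
  by move=> z /=; rewrite !in_itv/= !andbT => dz; lra.
have i1 : mu.-integrable `[d, +oo[ (fun z : R => ((z ^+ 2)^-1)%:E).
  apply/integrableP; split.
    by apply/measurable_EFinP; apply: measurable_funS measurable_inv2.
  under eq_integral => z _ do rewrite gee0_abs ?lee_fin ?invr_ge0 ?sqr_ge0//.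
  by rewrite int_inv2// ltry.
have i2 := @integrableZl _ _ _ mu _ (measurable_itv _) C _ i1.
apply: (le_integrable _ _ _ i2) => //.
  by apply/measurable_EFinP; exact: measurable_ker.
move=> z _ /=; rewrite lee_fin 2!normrM ler_wpM2r// (ger0_norm C0)//.
Qed.

(** Minus the symmetric second difference, so that A[f](x) is the integral of
    [sd f x z] / z^2 over z > 0. *)
Definition sd f x z := 2 * f x - f (x + z) - f (x - z).

Lemma measurable_sd f x : measurable_fun setT f -> measurable_fun setT (sd f x).
Proof.
move=> mf; apply: measurable_funB; first apply: measurable_funB => //.
  exact: (measurableT_comp mf (measurable_trans x)).
exact: (measurableT_comp mf (measurable_refl x)).
Qed.

(** The set |x - y| in S splits into y = x - z and y = x + z with z in S, and both
    pieces are carried to S by maps that preserve Lebesgue measure. *)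
Lemma A_symmetric (S : set R) f x d C : 0 < d -> measurable S -> S `<=` `[d, +oo[ ->
  measurable_fun setT f -> (forall z, `|f z| <= C) ->
  \int[mu]_(y in [set y | S `|x - y|]) ((f x - f y) / (x - y) ^+ 2) =
  \int[mu]_(z in S) (sd f x z / z ^+ 2).
Proof.
move=> d0 mS Sd mf fC.
have Sge z : S z -> d <= z by move=> /Sd /=; rewrite in_itv/= andbT.
pose F y := (f x - f y) / Num.max ((x - y) ^+ 2) (d ^+ 2).
have FE y : d <= `|x - y| -> (f x - f y) / (x - y) ^+ 2 = F y.
  move=> dxy; rewrite /F max_l// -[leRHS]real_normK ?num_real//.
  by rewrite lerXn2r ?nnegrE// ltW.
have mF : measurable_fun setT F.
  apply: measurable_funM; first exact: measurable_funB.
  apply: continuous_measurable_fun => y; apply: cvgV.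
    by rewrite gt_eqF// lt_max (exprn_gt0 _ d0) orbT.
  apply: (@continuous_max R R (fun y => (x - y) ^+ 2) (cst (d ^+ 2)) y).
    apply: (@continuous_comp _ _ _ (fun y : R => x - y) (fun z : R => z ^+ 2)); last exact: exprn_continuous.
    by apply: cvgB; [exact: cvg_cst|exact: cvg_id].
  exact: cvg_cst.
pose D1 := (refl x) @^-1` S; pose D2 := (trans (- x)) @^-1` S.
have mD1 : measurable D1 by rewrite -[D1]setTI; exact: measurable_refl.
have mD2 : measurable D2 by rewrite -[D2]setTI; exact: measurable_trans.
have DE : [set y | S `|x - y|] = D1 `|` D2.
  apply/seteqP; split => y /=; rewrite /D1 /D2 /refl /trans /=.
    have [h|h] := leP 0 (x - y).
      by rewrite (ger0_norm h); left.
    by rewrite (ltr0_norm h) opprB (addrC y); right.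
  move=> [Sy|Sy]; have := Sge _ Sy => h.
    by rewrite ger0_norm//; lra.
  by rewrite ler0_norm ?opprB; [rewrite addrC|lra].
have P1 : refl x @^-1` D1 = S.
  by apply/seteqP; split => z; rewrite /D1 /refl /= opprB addrC subrK.
have P2 : trans x @^-1` D2 = S.
  by apply/seteqP; split => z; rewrite /D2 /trans /= addrA addNr add0r.
have e1 z : S z -> F (refl x z) = (f x - f (x - z)) / z ^+ 2.
  move=> Sz; rewrite /refl -FE; first by congr (_ / _ ^+ 2); ring.
  by rewrite opprB addrC subrK (le_trans (Sge _ Sz))// ler_norm.
have e2 z : S z -> F (trans x z) = (f x - f (x + z)) / z ^+ 2.
  move=> Sz; rewrite /trans -FE; first by congr (_ / _); ring.
  by rewrite opprD addrA subrr add0r normrN (le_trans (Sge _ Sz))// ler_norm.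
have bnd g : measurable_fun setT g -> (forall z, `|g z| <= C) ->
    mu.-integrable S (fun z => ((f x - g z) / z ^+ 2)%:E).
  move=> mg gC; apply: (@integrableS _ _ _ mu `[d, +oo[%classic S) => //.
  apply: (@integrable_ker d (C + C) (fun z => f x - g z)) => //.
    exact: measurable_funB.
  by move=> z; rewrite (le_trans (ler_normB _ _))// lerD.
have i1 := bnd (fun z => f (x - z)) (measurableT_comp mf (measurable_refl x)) (fun z => fC _).
have i2 := bnd (fun z => f (x + z)) (measurableT_comp mf (measurable_trans x)) (fun z => fC _).
have I1 : mu.-integrable D1 (EFin \o F).
  apply: (@integrable_inv (refl x) (@lebesgue_measure_refl x)) => //.
  rewrite P1; apply: eq_integrable i1 => // z /set_mem Sz.
  by rewrite e1.
have I2 : mu.-integrable D2 (EFin \o F).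
  apply: (@integrable_inv (trans x) (@lebesgue_measure_trans x)) => //.
  rewrite P2; apply: eq_integrable i2 => // z /set_mem Sz.
  by rewrite e2.
rewrite DE (@eq_Rintegral _ _ _ mu _ F); last first.
  move=> y /set_mem; rewrite -DE /= => /Sge dy; exact: FE.
have dis : [disjoint D1 & D2].
  apply/disj_setPS => y [/Sge + /Sge]; rewrite /refl /trans; lra.
rewrite Rintegral_setU//; last first.
  have mF' D' : measurable_fun D' (EFin \o F) by apply/measurable_EFinP; exact: measurable_funTS.
  apply/integrableP; split; first exact: mF'.
  have mF'' D' : measurable_fun D' (fun y => `|(F y)%:E|%E).
    by apply: measurableT_comp.
  have E := @ge0_integral_setU _ _ _ mu D1 D2 mD1 mD2 (fun y => `|(F y)%:E|%E) (mF'' _) (fun _ _ => abse_ge0 _) dis.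
  apply: (@eq_ind_r _ _ (fun X => (X < +oo)%E) _ _ E).
  have /integrableP[_ ?] := I1; have /integrableP[_ ?] := I2.
  exact: lte_add_pinfty.
rewrite (@Rint_inv (refl x) (@lebesgue_measure_refl x) D1)//; last exact: measurable_funTS.
rewrite (@Rint_inv (trans x) (@lebesgue_measure_trans x) D2)//; last exact: measurable_funTS.
rewrite P1 P2 (@eq_Rintegral _ _ _ mu S _ _ (fun z zS => e1 z (set_mem zS))).
rewrite (@eq_Rintegral _ _ _ mu S _ _ (fun z zS => e2 z (set_mem zS))).
rewrite -RintegralD//; apply: eq_Rintegral => z _.
by rewrite -mulrDl /sd; congr (_ / _); ring.
Qed.

Lemma A_outE d f x C : 0 < d -> measurable_fun setT f ->
  (forall z, `|f z| <= C) ->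
  A_out d%:E f x = \int[mu]_(z in `[d, +oo[) (sd f x z / z ^+ 2).
Proof.
move=> d0 mf fC.
rewrite -(@A_symmetric `[d, +oo[%classic f x d C)// /A_out.
congr (Rintegral mu _ _); apply/seteqP; split => y /=.
  by rewrite in_itv/= lee_fin andbT.
by rewrite in_itv/= lee_fin andbT.
Qed.

Lemma integrable_cst_itv (a b : R) (b0 b1 : bool) (K : R) :
  mu.-integrable [set` Interval (BSide b0 a) (BSide b1 b)] (EFin \o cst K).
Proof.
apply: measurable_bounded_integrable; first exact: measurable_itv.
- by rewrite /= lebesgue_measure_itv/=; case: ifP => // _; rewrite -EFinD ltry.
- exact: measurable_cst.
- exact: bounded_cst.
Qed.

Lemma integrable_near0 d K k : measurable_fun setT k ->
  (forall z, `|k z| <= K * z ^+ 2) ->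
  mu.-integrable `]0, d[ (fun z => (k z / z ^+ 2)%:E).
Proof.
move=> mk kK.
apply: (@le_integrable _ _ _ mu _ (measurable_itv _) _ (EFin \o cst K)).
- apply/measurable_EFinP; apply: measurable_ker => //.
  by move=> z /=; rewrite !in_itv/= => /andP[->].
- move=> z /=; rewrite in_itv/= => /andP[z0 _]; rewrite lee_fin.
  rewrite normrM normfV (ger0_norm (sqr_ge0 z)) ler_pdivrMr ?exprn_gt0//.
  by rewrite (le_trans (kK z))// ler_wpM2r ?sqr_ge0// ler_norm.
- exact: integrable_cst_itv.
Qed.

Lemma int_near0_le d K k : 0 < d -> measurable_fun setT k ->
  (forall z, `|k z| <= K * z ^+ 2) ->
  `|\int[mu]_(z in `]0, d[) (k z / z ^+ 2)| <= K * d.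
Proof.
move=> d0 mk kK.
have ik := integrable_near0 d mk kK.
apply: le_trans (le_normr_Rintegral _ ik) _ => //.
have -> : K * d = \int[mu]_(z in `]0, d[) K.
  rewrite Rintegral_cst//= lebesgue_measure_itv/= lte_fin d0.
  by rewrite -EFinD/= subr0.
apply: le_Rintegral => //.
- exact: (integrable_norm ik).
- exact: integrable_cst_itv.
- move=> z /=; rewrite in_itv/= => /andP[z0 _].
  rewrite normrM normfV (ger0_norm (sqr_ge0 z)) ler_pdivrMr ?exprn_gt0//.
Qed.

(** Symmetrisation replaces the principal value by an absolutely convergent
    integral, because second differences of C^{1,1} functions are O(z^2). *)
Lemma A_inE d f x C K : 0 < d -> measurable_fun setT f ->
  (forall z, `|f z| <= C) -> (forall z, `|sd f x z| <= K * z ^+ 2) ->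
  A_in d%:E f x = \int[mu]_(z in `]0, d[) (sd f x z / z ^+ 2).
Proof.
move=> d0 mf fC sK.
have msd := measurable_sd x mf.
have K0 : 0 <= K by have := sK 1; rewrite expr1n mulr1; apply: le_trans.
apply/cvg_lim => //; apply/cvgrPdist_le => e e0.
near=> a.
have a0 : 0 < a by near: a; exact: nbhs_right_gt.
have ad : a < d by near: a; exact: nbhs_right_lt.
rewrite [X in `|_ - X|](_ : _ = \int[mu]_(z in `[a, d[) (sd f x z / z ^+ 2)).
  have U : `]0, d[%classic = `]0, a[%classic `|` `[a, d[%classic :> set R.
    apply/seteqP; split => z /=; rewrite !in_itv/=.
      by move=> /andP[-> ->]; rewrite andbT; have [_|_] := ltP z a; [left|right].
    by move=> [/andP[h1 h2]|/andP[h1 h2]]; apply/andP; split; lra.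
  have ik := integrable_near0 d msd sK.
  rewrite [X in `|X - _|](_ : _ =
      \int[mu]_(z in `]0, a[) (sd f x z / z ^+ 2) + \int[mu]_(z in `[a, d[) (sd f x z / z ^+ 2)); last first.
    transitivity (\int[mu]_(z in `]0, a[%classic `|` `[a, d[%classic) (sd f x z / z ^+ 2)).
      by congr (Rintegral mu _ _); exact: U.
    apply: Rintegral_setU; [exact: measurable_itv|exact: measurable_itv| |].
      by move: ik; rewrite U.
    apply/disj_setPS => z []/=; rewrite !in_itv/= => /andP[_ h1] /andP[h2 _].
    by move: (lt_le_trans h1 h2); rewrite ltxx.
  rewrite addrK (le_trans (int_near0_le a0 msd sK))//.
  rewrite (@le_trans _ _ ((K + 1) * a))//; first by rewrite ler_wpM2r ?ltW//; lra.
  rewrite mulrC -ler_pdivlMr; last lra.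
  near: a; apply: nbhs_right_le; rewrite divr_gt0//; lra.
rewrite -(@A_symmetric `[a, d[%classic f x a C)//; last first.
  by move=> z /=; rewrite !in_itv/= andbT => /andP[].
congr (Rintegral mu _ _); apply/seteqP; split => y /=.
  by rewrite in_itv/= lte_fin => -[-> ->].
by rewrite in_itv/= lte_fin => /andP[-> ->].
Unshelve. all: by end_near. Qed.

End integrals.

(** * Test functions built from contact on a time interval *)

Section env.
Variable R : realType.
Implicit Types (u : R * R -> R) (D : set (R * R)).

(** For a continuous solution both semicontinuous envelopes coincide with the
    solution on the strip, so that the viscosity inequalities apply to the
    function itself. *)
Lemma limf_esup_cvg (F : set_system (R * R)) {FF : ProperFilter F}
    (f : R * R -> R) (l : R) : f @ F --> l ->
  limf_esup (fun q => (f q)%:E) F = l%:E.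
Proof.
move=> fl; rewrite limf_esupE; apply/eqP; rewrite eq_le; apply/andP; split.
  apply/lee_addgt0Pr => e e0.
  have Fe : F [set q | f q <= l + e].
    move/cvgrPdist_le : fl => /(_ e e0); apply: filterS => q /=.
    by rewrite ler_norml; lra.
  apply: (@le_trans _ _ (ereal_sup ((fun q => (f q)%:E) @` [set q | f q <= l + e]))).
    by apply: ereal_inf_lbound; exists [set q | f q <= l + e].
  by apply: ge_ereal_sup => _ [q /= qe <-]; rewrite -EFinD lee_fin.
apply: le_ereal_inf_tmp => _ [V FV <-].
apply/lee_addgt0Pr => e e0.
have Fe : F [set q | l - e <= f q].
  move/cvgrPdist_le : fl => /(_ e e0); apply: filterS => q /=.
  by rewrite ler_norml; lra.
have [q [Vq /= eq]] := @filter_ex _ _ FF _ (filterI FV Fe).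
rewrite -leeBlDr// -EFinB.
apply: (@le_trans _ _ (f q)%:E); first by rewrite lee_fin.
by apply: ereal_sup_ubound; exists q.
Qed.

Lemma within_proper D p : D p -> ProperFilter (within D (nbhs p)).
Proof.
move=> Dp; apply: Build_ProperFilter_ex => P; rewrite /within/= => /nbhs_singleton.
by move=> /(_ Dp) Pp; exists p.
Qed.

Lemma within_cont_cvg D u p : {within D, continuous u} -> D p ->
  u @ within D (nbhs p) --> u p.
Proof.
move=> uc Dp; have /= := uc p.
by rewrite /continuous_at /from_subspace nbhs_subspace_in.
Qed.

Lemma usc_env_cont D u p : {within D, continuous u} -> D p -> usc_env D u p = u p.
Proof.
move=> uc Dp; rewrite /usc_env.
by rewrite (@limf_esup_cvg _ (within_proper Dp) _ (u p)) //; exact: within_cont_cvg.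
Qed.

Lemma lsc_env_cont D u p : {within D, continuous u} -> D p -> lsc_env D u p = u p.
Proof.
move=> uc Dp; rewrite /lsc_env /limf_einf.
have H : (fun q => - u q) @ within D (nbhs p) --> - u p.
  by apply: cvgN; exact: within_cont_cvg.
rewrite [X in limf_esup X](_ : _ = fun q => (- u q)%:E); last by apply/funext => q.
by rewrite (@limf_esup_cvg _ (within_proper Dp) _ (- u p))//= opprK.
Qed.

End env.

Section partial.
Variable R : realType.

Lemma d1E (f : R * R -> R) t x : d1 f (t, x) = 'D_1 (fun s => f (s, x)) t.
Proof.
rewrite /d1 /derive.
suff -> : (fun h : R => h^-1 *: ((f \o shift (t, x)) (h *: (1, 0)) - f (t, x))) =
  (fun h => h^-1 *: (((fun s => f (s, x)) \o shift t) (h *: (1 : R)) - f (t, x))) by [].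
apply/funext => h /=; congr (_ *: (f _ - _)).
by apply: injective_projections => /=; rewrite ?scaler0 ?add0r.
Qed.

Lemma d2E (f : R * R -> R) t x : d2 f (t, x) = 'D_1 (fun s => f (t, s)) x.
Proof.
rewrite /d2 /derive.
suff -> : (fun h : R => h^-1 *: ((f \o shift (t, x)) (h *: (0, 1)) - f (t, x))) =
  (fun h => h^-1 *: (((fun s => f (t, s)) \o shift x) (h *: (1 : R)) - f (t, x))) by [].
apply/funext => h /=; congr (_ *: (f _ - _)).
by apply: injective_projections => /=; rewrite ?scaler0 ?add0r.
Qed.

Lemma differentiable_fst2 (p : R * R) : differentiable (fst : R * R -> R) p.
Proof. by apply: linear_differentiable => q; exact: cvg_fst. Qed.
Lemma differentiable_snd2 (p : R * R) : differentiable (snd : R * R -> R) p.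
Proof. by apply: linear_differentiable => q; exact: cvg_snd. Qed.

Lemma C11_diff (f f' : R -> R) (x : R) : C11 f f' -> differentiable f x.
Proof. by move=> /(C11_is_derive x) ?; apply/derivable1_diffP; exact: ex_derive. Qed.

Variables (P P' G G' h h' r r' : R -> R).
Hypotheses (HP : C11 P P') (HG : C11 G G') (Hh : C11 h h') (Hr : C11 r r').
Variables (k Cr CP : R).
Hypotheses (rC : forall x, `|r x| <= Cr) (PC : forall x, `|P x| <= CP).
Let phi (p : R * R) : R := P (G p.1 + h p.2 - k) + r p.2.

Lemma test_d1 t x : d1 phi (t, x) = P' (G t + h x - k) * G' t.
Proof.
have := C11_comp HP (C11D HG (C11_cst (h x - k))) => /(C11_is_derive t) H.
rewrite d1E /phi/=.
have E : is_derive t 1 (fun s => P (G s + h x - k) + r x) (P' (G t + h x - k) * G' t).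
  have := is_deriveD H (is_derive_cst (r x) t 1); rewrite addr0 addr0 /= addrA.
  by rewrite /cst; under eq_fun do rewrite addrA.
by rewrite derive_val.
Qed.

Lemma test_d2 t x : d2 phi (t, x) = P' (G t + h x - k) * h' x + r' x.
Proof.
have := C11D (C11_comp HP (C11D Hh (C11_cst (G t - k)))) Hr => /(C11_is_derive x).
rewrite d2E /phi/= /cst => H.
have E : is_derive x 1 (fun s => P (G t + h s - k) + r s) (P' (G t + h x - k) * h' x + r' x).
  move: H; under eq_fun do rewrite addrCA addrA; rewrite addrCA addrA addr0.
  by [].
by rewrite derive_val.
Qed.

Lemma test_C11b : C11b phi.
Proof.
have [A A0 HA] := C11_gt0 HP; have [D D0 HD] := C11_gt0 HG.
have [E E0 HE] := C11_gt0 Hh; have [F F0 HF] := C11_gt0 Hr.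
have lipS (p q : R * R) : `|(G p.1 + h p.2 - k) - (G q.1 + h q.2 - k)| <= (D + E) * `|p - q|.
  have -> : (G p.1 + h p.2 - k) - (G q.1 + h q.2 - k) = (G p.1 - G q.1) + (h p.2 - h q.2) by ring.
  rewrite (le_trans (ler_normD _ _))// mulrDl lerD//.
    rewrite (le_trans (C11_lip HD _ _))// ler_wpM2l ?(ltW D0)// prod_normE/=.
    by rewrite le_max lexx.
  rewrite (le_trans (C11_lip HE _ _))// ler_wpM2l ?(ltW E0)// prod_normE/=.
  by rewrite le_max lexx orbT.
have n1 (p q : R * R) : `|p.1 - q.1| <= `|p - q| by rewrite prod_normE/= le_max lexx.
have n2 (p q : R * R) : `|p.2 - q.2| <= `|p - q| by rewrite prod_normE/= le_max lexx orbT.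
have mulB (a b a' b' : R) : a * b - a' * b' = (a - a') * b + a' * (b - b') by ring.
split.
- exists (CP + Cr); split; first exact: num_real.
  move=> M HM p _; apply: (@le_trans _ _ (CP + Cr)); last exact: ltW.
  by apply: le_trans (ler_normD _ _) _; rewrite lerD.
- move=> p; apply: differentiableD.
    apply: (@differentiable_comp _ _ _ _ (fun p : R * R => G p.1 + h p.2 - k) P); last exact: C11_diff HP.
    apply: differentiableB; last exact: differentiable_cst.
    apply: differentiableD.
      apply: (@differentiable_comp _ _ _ _ (fst : R * R -> R) G); [exact: differentiable_fst2|exact: C11_diff HG].
    apply: (@differentiable_comp _ _ _ _ (snd : R * R -> R) h); [exact: differentiable_snd2|exact: C11_diff Hh].
  apply: (@differentiable_comp _ _ _ _ (snd : R * R -> R) r); [exact: differentiable_snd2|exact: C11_diff Hr].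
- apply: (@klipschitzW _ _ _ (2 * A * (D + E) * D + A * (2 * D))).
    exact: (@globally_properfilter _ _ (0, 0)).
  move=> [p q] _ /=; rewrite (surjective_pairing p) (surjective_pairing q) !test_d1 -!surjective_pairing.
  rewrite mulB; apply: le_trans (ler_normD _ _) _.
  rewrite [leRHS](_ : _ = 2 * A * ((D + E) * `|p - q|) * D + A * (2 * D * `|p - q|)); last by ring.
  rewrite !normrM lerD// ler_pM//; [|by case: HD|by case: HA|].
    by rewrite (le_trans (C11_dlip HA _ _))// ler_wpM2l// mulr_ge0// ltW.
  by rewrite (le_trans (C11_dlip HD _ _))// ler_wpM2l// mulr_ge0// ltW.
- apply: (@klipschitzW _ _ _ (2 * A * (D + E) * E + A * (2 * E) + 2 * F)).
    exact: (@globally_properfilter _ _ (0, 0)).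
  move=> [p q] _ /=; rewrite (surjective_pairing p) (surjective_pairing q) !test_d2 -!surjective_pairing.
  rewrite opprD addrACA; apply: le_trans (ler_normD _ _) _.
  rewrite [leRHS]mulrDl lerD//; last first.
    by rewrite (le_trans (C11_dlip HF _ _))// ler_wpM2l// mulr_ge0// ltW.
  rewrite mulB; apply: le_trans (ler_normD _ _) _.
  rewrite [leRHS](_ : _ = 2 * A * ((D + E) * `|p - q|) * E + A * (2 * E * `|p - q|)); last by ring.
  rewrite !normrM lerD// ler_pM//; [|by case: HE|by case: HA|].
    by rewrite (le_trans (C11_dlip HA _ _))// ler_wpM2l// mulr_ge0// ltW.
  by rewrite (le_trans (C11_dlip HE _ _))// ler_wpM2l// mulr_ge0// ltW.
Qed.

End partial.

Section contact.
Variable R : realType.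
Local Notation mu := (@lebesgue_measure R).
Variables (c : R -> R) (beta : R * R -> R) (T M : R) (u : R * R -> R).
Hypothesis ucont : {within strip T, continuous u}.
Hypothesis uM : forall p, strip T p -> `|u p| <= M.

Lemma hj_lhs_eq d phi w t x : (forall y, w (t, y) = u (t, y)) ->
  hj_lhs c beta d phi w t x = hj_lhs c beta d phi u t x.
Proof.
move=> wu; rewrite /hj_lhs.
by have -> : (fun y => w (t, y)) = (fun y => u (t, y)) by apply/funext.
Qed.

(** Contact is usually known only on [s0, T'], with an unbounded h, whereas test
    functions must be bounded and touch on [0, T'].  Adding to g a large multiple
    of a function that vanishes near t0 and is positive before s0 takes care of
    the times in [0, s0], and composition with [hcut K] of the boundedness.  The
    sign s = 1 serves subsolutions and s = -1 supersolutions. *)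
Lemma contact_test (s0 T' t0 x0 : R) (g g' h h' : R -> R) (Ch s : R) :
  0 <= s0 -> s0 < t0 -> t0 <= T' -> T' < T -> C11 g g' -> C11 h h' ->
  (forall x, - Ch <= h x) -> s ^+ 2 = 1 ->
  (forall t x, s0 <= t <= T' ->
     s * u (t, x) - g t - h x <= s * u (t0, x0) - g t0 - h x0) ->
  exists K G G', [/\ 1 <= K, C11 G G', G t0 = g t0, G' t0 = g' t0 &
   forall t x, 0 <= t <= T' ->
     s * u (t, x) - s * u (t0, x0) <= hcut K (G t + h x - (g t0 + h x0))].
Proof.
move=> s00 s0t0 t0T T'T gC hC hB s2 cont.
have sn : `|s| = 1.
  by apply/eqP; rewrite -sqrp_eq1// real_normK ?num_real// s2.
have st0 : strip T (t0, x0) by rewrite /strip/=; apply/andP; split; lra.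
have M0 : 0 <= M by apply: le_trans (uM st0).
have [Cg Cg0 gCg] := C11_gt0 gC.
pose s1 := (s0 + t0) / 2.
have hs : 0 < hub (s1 - s0).
  by apply: hub_gt0; rewrite /s1; lra.
pose N := (2 * M + Cg * T + Ch + `|h x0|) / hub (s1 - s0).
have NE : N * hub (s1 - s0) = 2 * M + Cg * T + Ch + `|h x0|.
  by rewrite /N divfK// gt_eqF.
have Ch0 : 0 <= Ch + `|h x0|.
  by have := hB x0; have := ler_norm (h x0); lra.
have N0 : 0 <= N.
  rewrite /N divr_ge0 ?(ltW hs)//.
  have : 0 <= Cg * T by apply: mulr_ge0; lra.
  lra.
pose G t := g t + N * hub (s1 - t).
pose G' t := g' t + N * - clamp01 (s1 - t).
have z0 : s1 - t0 <= 0 by rewrite /s1; lra.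
exists (2 * M + 1), G, G'; split.
- by lra.
- by apply: C11D => //; apply: C11Z; exact: (C11_refl s1 (@C11_hub R)).
- by rewrite /G hub_eq0// mulr0 addr0.
- by rewrite /G' clamp01_eq0// oppr0 mulr0 addr0.
- move=> t x /andP[t0' tT'].
  have K1 : 1 <= 2 * M + 1 by lra.
  have sttx : strip T (t, x) by rewrite /strip/= t0'/=; lra.
  have d2M : s * u (t, x) - s * u (t0, x0) <= 2 * M.
    rewrite -mulrBr (le_trans (ler_norm _))// normrM sn mul1r.
    rewrite (le_trans (ler_normB _ _))//.
    by have := uM sttx; have := uM st0; lra.
  apply: le_trans (hcut_ge _ K1); rewrite le_min; apply/andP; split; last lra.
  have hub0 := hub_ge0 (s1 - t).
  have Nh : 0 <= N * hub (s1 - t) by rewrite mulr_ge0.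
  have [ts0|ts0] := leP s0 t.
    have := cont t x; rewrite ts0 tT' => /(_ isT); rewrite /G; lra.
  have hle : N * hub (s1 - s0) <= N * hub (s1 - t).
    by rewrite ler_wpM2l// hub_nd//; lra.
  have gle : g t0 - g t <= Cg * T.
    apply: le_trans (ler_norm _) _; apply: le_trans (C11_lip gCg _ _) _.
    by rewrite ler_wpM2l ?(ltW Cg0)// ger0_norm; lra.
  have := hB x; have := ler_norm (h x0); rewrite /G; lra.
Qed.

(** The extra term r, which vanishes to first order at x0, leaves the contact
    untouched but may change the nonlocal term; it is the freedom used to prove
    that contact slopes are nonnegative. *)
Lemma sub_contact0 (s0 T' t0 x0 : R) (g g' h h' : R -> R) (Ch : R) :
  viscosity_subsolution c beta T (usc_env (strip T) u) ->
  0 <= s0 -> s0 < t0 -> t0 <= T' -> T' < T -> C11 g g' -> C11 h h' ->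
  (forall x, - Ch <= h x) ->
  (forall t x, s0 <= t <= T' ->
     u (t, x) - g t - h x <= u (t0, x0) - g t0 - h x0) ->
  exists2 K, 1 <= K & forall r r' Cr d, C11 r r' -> (forall x, 0 <= r x <= Cr) ->
    r x0 = 0 -> r' x0 = 0 -> 0 < d ->
  g' t0 + h' x0 * c x0 *
   (A_in d%:E (fun y => hcut K (h y - h x0) + r y) x0 + A_out d%:E (fun y => u (t0, y)) x0)
   + B beta x0 (fun y => u (t0, y)) * h' x0 <= 0.
Proof.
move=> [_ sub] s00 s0t0 t0T T'T gC hC hB cont.
have [|K [G [G' [K1 GC Gt0 G't0 test]]]] :=
  @contact_test s0 T' t0 x0 g g' h h' Ch 1 s00 s0t0 t0T T'T gC hC hB (expr1n _ _).
  by move=> t x; rewrite !mul1r; exact: cont.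
exists K => // r r' Cr d rC rB r0 r'0 d0.
pose k := g t0 + h x0.
pose phi (p : R * R) : R := hcut K (G p.1 + h p.2 - k) + r p.2.
have phiC : C11b phi.
  apply: (@test_C11b _ _ _ _ _ _ _ _ _ (C11_hcut K) GC hC rC k Cr (3 * K)).
    by move=> x; have /andP[a b] := rB x; rewrite ger0_norm.
  by move=> x; exact: hcut_bnd.
have envE t x : 0 <= t <= T' -> usc_env (strip T) u (t, x) = u (t, x).
  move=> /andP[a b]; apply: usc_env_cont => //; rewrite /strip/= a/=; lra.
have dE : (0 < d%:E)%E by rewrite lte_fin.
have := sub T' _ phi phiC _ dE t0 x0 _ _.
have t0i : 0 < t0 <= T' by apply/andP; split; lra.
have T'i : 0 < T' < T by apply/andP; split; lra.
have z : G t0 + h x0 - k = 0 by rewrite Gt0 /k; ring.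
have phi0 : phi (t0, x0) = 0 by rewrite /phi/= z hcut0// add0r.
move=> /(_ T'i t0i).
have mx t x : 0 <= t <= T' ->
    usc_env (strip T) u (t, x) - phi (t, x) <= usc_env (strip T) u (t0, x0) - phi (t0, x0).
  move=> tT; rewrite !envE//; last by apply/andP; split; lra.
  rewrite phi0 subr0 /phi/=; have := test t x tT; rewrite !mul1r.
  by have /andP[a _] := rB x; rewrite /k; lra.
move=> /(_ mx).
rewrite (@hj_lhs_eq _ _ (usc_env (strip T) u)); last first.
  by move=> y; apply: envE; apply/andP; split; lra.
rewrite /hj_lhs (test_d1 _ _ (C11_hcut K) GC) (test_d2 _ (C11_hcut K) hC rC) z dhcut0// !mul1r.
rewrite r'0 addr0 G't0.
have -> // : (fun y => phi (t0, y)) = (fun y => hcut K (h y - h x0) + r y).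
by apply/funext => y; rewrite /phi/= Gt0 /k; congr (hcut K _ + _); ring.
Qed.

Lemma super_contact0 (s0 T' t0 x0 : R) (g g' h h' : R -> R) (Ch : R) :
  viscosity_supersolution c beta T (lsc_env (strip T) u) ->
  0 <= s0 -> s0 < t0 -> t0 <= T' -> T' < T -> C11 g g' -> C11 h h' ->
  (forall x, - Ch <= h x) ->
  (forall t x, s0 <= t <= T' ->
     u (t0, x0) + g t0 + h x0 <= u (t, x) + g t + h x) ->
  exists2 K, 1 <= K & forall d, 0 < d ->
  0 <= - g' t0 - h' x0 * c x0 *
   (A_in d%:E (fun y => - hcut K (h y - h x0)) x0 + A_out d%:E (fun y => u (t0, y)) x0)
   - B beta x0 (fun y => u (t0, y)) * h' x0.
Proof.
move=> [_ sup] s00 s0t0 t0T T'T gC hC hB cont.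
have [| |K [G [G' [K1 GC Gt0 G't0 test]]]] :=
  @contact_test s0 T' t0 x0 g g' h h' Ch (-1) s00 s0t0 t0T T'T gC hC hB.
- by rewrite sqrrN expr1n.
- by move=> t x /(cont t x); lra.
exists K => // d d0.
pose k := g t0 + h x0.
have PC := C11N (C11_hcut K).
have rC := C11_cst (0 : R).
pose phi (p : R * R) : R := - hcut K (G p.1 + h p.2 - k) + cst 0 p.2.
have phiC : C11b phi.
  apply: (@test_C11b _ _ _ _ _ _ _ _ _ PC GC hC rC k 0 (3 * K)).
    by move=> x; rewrite normr0.
  by move=> x; rewrite normrN; exact: hcut_bnd.
have envE t x : 0 <= t <= T' -> lsc_env (strip T) u (t, x) = u (t, x).
  move=> /andP[a b]; apply: lsc_env_cont => //; rewrite /strip/= a/=; lra.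
have dE : (0 < d%:E)%E by rewrite lte_fin.
have := sup T' _ phi phiC _ dE t0 x0 _ _.
have t0i : 0 < t0 <= T' by apply/andP; split; lra.
have T'i : 0 < T' < T by apply/andP; split; lra.
have z : G t0 + h x0 - k = 0 by rewrite Gt0 /k; ring.
have phi0 : phi (t0, x0) = 0 by rewrite /phi/= z hcut0// oppr0 add0r.
move=> /(_ T'i t0i).
have mx t x : 0 <= t <= T' ->
    lsc_env (strip T) u (t0, x0) - phi (t0, x0) <= lsc_env (strip T) u (t, x) - phi (t, x).
  move=> tT; rewrite !envE//; last by apply/andP; split; lra.
  by rewrite phi0 subr0 /phi/= /cst; have := test t x tT; rewrite /k; lra.
move=> /(_ mx).
rewrite (@hj_lhs_eq _ _ (lsc_env (strip T) u)); last first.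
  by move=> y; apply: envE; apply/andP; split; lra.
rewrite /hj_lhs (test_d1 _ _ PC GC) (test_d2 _ PC hC rC) z dhcut0// !mulN1r.
rewrite /cst addr0 G't0 mulrN !mulNr.
have -> // : (fun y => phi (t0, y)) = (fun y => - hcut K (h y - h x0)).
by apply/funext => y; rewrite /phi/= /cst addr0 Gt0 /k; congr (- hcut K _); ring.
Qed.

End contact.

(** * Viscosity inequalities at a contact point *)

Lemma fst_cont (R : realType) : continuous (fst : R * R -> R).
Proof. by move=> p; exact: cvg_fst. Qed.
Lemma snd_cont (R : realType) : continuous (snd : R * R -> R).
Proof. by move=> p; exact: cvg_snd. Qed.

Section sd_lemmas.
Variable R : realType.
Local Notation mu := (@lebesgue_measure R).

Lemma C11_sd (f f' : R -> R) : C11 f f' ->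
  exists2 C, 0 < C & forall x z, `|sd f x z| <= C * z ^+ 2.
Proof.
move=> /C11_gt0[C C0 [_ fC]]; exists (2 * C); first by rewrite mulr_gt0.
move=> x z; have A := fC x z; have B := fC x (- z).
rewrite sqrrN in B.
have -> : sd f x z = - (f (x + z) - f x - f' x * z) - (f (x - z) - f x - f' x * - z).
  by rewrite /sd; ring.
rewrite (le_trans (ler_normB _ _))// normrN.
by apply: le_trans (lerD A B) _; rewrite -mulrDl; lra.
Qed.

Lemma C11_measurable (f f' : R -> R) : C11 f f' -> measurable_fun setT f.
Proof. by move=> /C11_cont; exact: continuous_measurable_fun. Qed.

(** The integrand of A_{-d} is bounded for C^{1,1} functions: as d tends to 0
    only the part A_d of the solution itself survives. *)
Lemma A_in_le (f f' : R -> R) (x C : R) : C11 f f' -> (forall z, `|f z| <= C) ->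
  exists2 D, 0 < D & forall d, 0 < d -> `|A_in d%:E f x| <= D * d.
Proof.
move=> fC fb; have [D D0 H] := C11_sd fC; exists D => // d d0.
have mf := C11_measurable fC.
rewrite (A_inE d0 mf fb (H x)); apply: int_near0_le => //.
exact: measurable_sd.
Qed.

End sd_lemmas.

Section solution.
Variable R : realType.
Local Notation mu := (@lebesgue_measure R).
Variables (c : R -> R) (beta : R * R -> R) (T M : R) (u : R * R -> R).
Hypothesis ucont : {within strip T, continuous u}.
Hypothesis uM : forall p, strip T p -> `|u p| <= M.

(** The viscosity inequality in the form used later: the test function has
    disappeared from the nonlocal term, at the price of an error O(d). *)
Lemma sub_ineq (s0 T' t0 x0 : R) (g g' h h' : R -> R) (Ch : R) :
  viscosity_subsolution c beta T (usc_env (strip T) u) ->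
  0 <= s0 -> s0 < t0 -> t0 <= T' -> T' < T -> C11 g g' -> C11 h h' ->
  (forall x, - Ch <= h x) ->
  (forall t x, s0 <= t <= T' ->
     u (t, x) - g t - h x <= u (t0, x0) - g t0 - h x0) ->
  exists2 D, 0 < D & forall d, 0 < d ->
  g' t0 + h' x0 * (c x0 * A_out d%:E (fun y => u (t0, y)) x0
   + B beta x0 (fun y => u (t0, y))) <= D * d.
Proof.
move=> sub s00 s0t0 t0T T'T gC hC hB cont.
have [K K1 H] := sub_contact0 ucont uM sub s00 s0t0 t0T T'T gC hC hB cont.
have FC : C11 (fun y => hcut K (h y - h x0) + cst 0 y) _ :=
  C11D (C11_comp (C11_hcut K) (C11D hC (C11_cst (- h x0)))) (C11_cst 0).
have Fb y : `|hcut K (h y - h x0) + cst 0 y| <= 3 * K.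
  by rewrite /cst addr0; exact: hcut_bnd.
have [D D0 HD] := A_in_le x0 FC Fb.
exists (`|h' x0 * c x0| * D + 1) => [|d d0]; first by rewrite ltr_pwDr// mulr_ge0// ltW.
have H0 (x : R) : (0 : R) <= (cst 0 x : R) <= (0 : R) by rewrite /cst !lexx.
have := H _ _ 0 d (C11_cst 0) H0 erefl erefl d0.
set a := A_in _ _ _; set b := A_out _ _ _; set e := B _ _ _.
have ha : `|a| <= D * d by exact: HD.
have : `|h' x0 * c x0 * a| <= `|h' x0 * c x0| * D * d.
  by rewrite normrM -mulrA ler_wpM2l.
rewrite ler_norml => /andP[h1 _] h2.
rewrite mulrDl mul1r; lra.
Qed.

Lemma super_ineq (s0 T' t0 x0 : R) (g g' h h' : R -> R) (Ch : R) :
  viscosity_supersolution c beta T (lsc_env (strip T) u) ->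
  0 <= s0 -> s0 < t0 -> t0 <= T' -> T' < T -> C11 g g' -> C11 h h' ->
  (forall x, - Ch <= h x) ->
  (forall t x, s0 <= t <= T' ->
     u (t0, x0) + g t0 + h x0 <= u (t, x) + g t + h x) ->
  exists2 D, 0 < D & forall d, 0 < d ->
  g' t0 + h' x0 * (c x0 * A_out d%:E (fun y => u (t0, y)) x0
   + B beta x0 (fun y => u (t0, y))) <= D * d.
Proof.
move=> sup s00 s0t0 t0T T'T gC hC hB cont.
have [K K1 H] := super_contact0 ucont uM sup s00 s0t0 t0T T'T gC hC hB cont.
have FC : C11 (fun y => - hcut K (h y - h x0)) _ :=
  C11N (C11_comp (C11_hcut K) (C11D hC (C11_cst (- h x0)))).
have Fb y : `|- hcut K (h y - h x0)| <= 3 * K.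
  by rewrite normrN; exact: hcut_bnd.
have [D D0 HD] := A_in_le x0 FC Fb.
exists (`|h' x0 * c x0| * D + 1) => [|d d0]; first by rewrite ltr_pwDr// mulr_ge0// ltW.
have := H d d0.
set a := A_in _ _ _; set b := A_out _ _ _; set e := B _ _ _.
have ha : `|a| <= D * d by exact: HD.
have : `|h' x0 * c x0 * a| <= `|h' x0 * c x0| * D * d.
  by rewrite normrM -mulrA ler_wpM2l.
rewrite ler_norml => /andP[h1 _] h2.
rewrite mulrDl mul1r; lra.
Qed.

Definition clampt (a b t : R) := Num.max a (Num.min t b).

Lemma clampt_in a b t : a <= b -> a <= clampt a b t <= b.
Proof. by move=> ab; rewrite /clampt le_max lexx ge_max ab ge_min lexx orbT. Qed.

Lemma clampt_id a b t : a <= t <= b -> clampt a b t = t.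
Proof. by move=> /andP[at' tb]; rewrite /clampt (min_idPl tb) (max_idPr at'). Qed.

Lemma clampt_cont a b : continuous (clampt a b).
Proof.
move=> t; apply: (@continuous_max R R (cst a) (fun t => Num.min t b) t).
  exact: cvg_cst.
by apply: (@continuous_min R R id (cst b) t); [exact: cvg_id|exact: cvg_cst].
Qed.

(** The solution is continuous only on the strip; freezing it outside [a, b]
    gives a continuous function on the plane, to which compactness arguments
    and measurability results apply. *)
Definition uext (a b : R) (p : R * R) : R := u (clampt a b p.1, p.2).

Lemma uext_cont a b : 0 <= a -> a <= b -> b < T -> continuous (uext a b).
Proof.
move=> a0 ab bT p.
have inS t x : strip T (clampt a b t, x).
  by have /andP[h1 h2] := clampt_in t ab; rewrite /strip/=; apply/andP; split; lra.
have := within_cont_cvg ucont (inS p.1 p.2).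
apply: cvg_trans.
have cl : (fun q : R * R => (clampt a b q.1, q.2)) @ p --> (clampt a b p.1, p.2).
  apply: (@cvg_pair _ _ _ (nbhs p) (nbhs (clampt a b p.1)) (nbhs p.2)); last exact: snd_cont.
  apply: (@continuous_comp _ _ _ (fst : R * R -> R) (clampt a b)); first exact: fst_cont.
  exact: clampt_cont.
move=> P /=; rewrite /nbhs/= /within/= => HP.
have := cl _ HP; rewrite /nbhs/=; apply: filterS => q /=; apply; exact: inS.
Qed.

Lemma slice_cont t : 0 <= t < T -> continuous (fun y => u (t, y)).
Proof.
move=> /andP[t0 tT].
have E : (fun y => u (t, y)) = uext t t \o (fun y => (t, y)).
  apply/funext => y; rewrite /uext/=; congr (u (_, _)).
  by rewrite clampt_id// lexx.
rewrite E => y; apply: continuous_comp; last exact: uext_cont.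
by apply: (@cvg_pair _ _ _ (nbhs y) (nbhs t) (nbhs y)); [exact: cvg_cst|exact: cvg_id].
Qed.

Lemma slice_meas t : 0 <= t < T -> measurable_fun setT (fun y => u (t, y)).
Proof. by move=> /slice_cont; exact: continuous_measurable_fun. Qed.

Lemma exists_max2 (F : R * R -> R) (a b X t1 x1 : R) : a <= b -> continuous F ->
  a <= t1 <= b ->
  (forall t x, a <= t <= b -> X < `|x| -> F (t, x) <= F (t1, x1)) ->
  exists t0 x0, a <= t0 <= b /\ forall t x, a <= t <= b -> F (t, x) <= F (t0, x0).
Proof.
move=> ab Fc t1ab far; pose X' := Num.max X `|x1|.
pose K : set (R * R) := `[a, b] `*` `[- X', X'].
have K1 : K (t1, x1).
  split => /=; rewrite in_itv//=.
  by rewrite -ler_norml /X' le_max lexx orbT.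
have cK : compact K by apply: compact_setX; exact: segment_compact.
have [|||[t0 x0] /set_mem[K0a K0b] mx'] := @compact_EVT_max _ _ F K.
- by exists (t1, x1).
- exact: cK.
- exact: continuous_subspaceT.
have mx p : K p -> F p <= F (t0, x0) by move=> /mem_set; exact: mx'.
exists t0, x0; split; first by move: K0a; rewrite /= in_itv.
move=> t x tab; have [xX|xX] := leP `|x| X'.
  apply: mx; split => /=; rewrite in_itv/=; first exact: tab.
  by rewrite -ler_norml.
apply: le_trans (mx _ K1); apply: far => //.
by apply: le_lt_trans xX; rewrite /X' le_max lexx.
Qed.

(** A bounded bump equal to z^2/2 on [-1, 1], normalised so that its
    contribution to A_{-1} at 0 is exactly -1. *)
Let qb (z : R) := ehub z - hub (z - 1) - hub (- z - 1).
Let qb' (z : R) := dehub z - clamp01 (z - 1) + clamp01 (- z - 1).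

Lemma qb_C11 : C11 qb qb'.
Proof.
have H := C11B (C11B (@C11_ehub R) (C11_shift 1 (@C11_hub R))) (C11_refl (-1) (@C11_hub R)).
move: H; rewrite /qb /qb'; under eq_fun do rewrite (addrC (-1)).
by under [X in C11 _ X]eq_fun do rewrite opprK (addrC (-1)).
Qed.

Lemma qb_bnd z : 0 <= qb z <= 1.
Proof.
have H (s : R) : 0 <= hub s - hub (s - 1) <= 1.
  have := @hub_nd R (s - 1) s; rewrite lerBlDr lerDl ler01 => /(_ isT) h1.
  rewrite subr_ge0 h1/=.
  have := hubE s; have := @hub_conv R (clamp01 s) (s - 1).
  rewrite clamp01_ge0 clamp01_le1 => /(_ isT) h2 h3.
  have := clamp01_le1 s; rewrite mulrBr mulr1 in h2; lra.
have [z0|z0] := leP z 0.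
  have := H (- z); rewrite /qb /ehub (@hub_eq0 _ z)// (@hub_eq0 _ (z - 1)); last lra.
  by rewrite add0r subr0.
have := H z; rewrite /qb /ehub (@hub_eq0 _ (- z))//; last lra.
by rewrite (@hub_eq0 _ (- z - 1))//; last lra; rewrite addr0 subr0.
Qed.

Lemma qb_quad z : 0 < z < 1 -> qb z = z ^+ 2 / 2 /\ qb (- z) = z ^+ 2 / 2.
Proof.
move=> /andP[z0 z1]; rewrite /qb /ehub opprK !(@hub_eq0 _ (- z))//; try lra.
rewrite !(@hub_eq0 _ (z - 1)) ?(@hub_eq0 _ (- z - 1)); try lra.
by rewrite hub_quad; [split; ring|lra].
Qed.

Lemma qb0 : qb 0 = 0 /\ qb' 0 = 0.
Proof.
rewrite /qb /qb' /ehub /dehub !oppr0 !sub0r (@hub_eq0 _ 0)// (@hub_eq0 _ (-1)) ?lerN10//.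
by rewrite (@clamp01_eq0 _ 0)// (@clamp01_eq0 _ (-1)) ?lerN10// !subr0 !addr0.
Qed.

Lemma A_in_qb x0 : A_in (1%:E) (fun y => qb (y - x0)) x0 = -1.
Proof.
have qC := C11_shift x0 qb_C11; have [D D0 H] := C11_sd qC.
rewrite (@A_inE _ 1 _ _ 1 D)//; first last.
- by move=> z; have /andP[a b] := qb_bnd (z - x0); rewrite ger0_norm.
- exact: C11_measurable qC.
rewrite (@eq_Rintegral _ _ _ mu _ (cst (-1))); last first.
  move=> z /set_mem; rewrite /= in_itv/= => z01.
  have [e1 e2] := qb_quad z01; rewrite /sd subrr qb0.1.
  have z0 : z != 0 by rewrite gt_eqF//; case/andP: z01.
  rewrite (_ : x0 + z - x0 = z); last by ring.
  rewrite (_ : x0 - z - x0 = - z); last by ring.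
  by rewrite e1 e2 /cst; field.
rewrite Rintegral_cst//= lebesgue_measure_itv/= lte_fin ltr01 -EFinD/=.
by rewrite subr0 mulr1.
Qed.

(** Replacing phi by phi + k qb(x - x0) keeps the contact (qb is nonnegative) and
    the first derivatives, and changes A_{-1} phi(x0) by -k.  With slope times c
    negative, letting k grow contradicts the subsolution inequality. *)
Lemma contact_slope_ge0 (s0 T' t0 x0 : R) (g g' h h' : R -> R) (Ch : R) :
  (forall x, 0 < c x) ->
  viscosity_subsolution c beta T (usc_env (strip T) u) ->
  0 <= s0 -> s0 < t0 -> t0 <= T' -> T' < T -> C11 g g' -> C11 h h' ->
  (forall x, - Ch <= h x) ->
  (forall t x, s0 <= t <= T' ->
     u (t, x) - g t - h x <= u (t0, x0) - g t0 - h x0) ->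
  0 <= h' x0.
Proof.
move=> cpos sub s00 s0t0 t0T T'T gC hC hB cont.
have [K K1 H] := sub_contact0 ucont uM sub s00 s0t0 t0T T'T gC hC hB cont.
rewrite leNgt; apply/negP => hneg.
have FC := C11_comp (C11_hcut K) (C11D hC (C11_cst (- h x0))).
have qC := C11_shift x0 qb_C11.
pose F y := hcut K (h y - h x0).
have Fb y : `|F y| <= 3 * K by exact: hcut_bnd.
have [D D0 HD] := C11_sd FC; have [E E0 HE] := C11_sd qC.
have {}HD z : `|sd F x0 z| <= D * z ^+ 2 := HD x0 z.
have {}HE z : `|sd (fun y => qb (y - x0)) x0 z| <= E * z ^+ 2 := HE x0 z.
have lin k : 0 <= k -> A_in 1%:E (fun y => F y + k * qb (y - x0)) x0 =
    A_in 1%:E F x0 - k.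
  move=> k0.
  have mF := C11_measurable FC; have mq := C11_measurable qC.
  have qb1 z : `|qb (z - x0)| <= 1.
    by have /andP[a b] := qb_bnd (z - x0); rewrite ger0_norm.
  rewrite -[- k]mulr1 mulNr -mulrN -(A_in_qb x0).
  rewrite (@A_inE _ 1 F x0 (3 * K) D)//.
  rewrite (@A_inE _ 1 (fun y => qb (y - x0)) x0 1 E)//.
  have sdE z : sd (fun y => F y + k * qb (y - x0)) x0 z =
      sd F x0 z + k * sd (fun y => qb (y - x0)) x0 z by rewrite /sd; ring.
  rewrite (@A_inE _ 1 _ x0 (3 * K + k) (D + k * E))//.
  - rewrite -RintegralZl//; last by apply: (integrable_near0 _ (measurable_sd x0 mq)); exact: HE.
    rewrite -RintegralD//.
    + by apply: eq_Rintegral => z _; rewrite sdE mulrDl mulrA.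
    + by apply: (integrable_near0 _ (measurable_sd x0 mF)); exact: HD.
    + have := @integrableZl _ _ _ mu _ _ k _ (integrable_near0 1 (measurable_sd x0 mq) HE).
      by apply.
  - apply: measurable_funD => //; apply: measurable_funM => //; exact: measurable_cst.
  - move=> z; rewrite (le_trans (ler_normD _ _))// lerD// normrM (ger0_norm k0).
    by rewrite ler_piMr.
  - move=> z; rewrite sdE (le_trans (ler_normD _ _))// [leRHS]mulrDl lerD//.
    by rewrite normrM (ger0_norm k0) -mulrA ler_wpM2l.
pose Z := g' t0 + h' x0 * c x0 * (A_in 1%:E F x0 + A_out 1%:E (fun y => u (t0, y)) x0)
   + B beta x0 (fun y => u (t0, y)) * h' x0.
pose k := (`|Z| + 1) / - (h' x0 * c x0).
have hc : 0 < - (h' x0 * c x0) by rewrite -mulNr mulr_gt0// oppr_gt0.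
have k0 : 0 <= k by rewrite divr_ge0// ?ltW//; have := normr_ge0 Z; lra.
have := H (fun y => k * qb (y - x0)) _ k 1 (C11Z k qC).
rewrite !subrr qb0.1 qb0.2 !mulr0 => /(_ _ erefl erefl ltr01).
have kb x : 0 <= k * qb (x - x0) <= k.
  by have /andP[a b] := qb_bnd (x - x0); rewrite mulr_ge0//= ler_piMr.
move=> /(_ kb); rewrite lin//.
have -> : g' t0 + h' x0 * c x0 * (A_in 1%:E F x0 - k + A_out 1%:E (fun y => u (t0, y)) x0)
   + B beta x0 (fun y => u (t0, y)) * h' x0 = Z + k * - (h' x0 * c x0) by rewrite /Z; ring.
rewrite /k divfK ?gt_eqF//.
by have := ler_norm (- Z); rewrite normrN; lra.
Qed.

End solution.

(** * Monotonicity in space *)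

Section mono.
Variable R : realType.
Variables (c : R -> R) (beta : R * R -> R) (T M : R) (u : R * R -> R).
Hypothesis ucont : {within strip T, continuous u}.
Hypothesis uM : forall p, strip T p -> `|u p| <= M.

Lemma u_near (t1 x1 e : R) : 0 <= t1 < T -> 0 < e ->
  exists2 d, 0 < d & forall t x, 0 <= t < T -> `|t - t1| < d -> `|x - x1| < d ->
    `|u (t, x) - u (t1, x1)| < e.
Proof.
move=> t1T e0.
have := within_cont_cvg ucont (t1T : strip T (t1, x1)).
move/cvgrPdist_lt => /(_ e e0); rewrite /within/= => H.
have := @nbhs_ballP R (R * R)%type (t1, x1) _ => /(_ _)/iffLR /(_ H) [d /= d0 bd].
exists d => // t x tT td xd.
rewrite distrC; apply: bd => //=.
by split => /=; rewrite /ball/= distrC.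
Qed.

Lemma continuous_C11_fst (g g' : R -> R) : C11 g g' -> continuous (fun p : R * R => g p.1).
Proof.
move=> gC p; apply: (@continuous_comp _ _ _ (fst : R * R -> R) g); first exact: fst_cont.
exact: (C11_cont gC).
Qed.

Lemma continuous_C11_snd (g g' : R -> R) : C11 g g' -> continuous (fun p : R * R => g p.2).
Proof.
move=> gC p; apply: (@continuous_comp _ _ _ (snd : R * R -> R) g); first exact: snd_cont.
exact: (C11_cont gC).
Qed.

Lemma exists_contact (s : R) (a b X t1 x1 : R) (g g' h h' : R -> R) :
  0 <= a -> a <= b -> b < T -> C11 g g' -> C11 h h' -> a <= t1 <= b ->
  (forall t x, a <= t <= b -> X < `|x| ->
     s * u (t, x) - g t - h x <= s * u (t1, x1) - g t1 - h x1) ->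
  exists t0 x0, a <= t0 <= b /\ forall t x, a <= t <= b ->
     s * u (t, x) - g t - h x <= s * u (t0, x0) - g t0 - h x0.
Proof.
move=> a0 ab bT gC hC t1ab far.
pose F (p : R * R) : R := s * uext u a b p - g p.1 - h p.2.
have Fc : continuous F.
  move=> p; apply: cvgB; last exact: (continuous_C11_snd hC).
  apply: cvgB; last exact: (continuous_C11_fst gC).
  by apply: cvgM; [exact: cvg_cst|exact: uext_cont].
have FE t x : a <= t <= b -> F (t, x) = s * u (t, x) - g t - h x.
  by move=> tab; rewrite /F /uext/= clampt_id.
have [|t0 [x0 [t0ab mx]]] := @exists_max2 R F a b X t1 x1 ab Fc t1ab.
  by move=> t x tab xX; rewrite !FE//; exact: far.
by exists t0, x0; split => // t x tab; rewrite -!FE//; exact: mx.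
Qed.

(** If u(t1, a) > u(t1, b) with a < b, touch u from above by
    N ehub(t - t1) + N hub(a - x) + N hub(x - b) - k x with N large and k small.
    The contact point lies near time t1; slopes being nonnegative, it lies to
    the right of b, and N large keeps it close to b.  There u is close to
    u(t1, b), hence smaller than u(t1, a): a is a better point. *)
Lemma u_mono_pos (t1 a b : R) : (forall x, 0 < c x) ->
  viscosity_subsolution c beta T (usc_env (strip T) u) ->
  0 < t1 < T -> a < b -> u (t1, a) <= u (t1, b).
Proof.
move=> cpos sub /andP[t10 t1T] ab; rewrite leNgt; apply/negP => lt_ba.
set m := u (t1, a) - u (t1, b).
have m0 : 0 < m by rewrite subr_gt0.
have M0 : 0 <= M.
  have st : strip T (t1, a) by rewrite /strip/=; apply/andP; split; lra.
  by apply: le_trans (uM st).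
pose T' := (t1 + T) / 2.
pose k := m / (4 * (b - a)).
have k0 : 0 < k by rewrite divr_gt0// mulr_gt0//; lra.
have kE : k * (b - a) = m / 4 by rewrite /k; field; lra.
have t1i : 0 <= t1 < T by apply/andP; split; lra.
have m4 : 0 < m / 4 by lra.
have [d d0 dP] := u_near b t1i m4.
pose e := Num.min d (Num.min t1 (m / (4 * k))).
have e0 : 0 < e by rewrite /e !lt_min d0 t10 divr_gt0//; lra.
have ke : k * e <= m / 4.
  have : e <= m / (4 * k) by rewrite /e !ge_min lexx !orbT.
  rewrite ler_pdivlMr; last by lra.
  lra.
have ed : e <= d by rewrite /e ge_min lexx.
have et : e <= t1 by rewrite /e !ge_min lexx orbT.
have he : 0 < hub e by exact: hub_gt0.
pose N := k + (2 * M + k * (b - a) + k + m + 1) / hub e.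
have NE : (N - k) * hub e = 2 * M + k * (b - a) + k + m + 1.
  by rewrite /N addrAC subrr add0r divfK// gt_eqF.
have Nk : 0 <= N - k.
  rewrite /N addrAC subrr add0r divr_ge0// ?ltW//.
  have : 0 <= k * (b - a) by rewrite mulr_ge0//; lra.
  lra.
pose g t := N * ehub (t - t1).
pose g' t := N * dehub (t - t1).
pose h x := N * hub (a - x) + N * hub (x - b) + (- k * x + 0).
pose h' x := N * - clamp01 (a - x) + N * clamp01 (x - b) + cst (- k) x.
have gC : C11 g g' := C11Z N (C11_shift t1 (@C11_ehub R)).
have hC : C11 h h' := C11D (C11D (C11Z N (C11_refl a (@C11_hub R)))
  (C11Z N (C11_shift b (@C11_hub R)))) (C11_lin (- k) 0).
have N0 : 0 <= N by lra.
(* the penalty N hub beats the gain k x to the right of b *)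
have right x : - k * a - N * hub (x - b) + k * x <= k * (b - a) + k / 2 - (N - k) * hub (x - b).
  have A := hub_ge (x - b).
  have : k * (x - b - 2^-1) <= k * hub (x - b) by rewrite ler_pM2l.
  lra.
have hub0 s : 0 <= (N - k) * hub s by rewrite mulr_ge0// hub_ge0.
have Nhub s : 0 <= N * hub s by rewrite mulr_ge0// hub_ge0.
have st1 : 0 <= t1 <= T' by rewrite /T'; apply/andP; split; lra.
have inS t : 0 <= t <= T' -> 0 <= t < T.
  by move=> /andP[-> h0]/=; move: h0; rewrite /T'; lra.
have hlow x : - (`|k * b| + `|k * a| + k) <= h x.
  have := right x; have := hub0 (x - b); have := Nhub (a - x).
  have := ler_norm (k * b); have := normr_ge0 (k * a).
  rewrite /h addr0; lra.
have val1 : 1 * u (t1, a) - g t1 - h a = u (t1, a) + k * a.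
  rewrite /g /h !subrr ehub0 (@hub_eq0 _ 0)// (@hub_eq0 _ (a - b)); last lra.
  by rewrite !mulr0 mul1r; ring.
have ub t x : 0 <= t <= T' -> u (t, x) <= M.
  by move=> /inS tT; apply: le_trans (ler_norm _) (uM (tT : strip T (t, x))).
have lb t x : 0 <= t <= T' -> - M <= u (t, x).
  by move=> /inS tT; have := uM (tT : strip T (t, x)); rewrite ler_norml => /andP[].
have gge t : N * hub `|t - t1| <= g t.
  rewrite /g ler_wpM2l// /ehub.
  have [p|p] := leP 0 (t - t1); first by rewrite ger0_norm// lerDl hub_ge0.
  by rewrite ltr0_norm// lerDr hub_ge0.
have hle x : - h x <= k * b + k / 2 - (N - k) * hub (x - b).
  by have := right x; have := Nhub (a - x); rewrite /h addr0; lra.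
have hle2 x : - h x <= k * x.
  by have := Nhub (x - b); have := Nhub (a - x); rewrite /h addr0; lra.
have big x : e <= x - b -> 2 * M + k * (b - a) + k + m + 1 <= (N - k) * hub (x - b).
  by move=> ex; rewrite -NE ler_wpM2l// hub_nd.
have kba : k * (b - a) = k * b - k * a by ring.
have g0 t : 0 <= g t by apply: le_trans (gge t).
(* far from [a, b] the comparison function exceeds the oscillation of u *)
have [||| t0 [x0 [t0i mx]]] := @exists_contact 1 0 T' (`|a| + `|b| + e + (2 * M) / k + 1) t1 a g g' h h' (lexx 0) _ _ gC hC st1.
- by rewrite /T'; lra.
- by rewrite /T'; lra.
- move=> t x tT xX; rewrite val1 mul1r.
  have g0t := g0 t; have ubt := ub t x tT; have lba := lb _ a st1.
  have na := ler_norm (- a); have nb := ler_norm b; rewrite normrN in na.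
  have q0 : 0 <= 2 * M / k by rewrite divr_ge0 ?(ltW k0)// mulr_ge0.
  have na0 := normr_ge0 a; have nb0 := normr_ge0 b.
  have [x0|x0] := leP 0 x.
    rewrite (ger0_norm x0) in xX.
    have /big : e <= x - b by lra.
    by have := hle x; lra.
  rewrite (ltr0_norm x0) in xX.
  have : 2 * M / k <= a - x by lra.
  rewrite ler_pdivrMr// => H.
  by have := hle2 x; lra.
have mxa := mx t1 a st1; rewrite val1 mul1r in mxa.
have ub0 := ub _ x0 t0i; have lba := lb _ a st1.
have te : `|t0 - t1| < e.
  rewrite ltNge; apply/negP => et0.
  have A := hub_nd et0; have B := gge t0; have C := hle x0; have D := hub0 (x0 - b).
  have E : N * hub e <= N * hub `|t0 - t1| by rewrite ler_wpM2l.
  have F : 0 <= k * hub e by rewrite mulr_ge0// ltW.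
  lra.
have t00 : 0 < t0.
  by move: te; rewrite ltr_norml; lra.
have hs : 0 <= h' x0.
  apply: (@contact_slope_ge0 _ c beta T M u ucont uM 0 T' t0 x0 g g' h h' (`|k * b| + `|k * a| + k)) => //.
  - by case/andP: t0i.
  - by rewrite /T'; lra.
  - by move=> t x tT; have := mx t x tT; rewrite !mul1r.
have xb : b <= x0.
  rewrite leNgt; apply/negP => xb; move: hs; rewrite /h' (@clamp01_eq0 _ (x0 - b)); last lra.
  rewrite mulr0 addr0 /cst.
  have : 0 <= N * clamp01 (a - x0) by rewrite mulr_ge0// clamp01_ge0.
  lra.
have [ex|ex] := leP e (x0 - b).
  by have := big _ ex; have := hle x0; have := g0 t0; lra.
have := dP t0 x0 (inS _ t0i) (lt_le_trans te ed).
have -> : `|x0 - b| < d by rewrite ger0_norm; lra.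
move=> /(_ isT); rewrite ltr_norml => /andP[_ h1].
have h2 : k * (x0 - b) <= k * e by rewrite ler_pM2l// ltW.
have := hle2 x0; have := g0 t0; rewrite mulrBr in h2.
rewrite /m in m0 ke kE h1 *; lra.
Qed.

Lemma u_mono (t a b : R) : (forall x, 0 < c x) ->
  viscosity_subsolution c beta T (usc_env (strip T) u) ->
  0 <= t < T -> a <= b -> u (t, a) <= u (t, b).
Proof.
move=> cpos sub tT; rewrite le_eqVlt => /predU1P[->//|ab].
have := tT => /andP[]; rewrite le_eqVlt => /predU1P[<-|t0] tT'; last first.
  by apply: u_mono_pos => //; rewrite t0.
rewrite leNgt; apply/negP => lt_ba.
set m := u (0, a) - u (0, b).
have m2 : 0 < m / 2 by rewrite divr_gt0// subr_gt0.
have T0 : 0 <= (0 : R) < T by rewrite lexx tT'.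
have [d d0 dP] := u_near a T0 m2; have [e e0 eP] := u_near b T0 m2.
pose t1 := Num.min (Num.min d e) T / 2.
have t10 : 0 < t1 by rewrite divr_gt0// !lt_min d0 e0 tT'.
have ld : t1 < d.
  have : Num.min (Num.min d e) T <= d by rewrite !ge_min lexx.
  by rewrite /t1; lra.
have le : t1 < e.
  have : Num.min (Num.min d e) T <= e by rewrite !ge_min lexx orbT.
  by rewrite /t1; lra.
have lT : t1 < T.
  have : Num.min (Num.min d e) T <= T by rewrite ge_min lexx orbT.
  by rewrite /t1; lra.
have t1T : 0 < t1 < T by rewrite t10.
have t1T' : 0 <= t1 < T by rewrite (ltW t10).
have nz : `|t1 - 0| = t1 by rewrite subr0 gtr0_norm.
have := dP t1 a t1T'; rewrite nz subrr normr0 => /(_ ld d0).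
have := eP t1 b t1T'; rewrite nz subrr normr0 => /(_ le e0).
have := u_mono_pos cpos sub t1T ab.
rewrite !ltr_norml /m; lra.
Qed.

End mono.

(** * A confining penalty with nonnegative half-Laplacian at infinity *)

Section logkernel.
Variable R : realType.
Local Notation mu := (@lebesgue_measure R).

(** A function that tends to infinity although its half-Laplacian is only slightly
    negative: it equals - pi / (1 + x^2), the function being the boundary value
    of the harmonic function log |x + i (1 + y)| on the half-plane. *)
Definition lf (x : R) : R := ln (1 + x ^+ 2) / 2.
Definition dlf (x : R) : R := x / (1 + x ^+ 2).

Lemma m_gt0 (x : R) : 0 < 1 + x ^+ 2.
Proof. by rewrite ltr_pwDl ?sqr_ge0. Qed.
Lemma m_ge1 (x : R) : 1 <= 1 + x ^+ 2.
Proof. by rewrite lerDl sqr_ge0. Qed.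

Lemma lf_le (x y : R) : lf y - lf x <= ((1 + y ^+ 2) / (1 + x ^+ 2) - 1) / 2.
Proof.
rewrite /lf -mulrBl ler_pM2r ?invr_gt0// -ln_div ?posrE ?m_gt0//.
have := @le_ln1Dx R ((1 + y ^+ 2) / (1 + x ^+ 2) - 1).
rewrite subrKC; apply.
by rewrite ltrBrDr addNr divr_gt0 ?m_gt0.
Qed.

Lemma lf_nd (x y : R) : `|x| <= `|y| -> lf x <= lf y.
Proof.
move=> xy; rewrite /lf ler_pM2r ?invr_gt0// ler_ln ?posrE ?m_gt0// lerD2l.
by rewrite -(real_normK (num_real x)) -(real_normK (num_real y)) lerXn2r ?nnegrE.
Qed.

Lemma lfN (x : R) : lf (- x) = lf x.
Proof. by rewrite /lf sqrrN. Qed.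

Lemma lf_ge0 (x : R) : 0 <= lf x.
Proof. by rewrite divr_ge0// ln_ge0// m_ge1. Qed.

Lemma lf_exp (s : R) : s <= lf (expR s).
Proof.
rewrite /lf ler_pdivlMr// mulr_natr -[X in X <= _]expRK ler_ln ?posrE ?expR_gt0 ?m_gt0//.
by rewrite mulr2n expRD -expr2 lerDr.
Qed.

Lemma C11_lf : C11 lf dlf.
Proof.
exists 2; split=> [x|x h].
  rewrite /dlf normrM normfV (ger0_norm (ltW (m_gt0 x))) ler_pdivrMr ?m_gt0//.
  have := sqr_ge0 (`|x| - 1); rewrite sqrrB1 real_normK ?num_real// mulr2n.
  by have := sqr_ge0 x; lra.
set y := x + h; have yE : h = y - x by rewrite /y; ring.
have m0 := m_gt0 x; have n0 := m_gt0 y.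
have m1 := m_ge1 x; have n1 := m_ge1 y.
have A := lf_le x y; have B := lf_le y x.
set m := 1 + x ^+ 2 in A B m0 m1; set n := 1 + y ^+ 2 in A B n0 n1.
have mE : x ^+ 2 = m - 1 by rewrite /m; ring.
have nE : y ^+ 2 = n - 1 by rewrite /n; ring.
have hE : h ^+ 2 = m + n - 2 - 2 * (x * y).
  by rewrite yE sqrrB mE nE -mulr_natl; ring.
rewrite /dlf -/m ler_norml; apply/andP; split; last first.
  have -> : x / m * h = (n / m - 1) / 2 - h ^+ 2 / (2 * m).
    rewrite yE; have m00 : m != 0 by rewrite gt_eqF.
    rewrite /n /m in m00 *; field; exact: m00.
  have : 0 <= h ^+ 2 / (2 * m) <= 2 * h ^+ 2.
    rewrite divr_ge0 ?sqr_ge0 ?mulr_ge0 ?(ltW m0)//=.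
    rewrite ler_pdivrMr ?mulr_gt0//.
    have : 0 <= h ^+ 2 * (m - 1) by rewrite mulr_ge0 ?sqr_ge0// subr_ge0.
    by have := sqr_ge0 h; lra.
  by move=> /andP[]; lra.
have key : - (2 * h ^+ 2) <= - ((m / n - 1) / 2) - x / m * h.
  have -> : - ((m / n - 1) / 2) - x / m * h = h ^+ 2 * (m - 2 * x ^+ 2 - 2 * (x * y)) / (2 * (m * n)).
    have m00 : m != 0 by rewrite gt_eqF.
    have n00 : n != 0 by rewrite gt_eqF.
    rewrite yE /n /m in m00 n00 *; field.
    by rewrite m00 n00.
  rewrite ler_pdivlMr; last by rewrite !mulr_gt0.
  rewrite [leLHS](_ : _ = h ^+ 2 * (- 4 * (m * n))); last by ring.
  rewrite ler_wpM2l ?sqr_ge0//.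
  have xy : 2 * (x * y) <= x ^+ 2 + y ^+ 2.
    by have := sqr_ge0 (x - y); rewrite sqrrB -mulr_natl; lra.
  have mn : 0 <= (m - 1) * (n - 1) by rewrite mulr_ge0// subr_ge0.
  have : m + n - 1 <= m * n by lra.
  rewrite mE nE in xy *; lra.
lra.
Qed.

Lemma is_derive_trans (f f' : R -> R) (x z : R) :
  (forall y : R, is_derive y 1 f (f' y)) ->
  is_derive z 1 (fun z => f (x + z)) (f' (x + z)).
Proof.
move=> df; have d1 : is_derive z 1 (fun z : R => x + z) 1.
  have := is_deriveD (is_derive_cst x z 1) (is_derive_id z (1 : R)).
  by rewrite add0r; apply.
by have := @is_derive1_comp R f _ z _ _ (df (x + z)) d1; rewrite mulr1.
Qed.

Lemma is_derive_refl (f f' : R -> R) (x z : R) :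
  (forall y : R, is_derive y 1 f (f' y)) ->
  is_derive z 1 (fun z => f (x - z)) (- f' (x - z)).
Proof.
move=> df; have d1 : is_derive z 1 (fun z : R => x - z) (- 1).
  have := is_deriveB (is_derive_cst x z 1) (is_derive_id z (1 : R)).
  by rewrite add0r; apply.
by have := @is_derive1_comp R f _ z _ _ (df (x - z)) d1; rewrite mulrN1.
Qed.

(** A primitive in z of [sd lf x z] / z^2, obtained by integration by parts and
    partial fractions. *)
Definition lf_prim (x z : R) : R := - (sd lf x z * z^-1) -
  (1 + x ^+ 2)^-1 * ((atan (x + z) - atan (x - z)) - x * (lf (x + z) - lf (x - z))).

Lemma is_derive_lf_prim (x z : R) : 0 < z ->
  is_derive z 1 (lf_prim x) (sd lf x z / z ^+ 2).
Proof.
move=> z0.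
have zn0 : z != 0 by rewrite gt_eqF.
have dl (y : R) : is_derive y 1 lf (dlf y) := C11_is_derive y C11_lf.
have da (y : R) : is_derive y 1 atan (1 + y ^+ 2)^-1 := is_derive1_atan y.
have l1 := is_derive_trans x z dl; have l2 := is_derive_refl x z dl.
have a1 := is_derive_trans x z da; have a2 := is_derive_refl x z da.
have iv : is_derive z 1 (fun z : R => z^-1) (- z ^- 2).
  apply: is_derive_eq; first by apply: is_deriveV.
  by rewrite /GRing.scale/= mulr1.
rewrite /lf_prim /sd; apply: is_derive_eq.
rewrite /GRing.scale/= /dlf.
have p0 : 1 + (x + z) ^+ 2 != 0 by rewrite gt_eqF ?m_gt0.
have q0 : 1 + (x - z) ^+ 2 != 0 by rewrite gt_eqF ?m_gt0.
have m0 : 1 + x ^+ 2 != 0 by rewrite gt_eqF ?m_gt0.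
set A := lf (x + z); set B := lf (x - z).
field.
by rewrite ?zn0 ?p0 ?q0 ?m0.
Qed.

Lemma sd_lf_le0 (x Z : R) : 2 * `|x| <= Z -> sd lf x Z <= 0.
Proof.
move=> xZ.
have h1 : lf x <= lf (x + Z).
  apply: lf_nd; rewrite [leRHS]ger0_norm; have := ler_norm x; have := ler_norm (- x); rewrite normrN; lra.
have h2 : lf x <= lf (x - Z).
  apply: lf_nd; rewrite [leRHS]ler0_norm; have := ler_norm x; have := ler_norm (- x); rewrite normrN; lra.
by rewrite /sd; lra.
Qed.

Lemma lf_cross (x Z : R) : 0 <= Z -> 0 <= x * (lf (x + Z) - lf (x - Z)).
Proof.
move=> Z0; case: (leP 0 x) => x0.
  apply: mulr_ge0 => //; rewrite subr_ge0; apply: lf_nd.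
  by rewrite ler_norml (ger0_norm (addr_ge0 x0 Z0)); lra.
apply: mulr_le0; first exact: ltW.
rewrite subr_le0; apply: lf_nd.
by rewrite (ler0_norm (_ : x - Z <= 0)) ?ler_norml; lra.
Qed.

Lemma sd_cont (f : R -> R) (x : R) : continuous f -> continuous (sd f x).
Proof.
move=> cf z; apply: cvgB; first (apply: cvgB; first exact: cvg_cst).
  apply: (@continuous_comp _ _ _ (fun z : R => x + z) f); last exact: cf.
  by apply: cvgD; [exact: cvg_cst|exact: cvg_id].
apply: (@continuous_comp _ _ _ (fun z : R => x - z) f); last exact: cf.
by apply: cvgB; [exact: cvg_cst|exact: cvg_id].
Qed.

(** At the upper end Z >= 2 |x| each part of the primitive has a favourable sign
    except the difference of arctangents, which is at most pi; at the lower end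
    d everything is O(d). *)
Lemma int_lf : exists2 C, 0 < C & forall x d Z : R, 0 < d -> d < Z -> 2 * `|x| <= Z ->
  - (pi / (1 + x ^+ 2)) - C * d <= \int[mu]_(z in `[d, Z]) (sd lf x z / z ^+ 2).
Proof.
have [C C0 HC] := C11_sd C11_lf.
have [D D0 HD] : exists2 D : R, 0 < D & forall x y : R, `|lf x - lf y| <= D * `|x - y|.
  have /C11_gt0[D D0 HD] := C11_lf; exists D => // x y.
  exact: (C11_lip HD).
exists (C + 2 * D); first by rewrite addr_gt0// mulr_gt0.
move=> x d Z d0 dZ xZ.
have Z0 : 0 < Z by lra.
have m0 := m_gt0 x; have m1 := m_ge1 x.
have zp z : z \in `[d, Z] -> 0 < z by rewrite in_itv/= => /andP[]; lra.
have zp' z : z \in `]d, Z[ -> 0 < z by rewrite in_itv/= => /andP[]; lra.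
have -> : \int[mu]_(z in `[d, Z]) (sd lf x z / z ^+ 2) = lf_prim x Z - lf_prim x d.
  rewrite /Rintegral (@continuous_FTC2 R _ (lf_prim x) d Z dZ)//.
  - apply: continuous_in_subspaceT => z /[!inE]/zp z0.
    apply: cvgM; first exact: sd_cont (C11_cont C11_lf) z.
    by apply: cvgV; [rewrite sqrf_eq0 gt_eqF|rewrite expr2; apply: cvgM; exact: cvg_id].
  - have dK (z : R) : 0 < z -> derivable (lf_prim x) z 1.
      by move=> /(is_derive_lf_prim x) ?; exact: ex_derive.
    have cK (z : R) : 0 < z -> lf_prim x @ z --> lf_prim x z.
      by move=> /dK ?; apply: differentiable_continuous; apply/derivable1_diffP.
    split; first by move=> z /zp'; exact: dK.
      exact: cvg_at_right_filter (cK d d0).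
    exact: cvg_at_left_filter (cK Z Z0).
  - move=> z /zp' z0; rewrite derive1E; have K := is_derive_lf_prim x z0.
    by rewrite derive_val.
have KZ : - (pi / (1 + x ^+ 2)) <= lf_prim x Z.
  have := sd_lf_le0 xZ; rewrite /lf_prim => h1.
  have h2 : sd lf x Z * Z^-1 <= 0 by rewrite mulr_le0_ge0// invr_ge0 ltW.
  have h3 := lf_cross x (ltW Z0).
  have h4 := atan_gtNpi2 (x - Z); have h5 := atan_ltpi2 (x + Z).
  have : (1 + x ^+ 2)^-1 * (atan (x + Z) - atan (x - Z) - x * (lf (x + Z) - lf (x - Z)))
    <= pi / (1 + x ^+ 2).
    rewrite [leRHS]mulrC ler_wpM2l ?invr_ge0 ?ltW//; lra.
  lra.
have Kd : lf_prim x d <= (C + 2 * D) * d.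
  have : `|sd lf x d * d^-1| <= C * d.
    rewrite normrM (gtr0_norm (_ : 0 < d^-1)) ?invr_gt0// ler_pdivrMr//.
    by rewrite -mulrA -expr2.
  rewrite ler_norml => /andP[h1 _].
  have h2 : atan (x - d) <= atan (x + d) by apply: le_atan; lra.
  have h3 := lf_cross x (ltW d0).
  have : x * (lf (x + d) - lf (x - d)) <= (1 + x ^+ 2) * (2 * D * d).
    apply: le_trans (ler_norm _) _; rewrite normrM.
    have h : `|lf (x + d) - lf (x - d)| <= 2 * D * d.
      apply: (le_trans (HD _ _)); rewrite (_ : x + d - (x - d) = 2 * d); last by ring.
      by rewrite gtr0_norm ?mulr_gt0//; lra.
    apply: ler_pM => //.
    have := sqr_ge0 (`|x| - 1); rewrite sqrrB1 real_normK ?num_real// mulr2n.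
    have := sqr_ge0 x; have := normr_ge0 x; lra.
  rewrite -ler_pdivrMl// => h4.
  have h5 : 0 <= (1 + x ^+ 2)^-1 * (atan (x + d) - atan (x - d)).
    by rewrite mulr_ge0 ?subr_ge0// invr_ge0 ltW.
  rewrite /lf_prim mulrBr; lra.
lra.
Qed.

Lemma integrable_sd (f : R -> R) (x d Z : R) : continuous f -> 0 < d ->
  mu.-integrable `[d, Z] (EFin \o (fun z => sd f x z / z ^+ 2)).
Proof.
move=> cf d0; apply: continuous_compact_integrable; first exact: segment_compact.
apply: continuous_in_subspaceT => z /[!inE]/=; rewrite in_itv/= => /andP[dz _].
apply: cvgM; first exact: sd_cont.
by apply: cvgV; [rewrite sqrf_eq0 gt_eqF//; lra|rewrite expr2; apply: cvgM; exact: cvg_id].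
Qed.

Lemma Rint_subset (A D : set R) (f : R -> R) : measurable A -> measurable D ->
  A `<=` D -> mu.-integrable D (EFin \o f) -> (forall z, D z -> 0 <= f z) ->
  \int[mu]_(z in A) f z <= \int[mu]_(z in D) f z.
Proof.
move=> mA mD AD fi f0; have fiA := @integrableS _ _ _ mu _ _ _ mD mA AD fi.
apply: fine_le; [exact: integrable_fin_num|exact: integrable_fin_num|].
by apply: ge0_subset_integral => //; case/integrableP: fi.
Qed.

(** Zero where lf <= s0, and equal to lf + (k - 1/2 - s0) where lf >= s0 + 2; the
    constant is large, so that cutting the function off to 0 in the middle
    creates a deep well, which makes the half-Laplacian positive far away. *)
Definition pen (s0 k x : R) : R := (1 + k) * hub (lf x - s0) - k * hub (lf x - s0 - 1).
Definition dpen (s0 k x : R) : R :=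
  ((1 + k) * clamp01 (lf x - s0) - k * clamp01 (lf x - s0 - 1)) * dlf x.
(** How much [lf] plus that constant exceeds [pen]: a nonnegative function with
    compact support, at least k - 1/2 - s0 on the interval where [pen] vanishes. *)
Definition defect (s0 k x : R) : R := lf x - s0 - 2^-1 + k - pen s0 k x.

Lemma C11_pen s0 k : C11 (pen s0 k) (dpen s0 k).
Proof.
have h1 : C11 (fun s => (1 + k) * hub (s - s0) - k * hub (s - s0 - 1))
   (fun s => (1 + k) * clamp01 (s - s0) - k * clamp01 (s - s0 - 1)).
  have a1 := C11Z (1 + k) (C11_shift s0 (@C11_hub R)).
  have a2 := C11Z k (C11_shift s0 (C11_shift 1 (@C11_hub R))).
  exact: (C11B a1 a2).
exact: (C11_comp h1 C11_lf).
Qed.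

Lemma dpen_sign s0 k x : 0 <= k -> 0 <= x * dpen s0 k x.
Proof.
move=> k0; rewrite /dpen /dlf mulrCA mulr_ge0//; last first.
  by rewrite mulrA divr_ge0 ?(ltW (m_gt0 x))// -expr2 sqr_ge0.
set s := lf x - s0; rewrite subr_ge0.
have h : clamp01 (s - 1) <= clamp01 s.
  have h0 := clamp01_ge0 s; have h1 := clamp01_le1 (s - 1).
  by rewrite {1 2}/clamp01; case: (leP s 0) => ?; case: (leP (s-1) 0) => ?; 
    case: (leP s 1) => ?; case: (leP (s - 1) 1) => ?; lra.
have : k * clamp01 (s - 1) <= k * clamp01 s by rewrite ler_wpM2l.
by have := clamp01_ge0 s; lra.
Qed.

Lemma pen_eq0 s0 k x : lf x <= s0 -> pen s0 k x = 0 /\ dpen s0 k x = 0.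
Proof.
move=> h; rewrite /pen /dpen !hub_eq0 ?clamp01_eq0; [|lra..].
by rewrite !mulr0 subrr mul0r.
Qed.

Lemma defect_bnd s0 k x : s0 + 1 <= k -> 0 <= s0 -> 0 <= defect s0 k x <= k.
Proof.
move=> k1 s00; rewrite /defect /pen; have := lf_ge0 x; set s := lf x => l0.
case: (leP s s0) => h0; first by rewrite !hub_eq0; [|lra..]; lra.
case: (leP (s - s0) 1) => h1.
  (* concave in s on this interval and nonnegative at both ends *)
  rewrite hub_quad ?(hub_eq0 (_ : s - s0 - 1 <= 0)); [|lra..].
  have := sqr_ge0 (s - s0 - 1).
  have : 0 <= (s - s0) * (1 - (s - s0)) by apply: mulr_ge0; lra.
  have : 0 <= k * (1 - (s - s0) ^+ 2).
    by apply: mulr_ge0; [lra|rewrite subr_ge0 expr_le1//; lra].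
  have : 0 <= k * (s - s0) ^+ 2 by apply: mulr_ge0; [lra|exact: sqr_ge0].
  lra.
rewrite hub_lin; last lra.
case: (leP (s - s0 - 1) 1) => h2; last by rewrite hub_lin; lra.
rewrite hub_quad; last lra.
have a : 0 <= k * (s - s0 - 2) ^+ 2 by apply: mulr_ge0; [lra|exact: sqr_ge0].
have b : 0 <= k * (1 - (s - s0 - 2) ^+ 2).
  by apply: mulr_ge0; [lra|rewrite subr_ge0 -(real_normK (num_real _)) expr_le1// ler_norml; lra].
lra.
Qed.

Lemma defectN s0 k x : defect s0 k (- x) = defect s0 k x.
Proof. by rewrite /defect /pen lfN. Qed.

Lemma defect0 s0 k x : s0 + 2 <= lf x -> defect s0 k x = 0.
Proof. by move=> h; rewrite /defect /pen !hub_lin; lra. Qed.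

Lemma defect_cont s0 k : continuous (defect s0 k).
Proof.
move=> x; apply: cvgB; last exact: (C11_cont (C11_pen s0 k)).
apply: cvgD; last exact: cvg_cst.
apply: cvgB; last exact: cvg_cst.
by apply: cvgB; [exact: (C11_cont C11_lf)|exact: cvg_cst].
Qed.

Lemma C11_defect s0 k : exists d', C11 (defect s0 k) d'.
Proof.
exists (fun x => dlf x + 0 - dpen s0 k x); apply: C11B (C11_pen s0 k).
have := C11D C11_lf (C11_cst (- s0 - 2^-1 + k)).
by congr (C11 _ _); apply/funext => x /=; rewrite /cst; ring.
Qed.

Lemma sd_pen s0 k x z : sd (pen s0 k) x z = sd lf x z - sd (defect s0 k) x z.
Proof. by rewrite /sd /defect; ring. Qed.

Lemma sd_defect_norm s0 k x z : sd (defect s0 k) x z = sd (defect s0 k) `|x| z.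
Proof.
case: (leP 0 x) => h; first by rewrite ger0_norm.
rewrite ltr0_norm// /sd defectN -[in RHS](defectN _ _ (- x + z)) -[in RHS](defectN _ _ (- x - z)).
by rewrite !opprD !opprK; ring.
Qed.

(** Seen from far away, the plateau of the defect over [-Rf, Rf], of height at
    least 8 and width 2 Rf, contributes at least 16 Rf / (|x| + Rf)^2, which
    beats the deficit pi / (1 + x^2) of the logarithm since pi <= 4. *)
Lemma int_defect_far (Rf k x d Z : R) : 1 <= Rf -> k = lf Rf + 9 ->
  expR (lf Rf + 2) + Rf + 1 <= `|x| -> 0 < d <= 1 -> 2 * `|x| <= Z ->
  \int[mu]_(z in `[d, Z]) (sd (defect (lf Rf) k) x z / z ^+ 2) <= - (pi / (1 + x ^+ 2)).
Proof.
move=> R1 kE; set s0 := lf Rf; set y : R := `|x| => yR /andP[d0 d1] yZ.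
have s00 : 0 <= s0 := lf_ge0 Rf.
have e0 := expR_ge0 (s0 + 2).
have k1 : s0 + 1 <= k by rewrite kE /s0; lra.
have y0 : 0 <= y by rewrite normr_ge0.
under eq_Rintegral do rewrite sd_defect_norm -/y.
set f := fun z : R => sd (defect s0 k) y z / z ^+ 2.
have fi : mu.-integrable `[d, Z] (EFin \o f).
  by apply: integrable_sd => //; exact: defect_cont.
have dy0 : defect s0 k y = 0.
  apply: defect0; apply: (le_trans (lf_exp (s0 + 2))); apply: lf_nd.
  by rewrite !ger0_norm//; lra.
have fE z : f z = - ((defect s0 k (y + z) + defect s0 k (y - z)) / z ^+ 2).
  by rewrite /f /sd dy0; ring.
have d_ge0 z : 0 <= defect s0 k z by have /andP[] := defect_bnd z k1 s00.
pose q : R := 8 / (y + Rf) ^+ 2.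
pose A : set R := `[y - Rf, y + Rf]%classic.
have AD : A `<=` `[d, Z] by move=> z; rewrite /A /= !in_itv/= => /andP[h1 h2]; apply/andP; split; lra.
have mA : measurable A by exact: measurable_itv.
have nfi : mu.-integrable `[d, Z] (EFin \o (fun z => - f z)).
  by have := @integrableN _ _ _ mu _ _ fi.
have sub := Rint_subset mA (measurable_itv `[d, Z]) AD nfi.
have low : \int[mu]_(z in A) q <= \int[mu]_(z in A) (- f z).
  apply: le_Rintegral => //.
  - exact: integrable_cst_itv.
  - exact: (@integrableS _ _ _ mu _ _ _ (measurable_itv _) mA AD nfi).
  move=> z /[dup] /AD; rewrite /A /= !in_itv/= => /andP[z1 z2] /andP[z3 z4].
  have z0 : 0 < z by lra.
  rewrite fE opprK /q.
  have h : 8 <= defect s0 k (y - z).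
    have [p0 _] : pen s0 k (y - z) = 0 /\ dpen s0 k (y - z) = 0.
      by apply: pen_eq0; apply: lf_nd; rewrite (ger0_norm (_ : 0 <= Rf)) ?ler_norml; lra.
    by rewrite /defect p0 kE /s0; have := lf_ge0 (y - z); lra.
  apply: ler_pM; [lra|by rewrite invr_ge0 sqr_ge0|have := d_ge0 (y + z); lra|].
  rewrite lef_pV2 ?posrE ?exprn_gt0//; [|lra].
  by rewrite ler_pXn2r ?nnegrE//; lra.
have fN : \int[mu]_(z in `[d, Z]) (- f z) = - \int[mu]_(z in `[d, Z]) f z.
  have := @RintegralZl _ _ _ mu _ f (-1) (measurable_itv _) fi.
  under eq_Rintegral do rewrite mulN1r.
  by move=> ->; rewrite mulN1r.
have {}sub := le_trans low (sub _); rewrite fN in sub.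
rewrite lerNr; apply: (le_trans _ (sub _)); last first.
  move=> z /=; rewrite in_itv/= => /andP[dz _]; rewrite fE opprK.
  by rewrite divr_ge0 ?sqr_ge0// addr_ge0.
have -> : \int[mu]_(z in A) q = q * (2 * Rf).
  rewrite (@Rintegral_cst _ _ _ mu _ mA)/= /A lebesgue_measure_itv/= lte_fin ifT; last lra.
  by rewrite -EFinB/=; congr (_ * _); ring.
have pi4 : pi <= 4 :> R.
  by have := @pihalf_lt2 R; lra.
have m0 := m_gt0 x.
rewrite ler_pdivrMr//; apply: (le_trans pi4).
rewrite /q [leRHS](_ : _ = (16 * Rf * (1 + x ^+ 2)) / (y + Rf) ^+ 2); last by ring.
have yR0 : 0 < y + Rf by lra.
rewrite ler_pdivlMr ?exprn_gt0//.
have -> : x ^+ 2 = y ^+ 2 by rewrite /y real_normK ?num_real.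
have h1 : (y + Rf) ^+ 2 <= (2 * y) ^+ 2 by rewrite ler_pXn2r ?nnegrE//; lra.
have h2 : 1 * (1 + y ^+ 2) <= Rf * (1 + y ^+ 2).
  by rewrite ler_wpM2r// ltW// m_gt0.
by rewrite exprMn in h1; have := sqr_ge0 y; lra.
Qed.

Lemma int_atan (d Z : R) : d < Z -> \int[mu]_(z in `[d, Z]) ((1 + z ^+ 2)^-1) <= pi.
Proof.
move=> dZ.
have -> : \int[mu]_(z in `[d, Z]) ((1 + z ^+ 2)^-1) = atan Z - atan d.
  rewrite /Rintegral (@continuous_FTC2 R _ atan d Z dZ)//.
  - apply: continuous_in_subspaceT => z _.
    apply: cvgV; first by rewrite gt_eqF ?m_gt0.
    by apply: cvgD; [exact: cvg_cst|rewrite expr2; apply: cvgM; exact: cvg_id].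
  - split; first by move=> z _; exact: derivable_atan.
      exact: cvg_at_right_filter (@continuous_atan R d).
    exact: cvg_at_left_filter (@continuous_atan R Z).
  - by move=> z _; rewrite derive1_atan.
by have := atan_gtNpi2 d; have := atan_ltpi2 Z; lra.
Qed.

(** The second difference is at most C z^2 and at most 2 k, hence its quotient by
    z^2 is dominated by a multiple of 1 / (1 + z^2). *)
Lemma int_defect (s0 k : R) : s0 + 1 <= k -> 0 <= s0 ->
  exists N : R, forall x d Z : R, 0 < d -> d < Z ->
  \int[mu]_(z in `[d, Z]) (sd (defect s0 k) x z / z ^+ 2) <= N.
Proof.
move=> k1 s00; have [d' /C11_sd[C C0 HC]] := C11_defect s0 k.
exists ((C + 2 * k) * pi) => x d Z d0 dZ.
have k0 : 0 <= k by lra.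
have ai : mu.-integrable `[d, Z] (EFin \o (fun z : R => (1 + z ^+ 2)^-1)).
  apply: continuous_compact_integrable; first exact: segment_compact.
  apply: continuous_in_subspaceT => z _.
  apply: cvgV; first by rewrite gt_eqF ?m_gt0.
  by apply: cvgD; [exact: cvg_cst|rewrite expr2; apply: cvgM; exact: cvg_id].
apply: (@le_trans _ _ (\int[mu]_(z in `[d, Z]) ((C + 2 * k) * (1 + z ^+ 2)^-1))).
  apply: le_Rintegral => //.
  - by apply: integrable_sd => //; exact: defect_cont.
  - by have := @integrableZl _ _ _ mu _ (measurable_itv _) (C + 2 * k) _ ai.
  move=> z /=; rewrite in_itv/= => /andP[dz _].
  have z0 : 0 < z by lra.
  rewrite ler_pdivrMr ?exprn_gt0// mulrAC ler_pdivlMr ?m_gt0//.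
  have := HC x z; rewrite ler_norml => /andP[_ h1].
  have h2 : sd (defect s0 k) x z <= 2 * k.
    rewrite /sd; have /andP[_] := defect_bnd x k1 s00.
    by have /andP[+ _] := defect_bnd (x + z) k1 s00; have /andP[+ _] := defect_bnd (x - z) k1 s00; lra.
  have : sd (defect s0 k) x z * z ^+ 2 <= 2 * k * z ^+ 2 by rewrite ler_wpM2r ?sqr_ge0.
  lra.
rewrite (@RintegralZl _ _ _ mu _ _ (C + 2 * k) (measurable_itv _) ai).
by rewrite ler_wpM2l ?int_atan//; lra.
Qed.

(** The last clause is a truncated form of A_0 psi >= - N(x), with N(x) = 0
    for |x| >= R1; the truncation at Z is what makes it meaningful for an unbounded
    psi. *)
Definition penalty (Rf : R) (psi psi' : R -> R) (R1 N0 C : R) : Prop :=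
  [/\ C11 psi psi',
      forall x, 0 <= psi x /\ 0 <= x * psi' x,
      forall x, `|x| <= Rf -> psi x = 0 /\ psi' x = 0,
      forall K, exists Y, forall x, Y <= `|x| -> K <= psi x &
      [/\ 0 <= C, 0 <= N0 & forall x d Z : R, 0 < d <= 1 -> 1 < Z -> 2 * `|x| <= Z ->
       - ((if `|x| < R1 then N0 else 0) + C * d) <=
         \int[mu]_(z in `[d, Z]) (sd psi x z / z ^+ 2)]].

Lemma exists_penalty (Rf : R) : 1 <= Rf ->
  exists psi psi' R1 N0 C, penalty Rf psi psi' R1 N0 C.
Proof.
move=> R1; pose s0 := lf Rf; pose k := s0 + 9.
have s00 : 0 <= s0 := lf_ge0 Rf.
have k1 : s0 + 1 <= k by rewrite /k; lra.
have [N HN] := int_defect k1 s00.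
have [C C0 HC] := int_lf.
have pi0 := @pi_ge0 R.
exists (pen s0 k), (dpen s0 k), (expR (s0 + 2) + Rf + 1), (`|N| + pi), C; split.
- exact: C11_pen.
- move=> x; split; last by apply: dpen_sign; lra.
  rewrite /pen; have h1 : hub (lf x - s0 - 1) <= hub (lf x - s0) by apply: hub_nd; lra.
  have h2 : k * hub (lf x - s0 - 1) <= k * hub (lf x - s0) by rewrite ler_wpM2l//; lra.
  by have := hub_ge0 (lf x - s0); lra.
- move=> x xR; apply: pen_eq0; apply: lf_nd; apply: (le_trans xR); exact: ler_norm.
- move=> K; exists (expR (K + s0 + 1)) => x xK.
  have h1 : K + s0 + 1 <= lf x.
    apply: (le_trans (lf_exp _)); apply: lf_nd.
    by rewrite ger0_norm ?expR_ge0.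
  by have /andP[_] := defect_bnd x k1 s00; rewrite /defect; lra.
split; [exact: ltW|by rewrite addr_ge0|].
move=> x d Z /andP[d0 d1] Z1 xZ; have dZ : d < Z by lra.
have il : mu.-integrable `[d, Z] (EFin \o (fun z => sd lf x z / z ^+ 2)).
  by apply: integrable_sd => //; exact: C11_cont C11_lf.
have id : mu.-integrable `[d, Z] (EFin \o (fun z => sd (defect s0 k) x z / z ^+ 2)).
  by apply: integrable_sd => //; exact: defect_cont.
under eq_Rintegral do rewrite sd_pen mulrBl.
rewrite (@RintegralB _ _ _ mu _ _ _ (measurable_itv _) il id).
have h1 := HC x d Z d0 dZ xZ.
case: ifP => [_|/negbT]; last rewrite -leNgt => xR.
  have h2 := HN x d Z d0 dZ; have := ler_norm N.
  have : pi / (1 + x ^+ 2) <= pi by rewrite ler_pdivrMr ?m_gt0// ler_peMr// m_ge1.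
  lra.
have := @int_defect_far Rf k x d Z R1 erefl xR; rewrite d0 d1 => /(_ isT xZ).
by rewrite -/s0; lra.
Qed.

(** How the penalty is used.  At a contact point the second differences k of the
    solution dominate those of a psi; beyond Z only their boundedness is used. *)
Lemma penalty_int (Rf : R) psi psi' R1 N0 C a (k : R -> R) (Bd x d Z : R) :
  penalty Rf psi psi' R1 N0 C -> 0 <= a -> measurable_fun setT k ->
  (forall z, `|k z| <= Bd) -> (forall z, a * sd psi x z <= k z) ->
  0 < d <= 1 -> 1 < Z -> 2 * `|x| <= Z ->
  - (a * ((if `|x| < R1 then N0 else 0) + C * d)) - Bd / Z <=
  \int[mu]_(z in `[d, +oo[) (k z / z ^+ 2).
Proof.
move=> [psiC _ _ _ [_ _ H]] a0 mk kB kpsi d01 Z1 xZ.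
have {}H := H x d Z d01 Z1 xZ; have /andP[d0 d1] := d01.
have Z0 : 0 < Z by lra.
have dZ : d < Z by lra.
have ki := integrable_ker d0 mk kB.
have kZ := integrable_ker Z0 mk kB.
have sub1 : `[d, Z] `<=` (`[d, +oo[ : set R).
  by move=> z /=; rewrite !in_itv/= => /andP[->].
have kiZ := @integrableS _ _ _ mu _ _ _ (measurable_itv _) (measurable_itv _) sub1 ki.
have pi' : mu.-integrable `[d, Z] (EFin \o (fun z => sd psi x z / z ^+ 2)).
  by apply: integrable_sd => //; exact: C11_cont psiC.

have low1 : - (a * ((if `|x| < R1 then N0 else 0) + C * d)) <=
    \int[mu]_(z in `[d, Z]) (k z / z ^+ 2).
  apply: (@le_trans _ _ (\int[mu]_(z in `[d, Z]) (a * (sd psi x z / z ^+ 2)))).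
    rewrite (@RintegralZl _ _ _ mu _ _ a (measurable_itv _) pi') -mulrN.
    exact: ler_wpM2l.
  apply: le_Rintegral => //.
    by have := @integrableZl _ _ _ mu _ (measurable_itv _) a _ pi'.
  by move=> z _; rewrite mulrA ler_wpM2r// invr_ge0 sqr_ge0.
have low2 : - (Bd / Z) <= \int[mu]_(z in `[Z, +oo[) (k z / z ^+ 2).
  have c1 : forall z : R, `|cst 1 z| <= 1 :> R by move=> z; rewrite normr1.
  have i1 := integrable_ker Z0 (measurable_cst (1 : R)) c1.
  have -> : - (Bd / Z) = \int[mu]_(z in `[Z, +oo[) (- Bd * (1 / z ^+ 2)).
    rewrite (@RintegralZl _ _ _ mu _ _ (- Bd) (measurable_itv _) i1) mulNr.
    congr (- (_ * _)); rewrite /Rintegral.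
    by under eq_integral => z _ do rewrite div1r; rewrite int_inv2.
  apply: le_Rintegral => //.
    by have := @integrableZl _ _ _ mu _ (measurable_itv _) (- Bd) _ i1.
  move=> z _; rewrite mulrA mulr1 ler_wpM2r// ?invr_ge0 ?sqr_ge0//.
  by have := kB z; rewrite ler_norml => /andP[].
have -> : \int[mu]_(z in `[d, +oo[) (k z / z ^+ 2) = \int[mu]_(z in `[d, Z]) (k z / z ^+ 2) +
   \int[mu]_(z in `[Z, +oo[) (k z / z ^+ 2).
  have dZU : `[d, +oo[%classic = `[d, Z] `|` `]Z, +oo[ :> set R.
    by rewrite -itv_bndbnd_setU//; rewrite bnd_simp// ltW.
  have -> : \int[mu]_(z in `[Z, +oo[) (k z / z ^+ 2) = \int[mu]_(z in `]Z, +oo[) (k z / z ^+ 2).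
    rewrite Rintegral_itv_obnd_cbnd//.
    apply: (@integrableS _ _ _ mu _ _ _ (measurable_itv _) (measurable_itv _) _ kZ).
    by move=> z /=; rewrite !in_itv/= !andbT => /ltW.
  rewrite dZU Rintegral_setU//.
    by rewrite -dZU.
  rewrite disj_set2E; apply/eqP/seteqP; split=> // z [] /=; rewrite !in_itv/= => /andP[_ h].
  by rewrite ltNge h.
exact: lerD.
Qed.

End logkernel.

(** * Bounds on the nonlocal drift *)

Lemma ess_sup_bound (R : realType) d (X : measurableType d)
    (m : {measure set X -> \bar R}) (f : X -> \bar R) : (ess_sup m f < +oo)%E ->
  exists2 C, 0 <= C & \forall x \ae m, (f x <= C%:E)%E.
Proof.
have := ess_sup_ge m f; set S := ess_sup m f => H fin.
exists `|fine S| => //.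
have SC : (S <= `|fine S|%:E)%E.
  by case: S fin {H} => [r _| |]//=; rewrite ?lee_fin ?ler_norm// leNye.
by case: H => N [mN N0 sN]; exists N; split => // x /= h; apply: sN => /= h'; apply: h; exact: le_trans h' SC.
Qed.

Section meas2.
Variable R : realType.
Local Notation mu := (@lebesgue_measure R).

(** Open subsets of the plane are countable unions of rational boxes; this is how
    continuous functions of two variables are seen to be measurable for the
    product sigma-algebra. *)
Definition rbox (q : rat * rat * rat * rat) : set (R * R) :=
  `]ratr q.1.1.1, ratr q.1.1.2[%classic `*` `]ratr q.1.2, ratr q.2[%classic.

Lemma measurable_rbox q : measurable (rbox q).
Proof. by apply: measurableX; exact: measurable_itv. Qed.

Lemma rbox_near (U : set (R * R)) (p : R * R) : open U -> U p ->
  exists2 q, rbox q p & rbox q `<=` U.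
Proof.
move=> oU Up; have : nbhs p U by exact: open_nbhs_nbhs.
move=> /nbhs_ballP[e /= e0 eU].
have lo (s : R) : exists q : rat, (s - e < ratr q < s).
  have [|q] := @rat_in_itvoo R (s - e) s; first by lra.
  by rewrite in_itv/=; exists q.
have hi (s : R) : exists q : rat, (s < ratr q < s + e).
  have [|q] := @rat_in_itvoo R s (s + e); first by lra.
  by rewrite in_itv/=; exists q.
have [a /andP[a1 a2]] := lo p.1; have [b /andP[b1 b2]] := hi p.1.
have [c /andP[c1 c2]] := lo p.2; have [d /andP[d1 d2]] := hi p.2.
exists (a, b, c, d).
  by rewrite /rbox; split => /=; rewrite in_itv/= ?a2 ?b1 ?c2 ?d1.
move=> [x y] [] /=; rewrite !in_itv/= => /andP[h1 h2] /andP[h3 h4].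
by apply: eU; split; rewrite /ball/= ltr_norml; lra.
Qed.

Lemma open2_measurable (U : set (R * R)) : open U -> measurable U.
Proof.
move=> oU.
have -> : U = \bigcup_(q in [set q | rbox q `<=` U]) rbox q.
  apply/seteqP; split=> [p Up|p [q /= qU]]; last exact: qU.
  by have [q qp qU] := rbox_near oU Up; exists q.
rewrite bigcup_mkcond; apply: countable_bigcupT_measurable; first exact: countableP.
by move=> q; case: ifP => _; [exact: measurable_rbox|exact: measurable0].
Qed.

Lemma cont2_measurable (f : R * R -> R) : continuous f -> measurable_fun setT f.
Proof.
move=> /continuousP cf; apply: (measurability _ (RGenOpens.measurableE R)) => //.
move=> _ [_ [a [b ->] <-]]; rewrite setTI; apply: open2_measurable; apply: cf.
exact: interval_open.
Qed.

Lemma slice_cont1 (h : R * R -> R) (y : R) : continuous h -> continuous (fun s => h (s, y)).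
Proof.
move=> ch s; apply: (@continuous_comp _ _ _ (fun s => (s, y)) h); last exact: ch.
exact: cvg_pair cvg_id (cvg_cst _).
Qed.

Lemma slice_cont2 (h : R * R -> R) (s : R) : continuous h -> continuous (fun y => h (s, y)).
Proof.
move=> ch y; apply: (@continuous_comp _ _ _ (fun y => (s, y)) h); last exact: ch.
exact: cvg_pair (cvg_cst _) cvg_id.
Qed.

(** f(x', y) - f(x, y) is the integral of g(., y) over [x, x']; exchanging the
    integrals, only a bound for almost every s is required. *)
Lemma L1_lip (f g : R * R -> R) (C : R) : 0 <= C ->
  (forall x y : R, is_derive x (1 : R) (fun s => f (s, y)) (g (x, y))) ->
  continuous f -> continuous g ->
  (\forall s \ae mu, (\int[mu]_y `|g (s, y)|%:E <= C%:E)%E) ->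
  forall x x' : R, x < x' ->
  (\int[mu]_y `|f (x', y) - f (x, y)|%:E <= (C * (x' - x))%:E)%E.
Proof.
move=> C0 dfg cf cg gC x x' xx'.
have mg := cont2_measurable cg.
pose I : set R := `[x, x']%classic.
have mI : measurable I by exact: measurable_itv.
pose F : R * R -> \bar R := fun p => (`|g p| * \1_I p.1)%:E.
have mF : measurable_fun setT F.
  apply/measurable_EFinP; apply: measurable_funM.
    by apply: measurableT_comp mg.
  by apply: measurableT_comp; [exact: measurable_indic|exact: measurable_fst].
have F0 p : (0 <= F p)%E by rewrite lee_fin mulr_ge0.
apply: (@le_trans _ _ (\int[mu]_y \int[mu]_s F (s, y))%E).
  apply: ge0_le_integral => //.
  - apply/measurable_EFinP; apply: measurableT_comp => //.
    by apply: measurable_funB; apply: continuous_measurable_fun; apply: slice_cont2.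
  - exact: measurable_fun_fubini_tonelli_G.
  move=> y _.
  have gi : mu.-integrable I (EFin \o (fun s => g (s, y))).
    apply: continuous_compact_integrable; first exact: segment_compact.
    by apply: continuous_subspaceT; exact: slice_cont1.
  have -> : (\int[mu]_s F (s, y) = \int[mu]_(s in I) `|g (s, y)|%:E)%E.
    rewrite [RHS]integral_mkcond; apply: eq_integral => s _.
    rewrite /F patchE/= indicE; by case: ifPn => _; rewrite ?mulr1 ?mulr0.
  have -> : f (x', y) - f (x, y) = \int[mu]_(s in I) g (s, y).
    rewrite /Rintegral (@continuous_FTC2 R _ (fun s => f (s, y)) x x' xx')//.
    - by apply: continuous_subspaceT; exact: slice_cont1.
    - split; first by move=> s _; have := dfg s y => ?; exact: ex_derive.
        by apply: cvg_at_right_filter; exact: slice_cont1.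
      by apply: cvg_at_left_filter; exact: slice_cont1.
    - by move=> s _; rewrite derive1E; have := dfg s y => ?; rewrite derive_val.
  have := @le_normr_Rintegral _ _ _ mu _ _ mI gi.
  rewrite -lee_fin => /le_trans; apply.
  by rewrite /Rintegral fineK//; apply: integrable_fin_num => //; exact: (integrable_norm gi).
rewrite -fubini_tonelli//.
apply: (@le_trans _ _ (\int[mu]_(s in I) C%:E)%E); last first.
  rewrite integral_cst//= /I lebesgue_measure_itv/= lte_fin xx' -EFinB.
  by rewrite -EFinM.
have -> : (\int[mu]_s \int[mu]_y F (s, y) = \int[mu]_(s in I) \int[mu]_y `|g (s, y)|%:E)%E.
  rewrite [RHS]integral_mkcond; apply: eq_integral => s _.
  rewrite patchE/= ; case: ifPn => [sI|/negbTE sI].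
    by apply: eq_integral => y _; rewrite /F indicE sI mulr1.
  by rewrite integral0_eq// => y _; rewrite /F indicE sI mulr0.
apply: ae_ge0_le_integral => //.
- by move=> s _; apply: integral_ge0.
- apply: measurable_funTS.
  apply: (@measurable_fun_fubini_tonelli_F _ _ _ _ _ mu (fun p => `|g p|%:E)).
  by apply/measurable_EFinP; exact: measurableT_comp mg.
  by move=> p; rewrite lee_fin.
case: gC => N [mN N0 sN]; exists N; split => // s /= h.
by apply: sN => /= h'; apply: h => _.
Qed.

Lemma smooth_cont (f : R * R -> R) : smooth f -> continuous f.
Proof. by move=> sf p; apply: differentiable_continuous; exact: (sf [::] p). Qed.

Lemma smooth_d1_cont (f : R * R -> R) : smooth f -> continuous (d1 f).
Proof. by move=> sf p; apply: differentiable_continuous; exact: (sf [:: (1, 0)] p). Qed.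

Lemma smooth_is_derive1 (f : R * R -> R) (x y : R) : smooth f ->
  is_derive x (1 : R) (fun s => f (s, y)) (d1 f (x, y)).
Proof.
move=> sf; rewrite d1E; apply: DeriveDef => //.
apply/derivable1_diffP.
apply: (@differentiable_comp _ _ _ _ (fun s : R => (s, y)) f); last exact: (sf [::]).
by apply: differentiable_pair; [exact: ex_diff|exact: differentiable_cst].
Qed.

Lemma Linfty_ae (f : R * R -> R) : Linfty_L1 f -> exists2 C, 0 <= C &
  \forall s \ae mu, (\int[mu]_y `|f (s, y)|%:E <= C%:E)%E.
Proof. exact: ess_sup_bound. Qed.

Lemma ae_near_point (P : R -> Prop) (x : R) : (\forall s \ae mu, P s) ->
  exists2 s, x - 1 < s < x & P s.
Proof.
move=> [N [mN N0 sN]]; apply: contrapT => H.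
have : `]x - 1, x[ `<=` N.
  move=> s; rewrite /= in_itv/= => sx; apply: sN => /= Ps.
  by apply: H; exists s.
move=> sub; have := @le_measure _ _ _ mu _ N; rewrite inE => /(_ _ _ mN sub).
rewrite inE => /(_ (measurable_itv _)); rewrite [leRHS]N0 /= lebesgue_measure_itv/= lte_fin ifT; last lra.
by rewrite -EFinB lee_fin; lra.
Qed.

(** An almost everywhere bound on the L^1 norm of beta(s, .) holds at points
    within distance 1 of any x, and [L1_lip] transports it to x. *)
Lemma beta_bounds (beta : R * R -> R) : smooth beta -> Linfty_L1 beta ->
  Linfty_L1 (d1 beta) -> exists C0 C1 : R, [/\ 0 <= C0, 0 <= C1,
  (forall x, (\int[mu]_y `|beta (x, y)|%:E <= C0%:E)%E) &
  (forall x x', x < x' ->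
    (\int[mu]_y `|beta (x', y) - beta (x, y)|%:E <= (C1 * (x' - x))%:E)%E)].
Proof.
move=> sb /Linfty_ae[C0 C00 H0] /Linfty_ae[C1 C10 H1].
have cb := smooth_cont sb; have cd := smooth_d1_cont sb.
have lip := L1_lip C10 (fun x y => smooth_is_derive1 x y sb) cb cd H1.
exists (C0 + C1), C1; split => //; first exact: addr_ge0.
have sl s : measurable_fun setT (fun y => beta (s, y)).
  by apply: continuous_measurable_fun; exact: slice_cont2.
move=> x; have [s /andP[s1 s2] Ps] := ae_near_point x H0.
have {}lip := lip s x s2.
apply: (@le_trans _ _ (\int[mu]_y (`|beta (s, y)|%:E + `|beta (x, y) - beta (s, y)|%:E))%E).
  apply: ge0_le_integral => //.
  - by apply/measurable_EFinP; exact: measurableT_comp (sl x).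
  - have mB := measurable_funB (sl x) (sl s).
    apply: emeasurable_funD; apply/measurable_EFinP; first exact: measurableT_comp (sl s).
    exact: measurableT_comp mB.
  - by move=> y _; rewrite -EFinD lee_fin -{1}(subrKC (beta (s, y)) (beta (x, y))) ler_normD.
rewrite ge0_integralD//.
- rewrite EFinD; apply: leeD => //; apply: (le_trans lip).
  by rewrite lee_fin ler_piMr//; lra.
- by apply/measurable_EFinP; exact: measurableT_comp (sl s).
- have mB := measurable_funB (sl x) (sl s).
  by apply/measurable_EFinP; exact: measurableT_comp mB.
Qed.

Lemma int_prod_le (k w : R -> R) (K D : R) : measurable_fun setT k ->
  measurable_fun setT w -> (\int[mu]_y `|k y|%:E <= K%:E)%E ->
  (forall y, `|w y| <= D) ->
  mu.-integrable setT (EFin \o (fun y => k y * w y)) /\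
  `|\int[mu]_y (k y * w y)| <= K * D.
Proof.
move=> mk mw kK wD.
have D0 : 0 <= D by apply: le_trans (wD 0).
have ki : mu.-integrable setT (EFin \o k).
  apply/integrableP; split; first exact/measurable_EFinP.
  by apply: le_lt_trans kK _; rewrite ltry.
have kn := integrable_norm ki.
have kD := @integrableZl _ _ _ mu _ (measurableT) D _ kn.
have kwi : mu.-integrable setT (EFin \o (fun y => k y * w y)).
  apply: (le_integrable _ _ _ kD) => //.
    by apply/measurable_EFinP; exact: measurable_funM.
  move=> y _ /=; rewrite lee_fin [leRHS]ger0_norm ?mulr_ge0// normrM mulrC.
  exact: ler_wpM2r.
split=> //; apply: le_trans (@le_normr_Rintegral _ _ _ mu _ _ measurableT kwi) _.
apply: (@le_trans _ _ (\int[mu]_y (D * `|k y|))).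
  apply: le_Rintegral => //; first exact: (integrable_norm kwi).
  by move=> y _; rewrite normrM mulrC ler_wpM2r.
rewrite (@RintegralZl _ _ _ mu _ _ D measurableT kn) mulrC ler_wpM2r//.
rewrite -lee_fin /Rintegral fineK//.
exact: integrable_fin_num.
Qed.

Section Bfacts.
Variables (beta : R * R -> R) (C0 C1 : R).
Hypotheses (cb : continuous beta)
  (H0 : forall x, (\int[mu]_y `|beta (x, y)|%:E <= C0%:E)%E)
  (H1 : forall x x', x < x' ->
    (\int[mu]_y `|beta (x', y) - beta (x, y)|%:E <= (C1 * (x' - x))%:E)%E).

Let sl s : measurable_fun setT (fun y => beta (s, y)).
Proof. by apply: continuous_measurable_fun; exact: slice_cont2. Qed.

Lemma B_bound (x : R) (w : R -> R) M : measurable_fun setT w -> (forall y, `|w y| <= M) ->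
  `|B beta x w| <= C0 * M.
Proof. by move=> mw wM; have [] := int_prod_le (sl x) mw (H0 x) wM. Qed.

Lemma B_diff_w (x : R) (w1 w2 : R -> R) M1 M2 D : measurable_fun setT w1 -> measurable_fun setT w2 ->
  (forall y, `|w1 y| <= M1) -> (forall y, `|w2 y| <= M2) ->
  (forall y, `|w1 y - w2 y| <= D) ->
  `|B beta x w1 - B beta x w2| <= C0 * D.
Proof.
move=> mw1 mw2 h1 h2 h3.
have [i1 _] := int_prod_le (sl x) mw1 (H0 x) h1.
have [i2 _] := int_prod_le (sl x) mw2 (H0 x) h2.
have [_] := int_prod_le (sl x) (measurable_funB mw1 mw2) (H0 x) h3.
rewrite /B -(@RintegralB _ _ _ mu _ _ _ measurableT i1 i2).
by under eq_Rintegral do rewrite mulrBr.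
Qed.

Lemma B_lip_x (x x' : R) (w : R -> R) M : measurable_fun setT w -> (forall y, `|w y| <= M) ->
  `|B beta x w - B beta x' w| <= C1 * M * `|x - x'|.
Proof.
move=> mw wM; wlog xx' : x x' / x < x'.
  move=> H; have [/H//|/H|->] := ltgtP x x'; first by rewrite distrC (distrC x).
  by rewrite !subrr normr0 mulr0.
have [i1 _] := int_prod_le (sl x) mw (H0 x) wM.
have [i2 _] := int_prod_le (sl x') mw (H0 x') wM.
have [_] := int_prod_le (measurable_funB (sl x') (sl x)) mw (H1 xx') wM.
rewrite distrC /B -(@RintegralB _ _ _ mu _ _ _ measurableT i2 i1).
under eq_Rintegral do rewrite mulrBl.
by rewrite (ltr0_norm (_ : x - x' < 0)) ?subr_lt0// opprB mulrAC.
Qed.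
End Bfacts.

End meas2.

(** * Lipschitz continuity from the weak derivative *)

Section bumps.
Variable R : realType.
Local Notation mu := (@lebesgue_measure R).

(** The functions x^(-k) exp(-1/x), extended by 0: their derivatives are again
    combinations of functions of the family, so that smoothness can be proved
    by closure under differentiation. *)
Definition flat (k : nat) (x : R) : R := if x <= 0 then 0 else x ^- k * expR (- x^-1).

Lemma pow_exp (k : nat) (y : R) : 0 <= y -> y ^+ k.+1 <= k.+1%:R ^+ k.+1 * expR y.
Proof.
move=> y0; have k0 : 0 < k.+1%:R :> R by rewrite ltr0n.
have -> : expR y = expR (y / k.+1%:R) ^+ k.+1.
  by rewrite -expRM_natl mulrCA divff ?mulr1// gt_eqF.
rewrite -exprMn lerXn2r ?nnegrE ?mulr_ge0 ?expR_ge0 ?ler0n//.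
rewrite mulrC -ler_pdivrMr//.
by apply: le_trans (expR_ge1Dx _); rewrite lerDr.
Qed.

Lemma flat_bound (k : nat) : exists2 C, 0 < C & forall x, 0 <= flat k x <= C * x ^+ 2.
Proof.
exists (k.+2%:R ^+ k.+2) => [|x]; first by rewrite exprn_gt0// ltr0n.
rewrite /flat; case: (leP x 0) => x0; first by rewrite lexx mulr_ge0 ?sqr_ge0// exprn_ge0// ler0n.
rewrite mulr_ge0 ?expR_ge0 ?invr_ge0 ?exprn_ge0 ?(ltW x0)//=.
rewrite expRN ler_pdivrMr ?expR_gt0// mulrAC -ler_pdivrMr ?exprn_gt0// -invfM -exprD addnC add2n.
by rewrite -exprVn; apply: pow_exp; rewrite invr_ge0 ltW.
Qed.

Lemma flat_derive (k : nat) (x : R) : is_derive x 1 (flat k) (- k%:R * flat k.+1 x + flat k.+2 x).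
Proof.
have [x0|x0|->] := ltgtP x 0.
- have -> : - k%:R * flat k.+1 x + flat k.+2 x = 0 by rewrite /flat (ltW x0) mulr0 addr0.
  apply: (near_eq_is_derive _ (is_derive_cst 0 x 1)).
  near=> y; rewrite /flat ifT//; apply: ltW; near: y; exact: lt_nbhsl.
- have -> : - k%:R * flat k.+1 x + flat k.+2 x = (- k%:R * x ^- k.+1 + x ^- k.+2) * expR (- x^-1).
    by rewrite /flat !ifF; [rewrite mulrA mulrDl|rewrite leNgt x0..].
  have xn0 : x != 0 by rewrite gt_eqF.
  have D : is_derive x 1 (fun y : R => y^-1 ^+ k * expR (- y^-1)) ((- k%:R * x ^- k.+1 + x ^- k.+2) * expR (- x^-1)).
    have iv : is_derive x 1 (fun z : R => z^-1) (- x ^- 2).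
      by apply: is_derive_eq; first (by apply: is_deriveV); rewrite /GRing.scale/= mulr1.
    have e1 := @is_derive1_comp R expR (fun y => - y^-1) x _ _ (is_derive_expR (- x^-1)) (is_deriveN iv).
    have p1 := is_deriveX k iv.
    have -> : (fun y : R => y^-1 ^+ k * expR (- y^-1)) =
        ([eta GRing.inv] ^+ k : R -> R) * (expR \o (fun y : R => - y^-1)).
      by apply/funext => y; rewrite [RHS]/GRing.mul/= exprfctE.
    apply: (is_derive_eq (is_deriveM p1 e1)).
    rewrite /GRing.scale/= exprfctE opprK; set E := expR _.
    rewrite -!exprVn !exprS; case: (k) => [|n]/=; first by rewrite expr0; ring.
    by rewrite -mulr_natr !exprS; ring.
  apply: (near_eq_is_derive _ D).
  near=> y; rewrite /flat ifF ?exprVn//; apply/negbTE; rewrite -ltNge; near: y; exact: lt_nbhsr.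
- have -> : - k%:R * flat k.+1 0 + flat k.+2 0 = 0 :> R by rewrite /flat lexx mulr0 addr0.
  have [C C0 HC] := flat_bound k.
  apply: (is_derive_quad C0) => h; have /andP[h1 h2] := HC h.
  by rewrite add0r {2}/flat lexx subr0 mul0r subr0 ger0_norm.
Unshelve. all: by end_near. Qed.

Lemma flat_ge0 k x : 0 <= flat k x.
Proof. by have [C _ H] := flat_bound k; have /andP[] := H x. Qed.

Definition rho (x : R) : R := flat 0 (1 + x) * flat 0 (1 - x).

Lemma rho_ge0 x : 0 <= rho x. Proof. by rewrite mulr_ge0 ?flat_ge0. Qed.

Lemma rho_eq0 x : 1 <= `|x| -> rho x = 0.
Proof.
rewrite /rho /flat ler_normr => /orP[] h.
  by rewrite (_ : 1 - x <= 0) ?mulr0//; lra.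
by rewrite (_ : 1 + x <= 0) ?mul0r//; lra.
Qed.

Lemma rho_gt0 x : `|x| < 1 -> 0 < rho x.
Proof.
rewrite /rho /flat ltr_norml => /andP[h1 h2].
rewrite !ifF; [|lra..].
by rewrite mulr_gt0// mulr_gt0 ?expR_gt0 ?invr_gt0 ?exprn_gt0//; lra.
Qed.

Lemma is_derive_cont (f : R -> R) df (x : R) : is_derive x 1 f df -> {for x, continuous f}.
Proof. by move=> ?; apply: differentiable_continuous; apply/derivable1_diffP; exact: ex_derive. Qed.

Lemma flat_cont k : continuous (flat k).
Proof. by move=> x; exact: is_derive_cont (flat_derive k x). Qed.

Lemma rho_cont : continuous rho.
Proof.
move=> x; apply: cvgM.
  apply: (@continuous_comp _ _ _ (fun z : R => 1 + z) (flat 0)); last exact: flat_cont.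
  by apply: cvgD; [exact: cvg_cst|exact: cvg_id].
apply: (@continuous_comp _ _ _ (fun z : R => 1 - z) (flat 0)); last exact: flat_cont.
by apply: cvgB; [exact: cvg_cst|exact: cvg_id].
Qed.

Lemma rho_bnd : exists2 C, 0 < C & forall x, rho x <= C.
Proof.
have [C C0 HC] := flat_bound 0; exists (C * 4 * (C * 4)) => [|x].
  by rewrite !mulr_gt0.
have [h|/rho_eq0 ->] := ltP `|x| 1; last by rewrite !mulr_ge0// ltW.
move: h; rewrite ltr_norml => /andP[h1 h2].
have B (y : R) : 0 <= y -> y <= 2 -> flat 0 y <= C * 4.
  move=> y0 y2; have /andP[_ h] := HC y; apply: (le_trans h).
  apply: ler_wpM2l; first exact: ltW.
  have : 0 <= y * (2 - y) by rewrite mulr_ge0//; lra.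
  lra.
by apply: ler_pM; rewrite ?flat_ge0//; apply: B; lra.
Qed.

(** The primitive of the bump, a smooth step; it is kept unnormalised. *)
Definition rho_prim (x : R) : R := \int[mu]_(z in `]-oo, x]) rho z.

Lemma rho_integrable (A : set R) : measurable A -> mu.-integrable A (EFin \o rho).
Proof.
move=> mA; have mr := continuous_measurable_fun rho_cont.
have [C C0 HC] := rho_bnd.
have i1 : mu.-integrable setT (EFin \o (fun z => C * \1_(`[-1, 1]%classic : set R) z)).
  have := @integrable_indic_itv R (-1) 1 true false.
  by move=> /(@integrableZl _ _ _ mu _ measurableT C).
apply: (@integrableS _ _ _ mu setT) => //.
apply: (le_integrable _ _ _ i1) => //; first exact/measurable_EFinP.
move=> x _ /=; rewrite lee_fin ger0_norm ?rho_ge0//.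
rewrite ger0_norm ?mulr_ge0// ?(ltW C0)// indicE.
have [h|/ltW h] := leP 1 `|x|; first by rewrite rho_eq0// mulr_ge0// ltW.
rewrite (_ : (x \in _) = true) ?mulr1//.
by apply/mem_set; rewrite /= in_itv/= -ler_norml.
Qed.

Lemma rho_prim_derive (x : R) : is_derive x 1 rho_prim (rho x).
Proof.
have xx : x < x + 1 by lra.
have [|d1 d2] := continuous_FTC1 xx (rho_integrable (measurable_itv `]-oo, (x + 1)])) _ (@rho_cont x).
  exact: ltNyr.
by apply: DeriveDef; [exact: d1|rewrite -derive1E].
Qed.

Lemma rho_prim_MVT (x y : R) : x <= y -> exists2 z, x <= z <= y & rho_prim y - rho_prim x = rho z * (y - x).
Proof.
rewrite le_eqVlt => /predU1P[->|xy]; first by exists y; rewrite ?lexx// !subrr mulr0.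
have [z + e] := @MVT _ rho_prim rho x y xy (fun z _ => rho_prim_derive z)
  (derivable_within_continuous (fun z _ => @ex_derive _ _ _ _ _ _ _ (rho_prim_derive z))).
by rewrite in_itv/= => /andP[h1 h2]; exists z => //; rewrite !ltW.
Qed.

Lemma rho_prim_nd x y : x <= y -> rho_prim x <= rho_prim y.
Proof.
move=> xy; have [z _] := rho_prim_MVT xy.
have : 0 <= rho z * (y - x) by rewrite mulr_ge0 ?rho_ge0 ?subr_ge0.
by lra.
Qed.

Lemma rho_prim_left x : x <= -1 -> rho_prim x = 0.
Proof.
move=> x1; rewrite /rho_prim (@eq_Rintegral _ _ _ mu _ (cst 0)).
  by rewrite Rintegral_cst//= mul0r.
move=> z /[!inE]/=; rewrite in_itv/= => zx; apply: rho_eq0.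
by rewrite ler_normr; apply/orP; right; lra.
Qed.

Lemma rho_prim_right x : 1 <= x -> rho_prim x = rho_prim 1.
Proof.
move=> x1; have [z /andP[z1 _]] := rho_prim_MVT x1.
by rewrite rho_eq0 ?mul0r; [lra|rewrite ler_normr z1].
Qed.

Lemma rho_prim1_gt0 : 0 < rho_prim 1.
Proof.
have h1 := @rho_prim_nd (1/2) 1; have h2 := @rho_prim_nd (-1) 0.
have h3 := @rho_prim_left (-1) (lexx _).
have [|z /andP[z1 z2] h4] := @rho_prim_MVT 0 (1/2); first lra.
have : 0 < rho z by apply: rho_gt0; rewrite ltr_norml; lra.
lra.
Qed.

Definition aff (a b c : R) (p : R * R) : R := a * p.1 + b * p.2 + c.

(** A class of functions of two variables that consists of differentiable
    functions and is closed under directional derivatives, hence of smooth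
    functions; it contains the test functions needed here. *)
Inductive test_class : (R * R -> R) -> Prop :=
| tc_flat k a b c : test_class (fun p => flat k (aff a b c p))
| tc_prim a b c : test_class (fun p => rho_prim (aff a b c p))
| tc_add F G : test_class F -> test_class G -> test_class (fun p => F p + G p)
| tc_mul F G : test_class F -> test_class G -> test_class (fun p => F p * G p)
| tc_scale k F : test_class F -> test_class (fun p => k * F p).

Lemma aff_diff a b c p : differentiable (aff a b c) p.
Proof.
apply: differentiableD; last exact: differentiable_cst.
apply: differentiableD.
  exact: (differentiableZ a (@differentiable_fst2 R p)).
exact: (differentiableZ b (@differentiable_snd2 R p)).
Qed.

Lemma aff_comp_diff (f f' : R -> R) a b c p : (forall x : R, is_derive x 1 f (f' x)) ->
  differentiable (fun p => f (aff a b c p)) p.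
Proof.
move=> df; apply: (@differentiable_comp _ _ _ _ (aff a b c) f); first exact: aff_diff.
by apply/derivable1_diffP; have := df (aff a b c p) => ?; exact: ex_derive.
Qed.

Lemma aff_comp_derive (f f' : R -> R) a b c (v : R * R) : (forall x : R, is_derive x 1 f (f' x)) ->
  'D_v (fun p => f (aff a b c p)) = fun p => (a * v.1 + b * v.2) * f' (aff a b c p).
Proof.
move=> df; apply/funext => p.
have -> : 'D_v (fun p => f (aff a b c p)) p = 'D_(a * v.1 + b * v.2) f (aff a b c p).
  rewrite /derive.
  suff -> : (fun h : R => h^-1 *: (((fun p => f (aff a b c p)) \o shift p) (h *: v) - f (aff a b c p))) =
    (fun h => h^-1 *: ((f \o shift (aff a b c p)) (h *: (a * v.1 + b * v.2)) - f (aff a b c p))) by [].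
  apply/funext => h /=; congr (_ *: (f _ - _)).
  by rewrite /aff/= /GRing.scale/=; ring.
have d := df (aff a b c p).
have dd : differentiable f (aff a b c p) by apply/derivable1_diffP; exact: ex_derive.
rewrite deriveE//; set k := _ + _; have kE : k = k *: (1 : R) by rewrite /GRing.scale/= mulr1.
by rewrite kE linearZ -deriveE// derive_val -kE.
Qed.

Lemma tc_closed F : test_class F -> (forall p, differentiable F p) /\ forall v, test_class ('D_v F).
Proof.
elim=> {F} [k a b c|a b c|F G sF [dF DF] sG [dG DG]|F G sF [dF DF] sG [dG DG]|k F sF [dF DF]].
- split=> [p|v]; first exact: aff_comp_diff (flat_derive k).
  rewrite (aff_comp_derive _ _ _ _ (flat_derive k)).
  apply: tc_scale; apply: tc_add; first apply: tc_scale; exact: tc_flat.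
- split=> [p|v]; first exact: aff_comp_diff rho_prim_derive.
  rewrite (aff_comp_derive _ _ _ _ rho_prim_derive); apply: tc_scale; apply: tc_mul.
    have -> : (fun x => flat 0 (1 + aff a b c x)) = fun x => flat 0 (aff a b (1 + c) x).
      by apply/funext => x; rewrite /aff; congr flat; ring.
    exact: tc_flat.
  have -> : (fun x => flat 0 (1 - aff a b c x)) = fun x => flat 0 (aff (- a) (- b) (1 - c) x).
    by apply/funext => x; rewrite /aff; congr flat; ring.
  exact: tc_flat.
- split=> [p|v]; first exact: differentiableD.
  rewrite (_ : 'D_v _ = fun p => 'D_v F p + 'D_v G p); first exact: tc_add.
  by apply/funext => p; rewrite deriveD//; exact: diff_derivable.
- split=> [p|v]; first exact: differentiableM.
  rewrite (_ : 'D_v _ = fun p => F p * 'D_v G p + G p * 'D_v F p).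
    by apply: tc_add; apply: tc_mul.
  by apply/funext => p; rewrite deriveM//; exact: diff_derivable.
- split=> [p|v]; first exact: differentiableZ.
  rewrite (_ : 'D_v _ = fun p => k * 'D_v F p); first exact: tc_scale.
  by apply/funext => p; rewrite deriveZ//; exact: diff_derivable.
Qed.

Lemma tc_smooth F : test_class F -> smooth F.
Proof.
move=> sF vs p; suff : test_class (foldr (fun v g => 'D_v g) F vs) by move=> /tc_closed[].
by elim: vs => //= v vs IH; have [] := tc_closed IH.
Qed.

End bumps.

Section lip.
Variable R : realType.
Local Notation mu := (@lebesgue_measure R).
Local Notation mu2 := (@lebesgue_measure R \x @lebesgue_measure R)%E.
Local Notation I0 := (@rho_prim R 1).

Definition rho_at (c h x : R) : R := rho ((x - c) / h).
Definition prim_at (c h x : R) : R := rho_prim ((x - c) / h).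

Lemma rho_at_cont c h : continuous (rho_at c h).
Proof.
move=> x; apply: (@continuous_comp _ _ _ (fun z : R => (z - c) / h) (@rho R)); last exact: rho_cont.
by apply: cvgM; [apply: cvgB; [exact: cvg_id|exact: cvg_cst]|exact: cvg_cst].
Qed.

Lemma prim_at_derive (c h x : R) : is_derive x 1 (prim_at c h) (rho_at c h x / h).
Proof.
have d1 : is_derive x 1 (fun z : R => (z - c) / h) h^-1.
  have d0 := is_deriveB (is_derive_id x (1 : R)) (is_derive_cst c x 1).
  have := is_deriveM d0 (is_derive_cst h^-1 x 1).
  rewrite scaler0 add0r subr0 /GRing.scale/= mulr1.
  by [].
exact: (@is_derive1_comp R (@rho_prim R) _ x _ _ (rho_prim_derive ((x - c) / h)) d1).
Qed.

Lemma int_rho_at c h : 0 < h -> (\int[mu]_x (rho_at c h x)%:E = (h * I0)%:E)%E.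
Proof.
move=> h0; have ch : c - h < c + h by lra.
have hn0 : h != 0 by rewrite gt_eqF.
have -> : (\int[mu]_x (rho_at c h x)%:E = \int[mu]_(x in `[(c - h)%R, (c + h)%R]) (rho_at c h x)%:E)%E.
  rewrite [RHS]integral_mkcond; apply: eq_integral => x _.
  rewrite patchE; case: ifPn => // /negP xI; rewrite /rho_at rho_eq0// normrM normfV (gtr0_norm h0).
  rewrite ler_pdivlMr// mul1r leNgt; apply/negP => lt; apply: xI.
  by apply/mem_set; rewrite /= in_itv/=; move: lt; rewrite ltr_norml; lra.
have D (x : R) : is_derive x 1 (fun x => h * prim_at c h x) (rho_at c h x).
  have := is_deriveZ h (prim_at_derive c h x).
  by rewrite [h *: _](_ : _ = rho_at c h x)// /GRing.scale/= mulrC divfK.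
rewrite (@continuous_FTC2 R _ (fun x => h * prim_at c h x) _ _ ch).
- rewrite /prim_at (_ : (c + h - c) / h = 1); last by rewrite addrC addKr divff.
  rewrite (_ : (c - h - c) / h = -1); last by rewrite addrAC subrr add0r mulNr divff.
  by rewrite (@rho_prim_left R (-1))// mulr0 sube0.
- by apply: continuous_subspaceT => x; exact: rho_at_cont.
- split; first by move=> x _; have := D x => ?; exact: ex_derive.
    by apply: cvg_at_right_filter; exact: is_derive_cont (D _).
  by apply: cvg_at_left_filter; exact: is_derive_cont (D _).
- by move=> x _; rewrite derive1E; have := D x => ?; rewrite derive_val.
Qed.

Lemma int_tensor (f g : R -> R) (A B : R) : measurable_fun setT f -> measurable_fun setT g ->
  (forall x, 0 <= f x) -> (forall x, 0 <= g x) ->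
  (\int[mu]_x (f x)%:E = A%:E)%E -> (\int[mu]_x (g x)%:E = B%:E)%E ->
  (\int[mu2]_p (f p.1 * g p.2)%:E = (A * B)%:E)%E.
Proof.
move=> mf mg f0 g0 fA gB.
have mF : measurable_fun [set: R * R] (fun p : R * R => (f p.1 * g p.2)%:E).
  apply/measurable_EFinP; apply: measurable_funM.
    exact: (measurableT_comp mf (@measurable_fst _ _ _ _)).
  exact: (measurableT_comp mg (@measurable_snd _ _ _ _)).
rewrite fubini_tonelli1//; last by move=> p; rewrite lee_fin mulr_ge0.
rewrite /fubini_F /=.
under eq_integral => x _.
  under eq_integral => y _ do rewrite EFinM.
  rewrite ge0_integralZl//; [|exact/measurable_EFinP|by move=> y _; rewrite lee_fin|by rewrite lee_fin].
  rewrite gB muleC.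
  over.
rewrite ge0_integralZl//; [|exact/measurable_EFinP|by move=> y _; rewrite lee_fin|].
  by rewrite fA -EFinM mulrC.
rewrite -gB; apply: integral_ge0 => x _; by rewrite lee_fin.
Qed.

Section test.
Variables (T : R) (t0 a b tau eta : R).
Hypotheses (tau0 : 0 < tau) (eta0 : 0 < eta) (ab : a <= b).

(** A bump in time times the difference of two steps in space: its space
    derivative is concentrated near x = a and x = b, so that pairing it with u
    compares u(t, b) with u(t, a). *)
Definition slab_test (p : R * R) : R := rho_at t0 tau p.1 * (prim_at a eta p.2 - prim_at b eta p.2).

Lemma slab_test_class : test_class slab_test.
Proof.
have -> : slab_test = fun p => (flat 0 (aff tau^-1 0 (1 - t0 / tau) p) * flat 0 (aff (- tau^-1) 0 (1 + t0 / tau) p)) *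
   (rho_prim (aff 0 eta^-1 (- a / eta) p) + (-1) * rho_prim (aff 0 eta^-1 (- b / eta) p)).
  apply/funext => p; rewrite /slab_test /rho_at /prim_at /rho /aff; congr (flat _ _ * flat _ _ * _); [ring|ring|].
  by rewrite mulN1r; congr (rho_prim _ - rho_prim _); ring.
apply: tc_mul; first by apply: tc_mul; exact: tc_flat.
by apply: tc_add; [exact: tc_prim|apply: tc_scale; exact: tc_prim].
Qed.

Lemma slab_test_d2 p : d2 slab_test p = rho_at t0 tau p.1 * ((rho_at a eta p.2 - rho_at b eta p.2) / eta).
Proof.
case: p => t x /=; rewrite d2E /slab_test/=.
have D := is_deriveZ (rho_at t0 tau t) (is_deriveB (prim_at_derive a eta x) (prim_at_derive b eta x)).
rewrite [LHS](_ : _ = 'D_1 (rho_at t0 tau t \*: (prim_at a eta - prim_at b eta)) x)//.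
by rewrite derive_val /GRing.scale/= mulrBl.
Qed.

Lemma rho_at_eq0 c h x : 0 < h -> h <= `|x - c| -> rho_at c h x = 0.
Proof.
move=> h0 hx; rewrite /rho_at rho_eq0// normrM normfV (gtr0_norm h0).
by rewrite ler_pdivlMr// mul1r.
Qed.

Lemma prim_at_diff x : 0 <= prim_at a eta x - prim_at b eta x <= I0 * \1_(`[a - eta, b + eta]%classic : set R) x.
Proof.
have mono : prim_at b eta x <= prim_at a eta x.
  by apply: rho_prim_nd; rewrite ler_pM2r ?invr_gt0// lerD2l lerN2.
rewrite subr_ge0 mono /= indicE.
have le1 y : rho_prim y <= I0.
  by have [/rho_prim_nd//|/ltW/rho_prim_right->] := leP y 1.
have ge0 (y : R) : 0 <= rho_prim y.
  case: (leP y (-1)) => [/rho_prim_left->//|/ltW h].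
  by rewrite -(rho_prim_left (lexx (-1))); exact: rho_prim_nd.
have [xI|xI] := boolP (x \in _); first by have := le1 ((x - a) / eta); have := ge0 ((x - b) / eta); rewrite mulr1 /prim_at; lra.
rewrite mulr0; move/negP: xI => xI.
have [xa|xa] := leP x (a - eta).
  have h : rho_prim ((x - a) / eta) = 0.
    by apply: rho_prim_left; rewrite ler_pdivrMr//; lra.
  by rewrite /prim_at h; have := ge0 ((x - b) / eta); lra.
have xb : b + eta < x.
  by rewrite ltNge; apply/negP => xb; apply: xI; apply/mem_set; rewrite /= in_itv/=; lra.
have h y : eta <= y -> rho_prim (y / eta) = I0.
  by move=> ?; apply: rho_prim_right; rewrite ler_pdivlMr// mul1r.
have ab' := ab; by rewrite /prim_at (h (x - a)) ?(h (x - b)) ?subrr//; lra.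
Qed.

Lemma slab_test_ge0 p : 0 <= slab_test p.
Proof. by rewrite mulr_ge0 ?rho_ge0//; have /andP[] := prim_at_diff p.2. Qed.

Lemma slab_test_supp : [set p | slab_test p != 0] `<=`
  `[t0 - tau, t0 + tau]%classic `*` `[a - eta, b + eta]%classic.
Proof.
move=> [t x] /=; rewrite /slab_test/= => nz; split; rewrite /= in_itv/=.
  apply: contraNT nz => h; rewrite rho_at_eq0 ?mul0r//.
  by rewrite leNgt; apply: contra h; rewrite ltr_norml; lra.
apply: contraNT nz => h; have := prim_at_diff x; rewrite indicE.
rewrite (_ : (x \in _) = false) ?mulr0 => [/le_anti <-|]; first by rewrite mulr0.
by apply/negP => /set_mem /=; rewrite in_itv/=; exact/negP.
Qed.

Lemma slab_test_ok : 0 < t0 - tau -> t0 + tau < T -> test_function (open_strip T) slab_test.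
Proof.
move=> h1 h2.
have cK : compact (`[t0 - tau, t0 + tau]%classic `*` `[a - eta, b + eta]%classic : set (R * R)).
  by apply: compact_setX; exact: segment_compact.
have clK : closed (`[t0 - tau, t0 + tau]%classic `*` `[a - eta, b + eta]%classic : set (R * R)).
  by apply: compact_closed => //; exact: norm_hausdorff.
have sub : closure [set p | slab_test p != 0] `<=`
  (`[t0 - tau, t0 + tau]%classic `*` `[a - eta, b + eta]%classic : set (R * R)).
  by move: clK => /closure_id ->; apply: closureS; exact: slab_test_supp.
split; first exact: tc_smooth slab_test_class.
  exact: subclosed_compact (@closed_closure _ _) cK sub.
move=> p /sub[] /=; rewrite !in_itv/= /open_strip/= => /andP[h3 h4] _.
by apply/andP; split; lra.
Qed.

Lemma slab_test_pairing (g : R * R -> R) (L : R) : 0 <= L -> measurable_fun setT g ->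
  (\forall p \ae mu2, `|g p| <= L) ->
  (\int[mu2]_p `|g p * slab_test p|%:E <= (L * (tau * I0) * (I0 * (b - a + 2 * eta)))%:E)%E.
Proof.
move=> L0 mg gL.
have rho0 c h x : 0 <= rho_at c h x by exact: rho_ge0.
have mind : measurable_fun setT (\1_(`[a - eta, b + eta]%classic : set R) : R -> R).
  exact: measurable_indic.
have iI : (\int[mu]_x (I0 * \1_(`[a - eta, b + eta]%classic : set R) x)%:E = (I0 * (b - a + 2 * eta))%:E)%E.
  under eq_integral => x _ do rewrite EFinM.
  rewrite ge0_integralZl//; last by rewrite lee_fin ltW ?rho_prim1_gt0.
    rewrite integral_indic//= setIT lebesgue_measure_itv/= lte_fin ifT; last by have ab' := ab; have eta0' := eta0; lra.
    by rewrite -EFinD -EFinM; congr (_ * _)%:E; ring.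
  exact/measurable_EFinP.
have mr := continuous_measurable_fun (@rho_at_cont t0 tau).
have iL : (\int[mu]_x (L * rho_at t0 tau x)%:E = (L * (tau * I0))%:E)%E.
  under eq_integral => x _ do rewrite EFinM.
  rewrite ge0_integralZl//; [by rewrite int_rho_at// -EFinM|exact/measurable_EFinP|by move=> x _; rewrite lee_fin].
have mtst := cont2_measurable (smooth_cont (tc_smooth slab_test_class)).
have mL : measurable_fun setT (fun x => L * rho_at t0 tau x) by exact: measurable_funM.
have mI : measurable_fun setT (fun x => I0 * \1_(`[a - eta, b + eta]%classic : set R) x).
  exact: measurable_funM.
rewrite -(int_tensor mL mI _ _ iL iI); last 2 first.
- by move=> x; rewrite mulr_ge0.
- by move=> x; rewrite mulr_ge0// ltW ?rho_prim1_gt0.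
apply: ae_ge0_le_integral => //.
- have mgt := measurable_funM mg mtst.
  by apply/measurable_EFinP; exact: (measurableT_comp (@normr_measurable R setT) mgt).
- by move=> p _; rewrite lee_fin; apply: mulr_ge0; apply: mulr_ge0 => //; exact/ltW/rho_prim1_gt0.
- apply/measurable_EFinP; apply: measurable_funM.
    exact: (measurableT_comp mL (@measurable_fst _ _ _ _)).
  exact: (measurableT_comp mI (@measurable_snd _ _ _ _)).
case: gL => N [mN N0 sN]; exists N; split => // p /= h.
apply: sN => /= gp; apply: h => _; rewrite lee_fin normrM /slab_test.
rewrite (ger0_norm (_ : 0 <= _ * _)); last by exact: (slab_test_ge0 p).
rewrite [leLHS]mulrA; have /andP[e1 e2] := prim_at_diff p.2.
by apply: ler_pM; [exact: mulr_ge0|exact: e1|exact: ler_wpM2r|exact: e2].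
Qed.
End test.

Section lipschitz.
Variables (T M : R) (u : R * R -> R).
Hypothesis ucont : {within strip T, continuous u}.
Hypothesis uM : forall p, strip T p -> `|u p| <= M.

(** Pairing u with the space derivative of [slab_test] gives at most
    tau I^2 (u(t0,a) - u(t0,b) + 2 k), while the pairing of its weak derivative
    with [slab_test] is in absolute value at most L times the integral of
    [slab_test]; here I is the total mass of the bump. *)
Lemma weak_lip_estimate (g : R * R -> R) (L t0 a b k tau eta : R) : 0 <= L ->
  measurable_fun (open_strip T) g ->
  (\forall p \ae mu2, `|(g \_ (open_strip T)) p| <= L) ->
  (forall phi, test_function (open_strip T) phi ->
     \int[mu2]_(p in open_strip T) (u p * d2 phi p) =
     - \int[mu2]_(p in open_strip T) (g p * phi p)) ->
  0 < tau -> 0 < eta -> a <= b -> 0 < t0 - tau -> t0 + tau < T ->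
  (forall t x, `|t - t0| < tau -> `|x - a| < eta -> u (t, x) <= u (t0, a) + k) ->
  (forall t x, `|t - t0| < tau -> `|x - b| < eta -> u (t0, b) - k <= u (t, x)) ->
  u (t0, b) - u (t0, a) <= L * (b - a + 2 * eta) + 2 * k.
Proof.
move=> L0 mg gL wd tau0 eta0 ab lo hi ha hb.
set ua := u (t0, a); set ub := u (t0, b).
pose phi := slab_test t0 a b tau eta.
have e := wd phi (slab_test_ok tau0 eta0 ab lo hi).
have mD : measurable (open_strip T).
  have -> : open_strip T = `]0, T[%classic `*` setT :> set (R * R).
    by apply/seteqP; split => [p /= h|p [/=]]; rewrite ?in_itv//; split => //; rewrite /= in_itv.
  by apply: measurableX => //; exact: measurable_itv.
have rho0 c h x : 0 <= rho_at c h x by exact: rho_ge0.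
have I00 := @rho_prim1_gt0 R.
have mr c h : measurable_fun setT (rho_at c h) := continuous_measurable_fun (@rho_at_cont c h).
pose P c (p : R * R) := rho_at t0 tau p.1 * rho_at c eta p.2.
have PP c : (\int[mu2]_p (P c p)%:E = (tau * I0 * (eta * I0))%:E)%E.
  apply: (int_tensor _ _ (rho0 _ _) (rho0 _ _) (int_rho_at _ tau0) (int_rho_at _ eta0)).
  - exact: mr.
  - exact: mr.
have mP c : measurable_fun setT (P c).
  apply: measurable_funM.
    exact: (measurableT_comp (mr _ _) (@measurable_fst _ _ _ _)).
  exact: (measurableT_comp (mr _ _) (@measurable_snd _ _ _ _)).
have P0 c p : 0 <= P c p by exact: mulr_ge0.
have iP c : mu2.-integrable setT (EFin \o P c).
  apply/integrableP; split; first by apply/measurable_EFinP; exact: mP.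
  under eq_integral => p _ do rewrite gee0_abs ?lee_fin//.
  by rewrite PP ltry.
have RP c : \int[mu2]_p P c p = tau * I0 * (eta * I0) by rewrite /Rintegral PP.
pose H1 := (fun p => u p * d2 phi p) \_ (open_strip T).
pose H2 := (fun p => g p * phi p) \_ (open_strip T).
rewrite (@Rintegral_mkcond _ _ _ mu2 (open_strip T) (fun p => u p * d2 phi p)) in e.
rewrite (@Rintegral_mkcond _ _ _ mu2 (open_strip T) (fun p => g p * phi p)) in e.
rewrite -/H1 -/H2 in e.
have tT t : `|t - t0| < tau -> 0 < t < T by rewrite ltr_norml; lra.
have rz c h x : 0 < h -> rho_at c h x != 0 -> `|x - c| < h.
  by move=> h0; apply: contraNT; rewrite -leNgt => /(rho_at_eq0 h0) ->.
have E1 : H1 = fun p => uext u (t0 - tau) (t0 + tau) p *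
    (rho_at t0 tau p.1 * ((rho_at a eta p.2 - rho_at b eta p.2) / eta)).
  apply/funext => p; rewrite /H1 patchE slab_test_d2.
  have [->|/(rz _ _ _ tau0) h] := eqVneq (rho_at t0 tau p.1) 0.
    by rewrite !mul0r !mulr0; case: ifP.
  rewrite mem_set; last exact: tT.
  rewrite /uext clampt_id; first by case: (p).
  by move: h; rewrite ltr_norml; lra.
have md : measurable_fun setT (fun p : R * R => rho_at t0 tau p.1 * ((rho_at a eta p.2 - rho_at b eta p.2) / eta)).
  apply: measurable_funM; first exact: (measurableT_comp (mr _ _) (@measurable_fst _ _ _ _)).
  apply: measurable_funM => //; apply: measurable_funB.
    exact: (measurableT_comp (mr _ _) (@measurable_snd _ _ _ _)).
  exact: (measurableT_comp (mr _ _) (@measurable_snd _ _ _ _)).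
have mU : measurable_fun setT (uext u (t0 - tau) (t0 + tau)).
  have h1 : 0 <= t0 - tau by lra.
  have h2 : t0 - tau <= t0 + tau by lra.
  by apply: cont2_measurable; exact: (uext_cont ucont h1 h2 hi).
have mH1 : measurable_fun setT H1 by rewrite E1; exact: measurable_funM.
pose K p := (ua + k) / eta * P a p - (ub - k) / eta * P b p.
have H1K p : H1 p <= K p.
  have -> : K p = rho_at t0 tau p.1 * (((ua + k) * rho_at a eta p.2 - (ub - k) * rho_at b eta p.2) / eta).
    by rewrite /K /P; ring.
  rewrite E1 mulrCA; have [->|/(rz _ _ _ tau0) h] := eqVneq (rho_at t0 tau p.1) 0; first by rewrite !mul0r.
  rewrite ler_wpM2l// mulrA ler_pM2r ?invr_gt0//.
  have -> : uext u (t0 - tau) (t0 + tau) p = u p.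
    rewrite /uext clampt_id; first by case: (p).
    by move: h; rewrite ltr_norml; lra.
  rewrite mulrBr; apply: lerB.
    have [->|/(rz _ _ _ eta0) h2] := eqVneq (rho_at a eta p.2) 0; first by rewrite !mulr0.
    by rewrite ler_wpM2r//; case: (p) h h2 => t x; exact: ha.
  have [->|/(rz _ _ _ eta0) h2] := eqVneq (rho_at b eta p.2) 0; first by rewrite !mulr0.
  by rewrite ler_wpM2r//; case: (p) h h2 => t x; exact: hb.
have iZ c w := @integrableZl _ _ _ mu2 _ measurableT w _ (iP c).
have iH1 : mu2.-integrable setT (EFin \o H1).
  have := @integrableD _ _ _ mu2 _ measurableT _ _ (iZ a (M / eta)) (iZ b (M / eta)).
  apply: le_integrable => //; first exact/measurable_EFinP.
  move=> p _ /=; rewrite lee_fin E1.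
  have M0 : 0 <= M by apply: le_trans (uM (_ : strip T (t0, a))) => //; rewrite /strip/=; apply/andP; split; lra.
  rewrite [leRHS]ger0_norm; last by rewrite addr_ge0// mulr_ge0 ?divr_ge0 ?(ltW eta0).
  rewrite normrM; apply: (@le_trans _ _ (M * (rho_at t0 tau p.1 * ((rho_at a eta p.2 + rho_at b eta p.2) / eta)))).
    apply: ler_pM => //.
      apply: uM; rewrite /strip/=.
      by have /andP[c1 c2] := @clampt_in R (t0 - tau) (t0 + tau) p.1 (ltac:(lra)); apply/andP; split; lra.
    rewrite normrM (ger0_norm (rho0 _ _ _)) ler_wpM2l// normrM (gtr0_norm (_ : 0 < eta^-1)) ?invr_gt0//.
    rewrite ler_wpM2r ?invr_ge0 ?(ltW eta0)//.
    by apply: (le_trans (ler_normB _ _)); rewrite !ger0_norm.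
  by rewrite le_eqVlt; apply/orP; left; apply/eqP; rewrite /P; ring.
have iK : mu2.-integrable setT (EFin \o K).
  by have := @integrableB _ _ _ mu2 _ measurableT _ _ (iZ a ((ua + k) / eta)) (iZ b ((ub - k) / eta)).
have iH1K : \int[mu2]_p H1 p <= \int[mu2]_p K p by exact: le_Rintegral.
have vK : \int[mu2]_p K p = tau * I0 * I0 * (ua - ub + 2 * k).
  rewrite /K (@RintegralB _ _ _ mu2 _ _ _ measurableT (iZ a ((ua + k) / eta)) (iZ b ((ub - k) / eta))).
  rewrite (@RintegralZl _ _ _ mu2 _ _ _ measurableT (iP a)) (@RintegralZl _ _ _ mu2 _ _ _ measurableT (iP b)) !RP.
  by field; rewrite gt_eqF.
have H2E : H2 = fun p => (g \_ (open_strip T)) p * phi p.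
  by apply/funext => p; rewrite /H2 !patchE; case: ifP => // _; rewrite mul0r.
have mg' : measurable_fun setT (g \_ (open_strip T)).
  exact/(measurable_restrictT _ mD).
have aeb := slab_test_pairing t0 tau0 eta0 ab L0 mg' gL.
have mphi := cont2_measurable (smooth_cont (tc_smooth (slab_test_class t0 a b tau eta))).
have iH2 : mu2.-integrable setT (EFin \o H2).
  apply/integrableP; split.
    by apply/measurable_EFinP; rewrite H2E; exact: measurable_funM.
  by rewrite H2E; apply: le_lt_trans aeb _; rewrite ltry.
have nH2 : `|\int[mu2]_p H2 p| <= L * (tau * I0) * (I0 * (b - a + 2 * eta)).
  apply: (le_trans (@le_normr_Rintegral _ _ _ mu2 _ _ measurableT iH2)).
  have aeb' : (\int[mu2]_p `|H2 p|%:E <= (L * (tau * I0) * (I0 * (b - a + 2 * eta)))%:E)%E.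
    by rewrite H2E.
  rewrite -lee_fin /Rintegral fineK//.
  by apply: integrable_fin_num => //; exact: (integrable_norm iH2).
have : tau * I0 * I0 * (ub - ua) <= tau * I0 * I0 * (L * (b - a + 2 * eta) + 2 * k).
  move: nH2; rewrite ler_norml => /andP[_ n2].
  move: iH1K; rewrite vK e; move: (\int[mu2]_p H2 p) n2 => h.
  by clear; lra.
by rewrite ler_pM2l// !mulr_gt0.
Qed.

Lemma u_lip_interior (g : R * R -> R) (L t0 a b : R) : 0 <= L ->
  measurable_fun (open_strip T) g ->
  (\forall p \ae mu2, `|(g \_ (open_strip T)) p| <= L) ->
  (forall phi, test_function (open_strip T) phi ->
     \int[mu2]_(p in open_strip T) (u p * d2 phi p) =
     - \int[mu2]_(p in open_strip T) (g p * phi p)) ->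
  0 < t0 < T -> a <= b -> u (t0, b) - u (t0, a) <= L * (b - a).
Proof.
move=> L0 mg gL wd /andP[t00 t0T] ab; apply/ler_addgt0Pr => e e0.
have L1 : 0 < 2 * L + 2 by lra.
pose k := e / (2 * L + 2).
have k0 : 0 < k by rewrite divr_gt0.
have t0S : 0 <= t0 < T by rewrite ltW.
have [d1 d10 H1] := u_near ucont a t0S k0.
have [d2 d20 H2] := u_near ucont b t0S k0.
pose m := Num.min (Num.min d1 d2) (Num.min k (Num.min (t0 / 2) ((T - t0) / 2))).
have m0 : 0 < m by rewrite !lt_min d10 d20 k0 !divr_gt0// subr_gt0.
have : m <= m by [].
rewrite {2}/m !le_min => /andP[/andP[m1 m2] /andP[mk /andP[mt mT]]].
have lo : 0 < t0 - m by lra.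
have hi : t0 + m < T by lra.
have tT t : `|t - t0| < m -> 0 <= t < T by rewrite ltr_norml => /andP[]; lra.
have A t x : `|t - t0| < m -> `|x - a| < m -> u (t, x) <= u (t0, a) + k.
  move=> h1 h2; have := H1 t x (tT _ h1) (lt_le_trans h1 m1) (lt_le_trans h2 m1).
  by rewrite ltr_norml => /andP[]; lra.
have B t x : `|t - t0| < m -> `|x - b| < m -> u (t0, b) - k <= u (t, x).
  move=> h1 h2; have := H2 t x (tT _ h1) (lt_le_trans h1 m2) (lt_le_trans h2 m2).
  by rewrite ltr_norml => /andP[]; lra.
have := weak_lip_estimate L0 mg gL wd m0 m0 ab lo hi A B.
have : L * m <= L * k by rewrite ler_wpM2l.
have : k * (2 * L + 2) = e by rewrite divfK// gt_eqF.
lra.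
Qed.

Lemma u_lip : weak_d2_Linfty (open_strip T) u ->
  exists2 L, 0 <= L & forall t a b : R, 0 <= t < T -> a <= b -> u (t, b) - u (t, a) <= L * (b - a).
Proof.
move=> [g [mg gL wd]].
have [L L0 HL] : exists2 L, 0 <= L & \forall p \ae mu2, `|(g \_ (open_strip T)) p| <= L.
  have [L L0 HL] := @ess_sup_bound R _ _ mu2 _ gL; exists L => //.
exists L => // t a b tT ab.
have lip t1 : 0 < t1 < T -> u (t1, b) - u (t1, a) <= L * (b - a).
  by move=> t1T; exact: (u_lip_interior L0 mg HL wd).
have /andP[] := tT; rewrite le_eqVlt => /predU1P[t0|t0] tT'; last by apply: lip; rewrite t0.
apply/ler_addgt0Pr => e e0; have e2 : 0 < e / 2 by rewrite divr_gt0.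
have [d1 d10 H1] := u_near ucont a tT e2.
have [d2 d20 H2] := u_near ucont b tT e2.
pose m := Num.min (Num.min d1 d2) T / 2.
have m0 : 0 < m by rewrite divr_gt0// !lt_min d10 d20; lra.
have [h1 h2 h3] : [/\ 2 * m <= d1, 2 * m <= d2 & 2 * m <= T].
  have -> : 2 * m = Num.min (Num.min d1 d2) T by rewrite /m mulrC divfK.
  by split; rewrite !ge_min lexx ?orbT.
have mT : 0 <= m < T by lra.
have tm : `|m - t| < 2 * m by rewrite -t0 subr0 gtr0_norm//; lra.
have c0 (y d : R) : 0 < d -> `|y - y| < d by rewrite subrr normr0.
have := H1 m a mT (lt_le_trans tm h1) (c0 _ _ d10).
have := H2 m b mT (lt_le_trans tm h2) (c0 _ _ d20).
have := lip m; rewrite m0 (andP mT).2 => /(_ isT).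
by rewrite !ltr_norml => ? /andP[? ?] /andP[? ?]; lra.
Qed.
End lipschitz.

End lip.

(** * Behaviour in time and at infinity *)

Section gen.
Variable R : realType.
Local Notation mu := (@lebesgue_measure R).

(** The way the limits d -> 0 and Z -> +oo are taken in viscosity inequalities. *)
Lemma ler_of_small_errors (A B E1 E2 Z0 : R) : 0 <= E1 -> 0 <= E2 ->
  (forall d Z, 0 < d <= 1 -> Z0 <= Z -> 0 < Z -> A <= B + E1 * d + E2 / Z) -> A <= B.
Proof.
move=> E10 E20 H; apply/ler_addgt0Pr => e e0.
have p1 : 0 < 2 * (E1 + 1) by lra.
have p2 : 0 < 2 * (E2 + 1) / e by rewrite divr_gt0//; lra.
pose d := Num.min 1 (e / (2 * (E1 + 1))).
pose Z := Num.max Z0 (2 * (E2 + 1) / e).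
have d0 : 0 < d by rewrite lt_min ltr01 divr_gt0.
have d1 : d <= 1 by rewrite ge_min lexx.
have dE : d * (2 * (E1 + 1)) <= e by rewrite -ler_pdivlMr// ge_min lexx orbT.
have Z1 : Z0 <= Z by rewrite le_max lexx.
have Z2 : 2 * (E2 + 1) / e <= Z by rewrite le_max lexx orbT.
have Z3 : 0 < Z by lra.
have := H d Z; rewrite d0 d1 => /(_ isT Z1 Z3).
have : E2 / Z <= e / 2.
  rewrite ler_pdivrMr//; rewrite ler_pdivrMr// in Z2; lra.
have : E1 * d <= d * (E1 + 1) by lra.
lra.
Qed.

Lemma C11_slope_ge (h h' : R -> R) (x0 K : R) : C11 h h' ->
  (forall e, 0 < e -> K * e <= h (x0 + e) - h x0) -> K <= h' x0.
Proof.
move=> /C11_gt0[C C0 [_ hC]] H; apply: (@ler_of_small_errors K (h' x0) C 0 0); [exact: ltW|by []|].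
move=> d Z /andP[d0 _] _ _; have := H d d0; have := hC x0 d.
rewrite mul0r addr0 ler_norml => /andP[_ h1] h2.
have : K * d <= (h' x0 + C * d) * d by lra.
by rewrite ler_pM2r.
Qed.

Lemma C11_slope_le (h h' : R -> R) (x0 K : R) : C11 h h' ->
  (forall e, 0 < e -> h x0 - h (x0 - e) <= K * e) -> h' x0 <= K.
Proof.
move=> /C11_gt0[C C0 [_ hC]] H; apply: (@ler_of_small_errors (h' x0) K C 0 0); [exact: ltW|by []|].
move=> d Z /andP[d0 _] _ _; have := H d d0; have := hC x0 (- d).
rewrite mul0r addr0 ler_norml sqrrN => /andP[_ h1] h2.
have : h' x0 * d <= (K + C * d) * d by lra.
by rewrite ler_pM2r.
Qed.

Lemma cont_bounded (c : R -> R) (X : R) : continuous c -> exists2 c1, 0 < c1 &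
  forall x, `|x| <= X -> c x <= c1.
Proof.
move=> cc.
have [b Hb] : exists b, forall x, `|x| <= X -> c x <= b.
  have [X0|X0] := leP 0 X; last by exists 0 => x xX; have := normr_ge0 x; lra.
  have cw : {within `[- X, X], continuous c} by apply: continuous_subspaceT.
  have [|m _ Hm] := @EVT_max R c (- X) X _ cw; first lra.
  by exists (c m) => x; rewrite ler_norml => xX; apply: Hm; rewrite in_itv.
exists (`|b| + 1) => [|x /Hb]; first by have := normr_ge0 b; lra.
by have := ler_norm b; lra.
Qed.
End gen.

Section pen.
Variable R : realType.
Local Notation mu := (@lebesgue_measure R).
Variables (c : R -> R) (beta : R * R -> R) (T M C0 : R).
Hypothesis ccont : continuous c.
Hypothesis cpos : forall x, 0 < c x.
Hypothesis cb : continuous beta.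
Hypothesis H0 : forall x, (\int[mu]_y `|beta (x, y)|%:E <= C0%:E)%E.
Hypothesis M0 : 0 <= M.
Hypothesis C00 : 0 <= C0.

Definition mono_x (u : R * R -> R) := forall t a b : R, 0 <= t < T -> a <= b -> u (t, a) <= u (t, b).

(** What a subsolution, and likewise minus a supersolution, satisfies at a contact
    point with g(t) + a psi(x): the nonlocal term and B are both multiplied by
    the slope a psi', which is small, and c only appears where it is bounded or
    multiplied by 0. *)
Definition pen_prop (w : R * R -> R) :=
  forall (Rf : R) psi psi' R1 N0 C a (g g' : R -> R) (s0 T' t0 x0 : R),
  penalty Rf psi psi' R1 N0 C -> 0 <= a ->
  0 <= s0 -> s0 < t0 -> t0 <= T' -> T' < T -> C11 g g' ->
  (forall t x, s0 <= t <= T' ->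
     w (t, x) - g t - a * psi x <= w (t0, x0) - g t0 - a * psi x0) ->
  g' t0 <= `|a * psi' x0| * (c x0 * (a * (if `|x0| < R1 then N0 else 0)) + C0 * M).

Section one.
Variable u : R * R -> R.
Hypothesis ucont : {within strip T, continuous u}.
Hypothesis uM : forall p, strip T p -> `|u p| <= M.
Hypothesis umono : mono_x u.

Let pen_core psi psi' (Rf R1 N0 C a D G sl A Bv x0 : R) :
  penalty Rf psi psi' R1 N0 C -> 0 <= a -> 0 <= sl ->
  0 <= D ->
  (forall d Z : R, 0 < d <= 1 -> 1 < Z -> 2 * `|x0| <= Z ->
    G <= D * d + sl * (c x0 * (a * ((if `|x0| < R1 then N0 else 0) + C * d) + 4 * M / Z) + C0 * M)) ->
  G <= sl * (c x0 * (a * (if `|x0| < R1 then N0 else 0)) + C0 * M).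
Proof.
move=> [_ _ _ _ [C1 N1 _]] a0 sl0 D0 H.
set N := if _ then _ else _ in H *.
have cx := ltW (cpos x0).
apply: (@ler_of_small_errors R _ _ (D + sl * (c x0 * (a * C))) (sl * (c x0 * (4 * M))) (2 * `|x0| + 2)).
- by rewrite addr_ge0// !mulr_ge0.
- by rewrite !mulr_ge0.
move=> d Z d01 ZZ Z0; have := normr_ge0 x0 => n0.
apply: (le_trans (H d Z d01 _ _)); [lra|lra|].
by rewrite le_eqVlt; apply/orP; left; apply/eqP; ring.
Qed.

Lemma sub_pen : viscosity_subsolution c beta T (usc_env (strip T) u) -> pen_prop u.
Proof.
move=> sub Rf psi psi' R1 N0 C a g g' s0 T' t0 x0 pen a0 s00 s0t0 t0T T'T gC cont.
have [psiC psi0 _ _ [C1 N1 _]] := pen.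
have t0S : 0 <= t0 < T by lra.
have hC := C11Z a psiC.
have hB (x : R) : - (0 : R) <= a * psi x by rewrite oppr0 mulr_ge0//; have [] := psi0 x.
have [D D0 HD] := sub_ineq ucont uM sub s00 s0t0 t0T T'T gC hC hB cont.
have t0I : s0 <= t0 <= T' by rewrite t0T ltW.
have sl0 : 0 <= a * psi' x0.
  apply: (C11_slope_ge hC) => e e0; rewrite mul0r.
  have := cont t0 (x0 + e) t0I; have := @umono t0 x0 (x0 + e) t0S; rewrite lerDl (ltW e0) => /(_ isT); lra.
rewrite ger0_norm//; apply: (pen_core 0 0 pen a0 sl0 (ltW D0)) => d Z d01 Z1 xZ.
have /andP[d0 d1] := d01.
have mu0 := slice_meas ucont t0S.
have ub y : `|u (t0, y)| <= M by exact: uM.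
have := HD d d0; rewrite (A_outE x0 d0 mu0 ub).
have sdb z : `|sd (fun y => u (t0, y)) x0 z| <= 4 * M.
  rewrite /sd; have := ub x0; have := ub (x0 + z); have := ub (x0 - z).
  by rewrite !ler_norml => /andP[? ?] /andP[? ?] /andP[? ?]; lra.
have sdk z : a * sd psi x0 z <= sd (fun y => u (t0, y)) x0 z.
  by rewrite /sd; have := cont t0 (x0 + z) t0I; have := cont t0 (x0 - z) t0I; lra.
have := penalty_int pen a0 (measurable_sd x0 mu0) sdb sdk d01 Z1 xZ.
set A := \int[mu]_(z in _) _; set N := if _ then _ else _ => h1 h2.
have := B_bound cb H0 x0 mu0 ub; rewrite ler_norml => /andP[h3 _].
have : a * psi' x0 * (c x0 * (- (a * (N + C * d)) - 4 * M / Z)) <= a * psi' x0 * (c x0 * A).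
  by rewrite ler_wpM2l// ler_wpM2l// ltW.
have : a * psi' x0 * - (C0 * M) <= a * psi' x0 * B beta x0 (fun y => u (t0, y)).
  by rewrite ler_wpM2l.
lra.
Qed.

Lemma super_pen : viscosity_supersolution c beta T (lsc_env (strip T) u) -> pen_prop (fun p => - u p).
Proof.
move=> sup Rf psi psi' R1 N0 C a g g' s0 T' t0 x0 pen a0 s00 s0t0 t0T T'T gC cont.
have [psiC psi0 _ _ [C1 N1 _]] := pen.
have t0S : 0 <= t0 < T by lra.
have hC := C11Z a psiC.
have hB (x : R) : - (0 : R) <= a * psi x by rewrite oppr0 mulr_ge0//; have [] := psi0 x.
have cont' t x : s0 <= t <= T' -> u (t0, x0) + g t0 + a * psi x0 <= u (t, x) + g t + a * psi x.
  by move=> /(cont t x); lra.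
have [D D0 HD] := super_ineq ucont uM sup s00 s0t0 t0T T'T gC hC hB cont'.
have t0I : s0 <= t0 <= T' by rewrite t0T ltW.
have sl0 : a * psi' x0 <= 0.
  apply: (C11_slope_le hC) => e e0; rewrite mul0r.
  have := cont t0 (x0 - e) t0I; have := @umono t0 (x0 - e) x0 t0S; rewrite gerBl (ltW e0) => /(_ isT); lra.
rewrite ler0_norm//; have sl0' : 0 <= - (a * psi' x0) by rewrite oppr_ge0.
apply: (pen_core 0 0 pen a0 sl0' (ltW D0)) => d Z d01 Z1 xZ.
have /andP[d0 d1] := d01.
have mu0 := slice_meas ucont t0S.
have ub y : `|u (t0, y)| <= M by exact: uM.
have := HD d d0; rewrite (A_outE x0 d0 mu0 ub).
have sdb z : `|sd (fun y => u (t0, y)) x0 z| <= 4 * M.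
  rewrite /sd; have := ub x0; have := ub (x0 + z); have := ub (x0 - z).
  by rewrite !ler_norml => /andP[? ?] /andP[? ?] /andP[? ?]; lra.
have sdb' z : `|- 1 * sd (fun y => u (t0, y)) x0 z| <= 4 * M by rewrite mulN1r normrN.
have sdk z : a * sd psi x0 z <= -1 * sd (fun y => u (t0, y)) x0 z.
  by rewrite /sd; have := cont t0 (x0 + z) t0I; have := cont t0 (x0 - z) t0I; lra.
have msd := measurable_sd x0 mu0.
have msd' : measurable_fun setT (fun z => -1 * sd (fun y => u (t0, y)) x0 z).
  by apply: measurable_funM.
have := penalty_int pen a0 msd' sdb' sdk d01 Z1 xZ.
under eq_Rintegral do rewrite -mulrA.
rewrite (@RintegralZl _ _ _ mu _ _ (-1) (measurable_itv _) (integrable_ker d0 msd sdb)).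
set A := \int[mu]_(z in _) _; set N := if _ then _ else _ => h1 h2.
have := B_bound cb H0 x0 mu0 ub; rewrite ler_norml => /andP[_ h3].
have : - (a * psi' x0) * (c x0 * (- (a * (N + C * d)) - 4 * M / Z)) <= - (a * psi' x0) * (c x0 * - A).
  by rewrite ler_wpM2l// ler_wpM2l ?(ltW (cpos x0))//; lra.
have : - (a * psi' x0) * - (C0 * M) <= - (a * psi' x0) * - B beta x0 (fun y => u (t0, y)).
  by rewrite ler_wpM2l// lerN2.
lra.
Qed.

End one.

(** Touch w by gam (t - s) + a psi(x).  If w exceeded K at time t1 there would be
    a contact at a time > s, where [pen_prop] gives gam <= a Q with Q independent
    of a; this is false for small a. *)
Lemma sup_decr (w : R * R -> R) (s t1 K : R) :
  {within strip T, continuous w} -> (forall p, strip T p -> `|w p| <= M) -> pen_prop w ->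
  0 <= s -> s <= t1 -> t1 < T -> (forall x, w (s, x) <= K) -> forall x, w (t1, x) <= K.
Proof.
move=> wcont wM pw s0 st1 t1T wK x1; rewrite leNgt; apply/negP => gtK.
have lt1 : s < t1.
  by rewrite lt_neqAle st1 andbT; apply/eqP => e; have := wK x1; rewrite e; lra.
pose m := w (t1, x1) - K; have m0 : 0 < m by rewrite subr_gt0.
have mE : w (t1, x1) = K + m by rewrite /m; ring.
have ts0 : 0 < t1 - s by rewrite subr_gt0.
pose gam := m / 4 / (t1 - s); have gam0 : 0 < gam by rewrite !divr_gt0.
have gE : gam * (t1 - s) = m / 4 by rewrite /gam divfK// gt_eqF.
have [psi [psi' [R1 [N0 [C pen]]]]] := @exists_penalty R 1 (lexx _).
have [psiC psi0 _ coer [C1 N1 _]] := pen.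
have [P P0 [psiP _]] := C11_gt0 psiC.
have [c1 c10 Hc] := cont_bounded R1 ccont.
pose Q := P * (c1 * N0 + C0 * M).
have Q0 : 0 <= Q.
  by rewrite mulr_ge0 ?(ltW P0)// addr_ge0// mulr_ge0// ltW.
have p1 : 0 < psi x1 + 1 by have [] := psi0 x1; lra.
pose a := Num.min 1 (Num.min (gam / (Q + 1)) (m / 4 / (psi x1 + 1))).
have Q1 : 0 < Q + 1 by lra.
have a0 : 0 < a by rewrite !lt_min ltr01 !divr_gt0.
have a1 : a <= 1 by rewrite ge_min lexx.
have a2 : a * (Q + 1) <= gam by rewrite -ler_pdivlMr// !ge_min lexx ?orbT.
have a3 : a * (psi x1 + 1) <= m / 4 by rewrite -ler_pdivlMr// !ge_min lexx ?orbT.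
have [Y HY] := coer ((2 * M + m + 1) / a).
have gC := C11_lin gam (- gam * s).
have t1I : s <= t1 <= t1 by rewrite st1 lexx.
have [|t0 [x0 [t0I mx]]] := @exists_contact R T w wcont 1 s t1 Y t1 x1 _ _ _ _ s0 st1 t1T gC (C11Z a psiC) t1I.
  move=> t x tst xY.
  have := HY x (ltW xY); rewrite ler_pdivrMr// => h1.
  have tS : strip T (t, x) by rewrite /strip/=; lra.
  have t1S : strip T (t1, x1) by rewrite /strip/=; lra.
  have := wM _ tS; rewrite ler_norml => /andP[_ h2].
  have := wM _ t1S; rewrite ler_norml => /andP[h3 _].
  have : 0 <= gam * (t - s) by rewrite mulr_ge0 ?(ltW gam0)//; lra.
  lra.
have mx' t x : s <= t <= t1 -> w (t, x) - (gam * t + - gam * s) - a * psi x <=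
    w (t0, x0) - (gam * t0 + - gam * s) - a * psi x0.
  by move=> /(mx t x); rewrite !mul1r.
have /andP[t0s t0t] := t0I.
have psix0 : 0 <= a * psi x0 by rewrite mulr_ge0 ?(ltW a0)//; have [] := psi0 x0.
have st0 : s < t0.
  rewrite lt_neqAle t0s andbT; apply/eqP => e; have := mx' t1 x1; rewrite st1 lexx => /(_ isT).
  by have := wK x0; rewrite -e; lra.
have := pw _ _ _ _ _ _ _ _ _ s t1 t0 x0 pen (ltW a0) s0 st0 t0t t1T gC mx'.
rewrite /cst normrM (gtr0_norm a0) => H.
have cN : c x0 * (a * (if `|x0| < R1 then N0 else 0)) <= c1 * N0.
  case: ifP => h; last by rewrite !mulr0 mulr_ge0// ltW.
  have := Hc x0 (ltW h) => h1.
  apply: ler_pM => //; [exact: ltW|by rewrite mulr_ge0// ltW|by rewrite ler_piMl].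
have : a * `|psi' x0| * (c x0 * (a * (if `|x0| < R1 then N0 else 0)) + C0 * M) <= a * Q.
  rewrite -mulrA ler_wpM2l ?(ltW a0)//; apply: ler_pM => //.
    rewrite addr_ge0 ?mulr_ge0 ?(ltW (cpos x0)) ?(ltW a0)//; by case: ifP.
  by rewrite lerD2r.
lra.
Qed.

End pen.

Section absw.
Variable R : realType.
Variables (T M : R).

Definition near_prop (w : R * R -> R) := forall t1 x1 e : R, 0 <= t1 < T -> 0 < e ->
  exists2 d, 0 < d & forall t x, 0 <= t < T -> `|t - t1| < d -> `|x - x1| < d ->
    `|w (t, x) - w (t1, x1)| < e.

Definition decr_prop (w : R * R -> R) := forall s t K : R, 0 <= s -> s <= t -> t < T ->
  (forall x, w (s, x) <= K) -> forall x, w (t, x) <= K.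

Section one.
Variable w : R * R -> R.
Hypothesis wnear : near_prop w.
Hypothesis wM : forall p, strip T p -> `|w p| <= M.
Hypothesis wmono : mono_x T w.
Hypothesis wdecr : decr_prop w.

(** The supremum over x is almost attained at one point X, and stays so for
    nearby times by continuity at (s, X). *)
Lemma sup_point (s e : R) : 0 <= s < T -> 0 < e -> exists S X d, [/\ 0 < d,
  (forall x, w (s, x) <= S), S - e < w (s, X) &
  forall t, 0 <= t < T -> `|t - s| < d -> S - e < w (t, X)].
Proof.
move=> sT e0; pose E := [set w (s, x) | x in [set: R]].
have e2 : 0 < e / 2 by rewrite divr_gt0.
have hE : has_sup E.
  split; first by exists (w (s, 0)); exists 0.
  exists M => _ [x _ <-]; apply: le_trans (ler_norm _) _; exact: wM.
have [_ [X _ <-] hX] := sup_adherent e2 hE.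
have [d d0 H] := wnear X sT e2.
exists (sup E), X, d; split => //.
- move=> x; apply: sup_upper_bound => //; by exists x.
- lra.
move=> t tT td; have := H t X tT td; rewrite subrr normr0 => /(_ d0).
by rewrite ltr_norml => /andP[h _]; lra.
Qed.

(** Near +oo the value at time tau is almost the supremum over x at that time, by
    monotonicity, and later values cannot exceed this supremum.  Compactness of
    [s0, T'] makes R0 uniform; the gap rh leaves room to replace tau by a nearby
    reference time. *)
Lemma tail_right (s0 T' rh k : R) : 0 <= s0 -> T' < T -> 0 < rh -> 0 < k ->
  exists R0, forall tau t x : R, s0 <= tau -> tau + rh <= t -> t <= T' -> R0 <= x ->
    w (t, x) - w (tau, x) < k.
Proof.
move=> s00 T'T rh0 k0.
pose P (R0 tau : R) := forall t x : R, s0 <= tau -> tau + rh <= t -> t <= T' -> R0 <= x ->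
    w (t, x) - w (tau, x) < k.
have cK := @segment_compact R s0 T'.
move/compact_near_coveringP : cK => /(_ R +oo P _) cov.
have H : forall x, `[s0, T']%classic x -> \forall x' \near x & i \near +oo, P i x'.
  move=> tau0 /=; rewrite in_itv/= => /andP[h1 h2].
  have tS : 0 <= tau0 < T by lra.
  have [S [X [d [d0 HS HX HX']]]] := sup_point tS k0.
  exists (ball tau0 (Num.min d rh), [set i | X < i]).
    split => /=; first by apply: nbhsx_ballx; rewrite lt_min d0.
    by exists X; split; [exact: num_real|].
  move=> [tau i] /= [b Xi] t x s0tau taut tT' ix.
  move: b; rewrite /ball/= distrC lt_min => /andP[b1 b2].
  have tauS : 0 <= tau < T by lra.
  have := HX' tau tauS b1.
  have := @wmono tau X x tauS; rewrite (le_trans (ltW Xi) ix) => /(_ isT).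
  have t0t : tau0 <= t by move: b2; rewrite ltr_norml => /andP[]; lra.
  have t00 : 0 <= tau0 by lra.
  have tT : t < T by lra.
  have := wdecr t00 t0t tT HS x; lra.
have [A [_ HA]] := cov H.
exists (A + 1) => tau t x h1 h2 h3 h4; apply: (HA (A + 1)) => //; first by rewrite ltrDl.
by rewrite /= in_itv/= h1; lra.
Qed.

Lemma right_uniform (s k : R) : 0 <= s < T -> 0 < k -> exists X d, 0 < d /\
  forall t x, s <= t < T -> t < s + d -> X <= x -> `|w (t, x) - w (s, x)| <= k.
Proof.
move=> sT k0; have [S [X [d [d0 HS HX HX']]]] := sup_point sT k0.
exists X, d; split => // t x /andP[st tT] td Xx.
have /andP[s0 sT'] := sT.
have tS : 0 <= t < T by lra.
have h1 := wdecr s0 st tT HS x.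
have h2 := HX' t tS; rewrite ger0_norm in h2; last lra.
have h3 := @wmono t X x tS Xx; have h4 := @wmono s X x sT Xx.
have h5 := HS x; have := h2 (ltac:(lra)).
by rewrite ler_norml; lra.
Qed.

End one.

Variable u : R * R -> R.
Hypothesis unear : near_prop u.
Hypothesis uM : forall p, strip T p -> `|u p| <= M.
Hypothesis umono : mono_x T u.
Hypothesis udecr : decr_prop u.
Hypothesis uincr : decr_prop (fun p => - u p).

(** Reflection in space and sign turns left tails into right tails and infima
    into suprema, while preserving monotonicity in x. *)
Definition mirror (p : R * R) := - u (p.1, - p.2).

Lemma mirror_near : near_prop mirror.
Proof.
move=> t1 x1 e t1T e0; have [d d0 H] := unear (- x1) t1T e0.
exists d => // t x tT td xd; rewrite /mirror/= opprK addrC distrC.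
by apply: H => //; rewrite -opprD normrN.
Qed.
Lemma mirror_M p : strip T p -> `|mirror p| <= M.
Proof. by move=> ?; rewrite normrN; exact: uM. Qed.
Lemma mirror_mono : mono_x T mirror.
Proof. by move=> t a b tT ab; rewrite /mirror lerN2; apply: umono => //; rewrite lerN2. Qed.
Lemma mirror_decr : decr_prop mirror.
Proof.
move=> s t K s0 st tT H x; apply: (uincr s0 st tT) => y.
by have := H (- y); rewrite /mirror/= opprK.
Qed.

Lemma tail_left (s0 T' rh k : R) : 0 <= s0 -> T' < T -> 0 < rh -> 0 < k ->
  exists R0, forall tau t x : R, s0 <= t -> t + rh <= tau -> tau <= T' -> x <= - R0 ->
    u (t, x) - u (tau, x) < k.
Proof.
move=> s00 T'T rh0 k0.
have [R0 H] := tail_right mirror_near mirror_M mirror_mono mirror_decr s00 T'T rh0 k0.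
exists R0 => tau t x h1 h2 h3 h4.
have := H t tau (- x) h1 h2 h3; rewrite /mirror/= opprK lerNr => /(_ h4); lra.
Qed.

(** On a compact interval this is continuity; near +oo and -oo it follows from
    the monotonicity in time of the supremum and the infimum. *)
Lemma uniform_right_time (s k : R) : 0 <= s < T -> 0 < k -> exists2 d, 0 < d &
  forall t x, s <= t < T -> t < s + d -> `|u (t, x) - u (s, x)| <= k.
Proof.
move=> sT k0.
have [X1 [d1 [d10 H1]]] := right_uniform unear uM umono udecr sT k0.
have [X2 [d2 [d20 H2]]] := right_uniform mirror_near mirror_M mirror_mono mirror_decr sT k0.
pose P (t x : R) := s <= t < T -> `|u (t, x) - u (s, x)| <= k.
have cK := @segment_compact R (- X2) X1.
move/compact_near_coveringP : cK => /(_ R (nbhs s) P _) cov.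
have H : forall x, `[- X2, X1]%classic x -> \forall x' \near x & i \near nbhs s, P i x'.
  move=> x _; have k2 : 0 < k / 2 by rewrite divr_gt0.
  have [d d0 H] := unear x sT k2.
  exists (ball x d, ball s d); first by split => /=; apply: nbhsx_ballx.
  move=> [x' t] /= []; rewrite /ball/= => b1 b2 /andP[st tT].
  have tS : 0 <= t < T by lra.
  have b0 : `|s - s| < d by rewrite subrr normr0.
  rewrite distrC in b1; rewrite distrC in b2.
  have := H t x' tS b2 b1; have := H s x' sT b0 b1.
  by rewrite !ltr_norml ler_norml => /andP[? ?] /andP[? ?]; lra.
have := cov H.
move=> /nbhs_ballP[d3 /= d30 H3].
exists (Num.min d1 (Num.min d2 d3)) => [|t x /andP[st tT]]; first by rewrite !lt_min d10 d20.
rewrite -ltrBlDl !lt_min => /and3P[td1 td2 td3].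
have sI : s <= t < T by rewrite st.
have [x1|x1] := leP X1 x; first by apply: H1 => //; lra.
have [x2|x2] := leP x (- X2).
  have := H2 t (- x) sI; rewrite /mirror/= opprK -ltrBlDl lerNr => /(_ td2 x2).
  by rewrite opprK addrC distrC.
apply: (H3 t) => //=; last by rewrite in_itv/=; lra.
by rewrite /ball/= distrC ger0_norm; lra.
Qed.

End absw.

(** * Comparison on a short time interval *)

Section aux.
Variable R : realType.

Lemma exists_max4 (F : (R * R) * (R * R) -> R) (a b X t1 x1 y1 : R) : continuous F ->
  a <= t1 <= b ->
  (forall t x tau y, a <= t <= b -> a <= tau <= b -> X < `|x| \/ X < `|y| ->
    F ((t, x), (tau, y)) <= F ((t1, x1), (t1, y1))) ->
  exists t0 x0 tau0 y0, [/\ a <= t0 <= b, a <= tau0 <= b &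
   forall t x tau y, a <= t <= b -> a <= tau <= b ->
    F ((t, x), (tau, y)) <= F ((t0, x0), (tau0, y0))].
Proof.
move=> Fc t1ab far; pose X' := Num.max X (Num.max `|x1| `|y1|).
pose J : set (R * R) := `[a, b] `*` `[- X', X'].
have cJ : compact J by apply: compact_setX; exact: segment_compact.
have K1 : (J `*` J) ((t1, x1), (t1, y1)).
  split; split => /=; rewrite in_itv//= -ler_norml /X' !le_max lexx ?orbT//.
have [|||[[t0 x0] [tau0 y0]] /set_mem[[K0a K0b] [K0c K0d]] mx'] := @compact_EVT_max _ _ F (J `*` J).
- by exists ((t1, x1), (t1, y1)).
- exact: compact_setX.
- exact: continuous_subspaceT.
exists t0, x0, tau0, y0; split; [by move: K0a; rewrite /= in_itv|by move: K0c; rewrite /= in_itv|].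
move=> t x tau y tab tauab.
have K0 := mx' _ (mem_set K1).
have XX : X <= X' by rewrite /X' le_max lexx.
have [xX|xX] := leP `|x| X'; last first.
  by apply: le_trans K0; apply: far => //; left; exact: le_lt_trans xX.
have [yX|yX] := leP `|y| X'; last first.
  by apply: le_trans K0; apply: far => //; right; exact: le_lt_trans yX.
by apply: mx'; apply/mem_set; split; split => /=; rewrite in_itv//= -ler_norml.
Qed.

(** On a compact set c is uniformly continuous and bounded below, hence c(x) and
    c(y) are close in relative terms. *)
Lemma c_ratio (c : R -> R) (Y w : R) : continuous c -> (forall x, 0 < c x) -> 0 < w ->
  exists2 eta, 0 < eta & forall x y, `|x| <= Y -> `|x - y| < eta -> `|c x - c y| <= w * c y.
Proof.
move=> cc cpos w0.
pose P (e x : R) := forall y, `|x - y| < e -> `|c x - c y| <= w * c y.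
have cK := @segment_compact R (- Y) Y.
move/compact_near_coveringP : cK => /(_ R (nbhs 0^'+) P _) cov.
have H : forall x, `[- Y, Y]%classic x -> \forall x' \near x & i \near nbhs 0^'+, P i x'.
  move=> x0 _; pose eps := w * c x0 / (2 + w).
  have w2 : 0 < 2 + w by lra.
  have eps0 : 0 < eps by rewrite divr_gt0// mulr_gt0.
  have epsE : eps * (2 + w) = w * c x0 by rewrite /eps divfK// gt_eqF.
  have /cvgrPdist_lt/(_ eps eps0)/nbhs_ballP[d /= d0 Hd] := cc x0.
  have d2 : 0 < d / 2 by rewrite divr_gt0.
  exists (ball x0 (d / 2), [set i | i < d / 2]).
    by split => /=; [exact: nbhsx_ballx|exact: nbhs_right_lt].
  move=> [x i] /= [bx id] y xy.
  have h1 : `|c x0 - c x| < eps.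
    by apply: Hd; apply: le_ball bx; lra.
  have h2 : `|c x0 - c y| < eps.
    apply: Hd; rewrite /ball/= in bx *.
    rewrite (_ : x0 - y = (x0 - x) + (x - y)); last by ring.
    by apply: (le_lt_trans (ler_normD _ _)); lra.
  move: h1 h2; rewrite !ltr_norml => /andP[h1 h2] /andP[h3 h4].
  have : w * (c x0 - eps) <= w * c y by rewrite ler_wpM2l ?(ltW w0)//; lra.
  by rewrite ler_norml; lra.
have {}cov := cov H.
near (0:R)^'+ => e; exists e; first by near: e; exact: nbhs_right_gt.
move=> x y xY xy; have He : `[- Y, Y] `<=` P e by near: e.
by apply: He => //; rewrite /= in_itv/= -ler_norml.
Unshelve. all: by end_near. Qed.

(** Flat on [-rh, rh]: a nonzero derivative at t - tau certifies that the two
    times are rh apart. *)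
Definition time_pen (Th rh r : R) : R := Th * (hub (r - rh) + hub (- rh - r)).
Definition dtime_pen (Th rh r : R) : R := Th * (clamp01 (r - rh) + - clamp01 (- rh - r)).

Lemma C11_time_pen Th rh : C11 (time_pen Th rh) (dtime_pen Th rh).
Proof. exact: (C11Z Th (C11D (C11_shift rh (@C11_hub R)) (C11_refl (- rh) (@C11_hub R)))). Qed.

Lemma time_pen_ge0 Th rh r : 0 <= Th -> 0 <= time_pen Th rh r.
Proof. by move=> h; rewrite mulr_ge0// addr_ge0 ?hub_ge0. Qed.

Lemma time_pen_eq0 Th rh : 0 <= rh -> time_pen Th rh 0 = 0.
Proof. by move=> h; rewrite /time_pen !hub_eq0 ?addr0 ?mulr0//; lra. Qed.

Lemma dtime_pen_bnd Th rh r : 0 <= Th -> `|dtime_pen Th rh r| <= Th.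
Proof.
move=> h; rewrite normrM ger0_norm// ler_piMr// ler_norml.
have := clamp01_ge0 (r - rh); have := clamp01_le1 (r - rh).
by have := clamp01_ge0 (- rh - r); have := clamp01_le1 (- rh - r); lra.
Qed.

Lemma dtime_pen_pos Th rh r : 0 <= Th -> 0 < dtime_pen Th rh r -> rh < r.
Proof.
move=> h; apply: contraTT; rewrite -!leNgt => rr.
rewrite mulr_ge0_le0// clamp01_eq0 ?add0r ?oppr_le0 ?clamp01_ge0//; lra.
Qed.

Lemma dtime_pen_neg Th rh r : 0 <= Th -> dtime_pen Th rh r < 0 -> r < - rh.
Proof.
move=> h; apply: contraTT; rewrite -!leNgt => rr.
rewrite mulr_ge0// (@clamp01_eq0 _ (- rh - r)) ?subr0 ?clamp01_ge0//; lra.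
Qed.

Lemma time_pen_lt Th rh r K : 0 < Th -> 0 < rh <= 1 -> time_pen Th rh r <= K -> K < Th * (rh ^+ 2 / 2) ->
  `|r| < 2 * rh.
Proof.
move=> Th0 /andP[rh0 rh1] h1 h2; have := le_lt_trans h1 h2; rewrite /time_pen ltr_pM2l// => h.
have hE : hub rh = rh ^+ 2 / 2 by apply: hub_quad; rewrite ltW.
have A s : hub s < hub rh -> s < rh.
  by apply: contraTT; rewrite -!leNgt; exact: hub_nd.
have a1 : r - rh < rh by apply: A; have := hub_ge0 (- rh - r); lra.
have a2 : - rh - r < rh by apply: A; have := hub_ge0 (r - rh); lra.
by rewrite ltr_norml; lra.
Qed.

(** With P1 = p1 c(x) and P2 = p2 c(y), every error term is a multiple of P2, and
    their sum is at most (2 L C0 + 3/4) E0 P2 < gam (P1 + P2).  The degenerate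
    case P1 = P2 = 0 is excluded by the two inequalities without nonlocal
    terms. *)
Lemma slope_balance (L C0 C1 M E0 gam a c1 N0 w Th eta pt p1 p2 cx cy bu bv apsi N : R) :
  0 <= L -> 0 <= C0 -> 0 <= C1 -> 0 <= M -> 0 < E0 -> gam = (2 * L * C0 + 1) * E0 ->
  0 < cx -> 0 < cy -> 0 <= a -> 0 <= c1 -> 0 <= Th -> 0 <= eta ->
  0 <= p1 <= L -> 0 <= p2 <= L -> p1 = p2 + apsi ->
  (p1 = 0 -> gam + pt <= 0) -> (p2 = 0 -> gam - pt <= 0) ->
  N = 0 \/ (N = N0 /\ cx <= c1) -> 0 <= N0 ->
  a * (L * c1 * N0) <= E0 / 4 -> w * (L * C0 * M + Th) <= E0 / 4 -> eta * (L * C1 * M) <= E0 / 4 ->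
  0 <= w -> `|cx - cy| <= w * cy -> `|pt| <= Th -> pt * apsi <= 0 ->
  `|bv| <= C0 * M -> `|bu - bv| <= C0 * (2 * E0) + C1 * M * eta ->
  gam * (p1 * cx + p2 * cy) + pt * (p2 * cy - p1 * cx) + p1 * p2 * (cy * bu - cx * bv) <=
    p1 * cx * (p2 * cy) * (a * N) -> False.
Proof.
move=> L0 C00 C10 M0 E00 gE cx0 cy0 a0 c10 Th0 eta0 /andP[p10 p1L] /andP[p20 p2L] p12 z1 z2 HN N00
  ha hw heta w0 hc hpt hapsi hbv hb H.
have gam0 : 0 < gam by rewrite gE mulr_gt0// ltr_wpDl// !mulr_ge0.
pose P1 := p1 * cx; pose P2 := p2 * cy.
have P10 : 0 <= P1 by rewrite mulr_ge0// ltW.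
have P20 : 0 <= P2 by rewrite mulr_ge0// ltW.
have S0 : 0 < P1 + P2.
  rewrite lt_neqAle addr_ge0// andbT eq_sym paddr_eq0// !mulf_eq0 !(gt_eqF cx0) !(gt_eqF cy0) !orbF.
  by apply/negP => /andP[/eqP/z1 ? /eqP/z2]; lra.
have t1 : P1 * P2 * (a * N) <= P2 * (E0 / 4).
  case: HN => [->|[-> cxc]]; first by rewrite !mulr0 mulr_ge0//; lra.
  rewrite (mulrC P1) -mulrA ler_wpM2l//; apply: le_trans ha.
  rewrite mulrCA ler_wpM2l// ler_wpM2r//.
  by apply: ler_pM => //; exact: ltW.
have t2 : - (P2 * (Th * w)) - pt * apsi * cx <= pt * (P2 - P1).
  have -> : pt * (P2 - P1) = - (pt * apsi * cx) - p2 * (pt * (cx - cy)) by rewrite /P1 /P2 p12; ring.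
  rewrite addrC lerD2l lerN2.
  apply: le_trans (_ : p2 * (Th * (w * cy)) <= _); last by rewrite /P2; lra.
  rewrite ler_wpM2l//; apply: (le_trans (ler_norm _)); rewrite normrM.
  exact: ler_pM.
have t2' : 0 <= - (pt * apsi * cx) by rewrite oppr_ge0 mulr_le0_ge0// ltW.
have t3 : - (P2 * (L * (C0 * (2 * E0) + C1 * M * eta))) - P2 * (L * (w * (C0 * M))) <=
    p1 * p2 * (cy * bu - cx * bv).
  have -> : p1 * p2 * (cy * bu - cx * bv) = - (P2 * (p1 * (bv - bu))) - p2 * (p1 * ((cx - cy) * bv)).
    by rewrite /P2; ring.
  apply: lerB.
    rewrite lerN2 ler_wpM2l//; apply: le_trans (ler_norm _) _; rewrite normrM distrC.
    by apply: ler_pM => //; rewrite ger0_norm.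
  rewrite (_ : P2 * _ = p2 * (L * (w * cy * (C0 * M)))); last by rewrite /P2; ring.
  rewrite ler_wpM2l//; apply: le_trans (ler_norm _) _; rewrite normrM.
  apply: ler_pM => //; first by rewrite ger0_norm.
  by rewrite normrM; apply: ler_pM.
have t4 : P2 * (eta * (L * C1 * M)) <= P2 * (E0 / 4) by rewrite ler_wpM2l.
have t5 : P2 * (w * (L * C0 * M + Th)) <= P2 * (E0 / 4) by rewrite ler_wpM2l.
have t6 : gam * (P1 + P2) <= (gam - E0 / 4) * P2.
  have {}H : gam * (P1 + P2) + pt * (P2 - P1) + p1 * p2 * (cy * bu - cx * bv) <= P1 * P2 * (a * N) := H.
  rewrite [in leRHS]gE; move: H t1 t2 t2' t3 t4 t5.
  set A := gam * _; set A2 := pt * (_ - _); set A3 := p1 * p2 * _; set A4 := P1 * P2 * _; set A5 := pt * apsi * cx.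
  by move: (A) (A2) (A3) (A4) (A5) (P2) => *; clear P10 P20 S0; lra.
have : (gam - E0 / 4) * P2 <= (gam - E0 / 4) * (P1 + P2).
  by rewrite ler_wpM2l ?lerDr// gE; have : 0 <= L * C0 * E0; [rewrite !mulr_ge0// ltW|lra].
have : 0 < E0 / 4 * (P1 + P2) by rewrite mulr_gt0//; lra.
lra.
Qed.

End aux.

Section doubled_contact.
Variable R : realType.
Local Notation mu := (@lebesgue_measure R).
Variables (c : R -> R) (beta : R * R -> R) (T M L C0 : R).
Hypothesis cpos : forall x, 0 < c x.
Hypothesis M0 : 0 <= M.

Definition lip_x (u : R * R -> R) := forall t a b : R, 0 <= t < T -> a <= b -> u (t, b) - u (t, a) <= L * (b - a).

Variables u v : R * R -> R.
Hypothesis ucont : {within strip T, continuous u}.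
Hypothesis uM : forall p, strip T p -> `|u p| <= M.
Hypothesis umono : mono_x T u.
Hypothesis ulip : lip_x u.
Hypothesis usub : viscosity_subsolution c beta T (usc_env (strip T) u).
Hypothesis vcont : {within strip T, continuous v}.
Hypothesis vM : forall p, strip T p -> `|v p| <= M.
Hypothesis vmono : mono_x T v.
Hypothesis vlip : lip_x v.
Hypothesis vsup : viscosity_supersolution c beta T (lsc_env (strip T) v).

(** The inequality for u, multiplied by P2, plus the one for v, multiplied by P1:
    the two nonlocal terms get the common factor P1 P2, and since x - y does not
    change when both points are moved by z, the difference of their second
    differences dominates that of a psi. *)
Lemma doubled_contact (s0 s1 gam a t0 tau0 x0 y0 Rf R1 N0 C : R) (th th' q q' psi psi' : R -> R) :
  0 <= s0 -> s1 < T -> s0 < t0 <= s1 -> s0 < tau0 <= s1 ->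
  C11 th th' -> C11 q q' -> (forall z, 0 <= q z) -> penalty Rf psi psi' R1 N0 C -> 0 <= a ->
  (forall t tau x y, s0 <= t <= s1 -> s0 <= tau <= s1 ->
    u (t, x) - v (tau, y) - gam * (t + tau) - th (t - tau) - q (x - y) - a * psi x <=
    u (t0, x0) - v (tau0, y0) - gam * (t0 + tau0) - th (t0 - tau0) - q (x0 - y0) - a * psi x0) ->
  let pt := th' (t0 - tau0) in
  let p1 := q' (x0 - y0) + a * psi' x0 in let p2 := q' (x0 - y0) in
  let P1 := p1 * c x0 in let P2 := p2 * c y0 in
  let bu := B beta x0 (fun y => u (t0, y)) in let bv := B beta y0 (fun y => v (tau0, y)) in
  [/\ 0 <= p1 <= L, 0 <= p2 <= L,
    p1 = 0 -> gam + pt <= 0, p2 = 0 -> gam - pt <= 0 &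
    gam * (P1 + P2) + pt * (P2 - P1) + p1 * p2 * (c y0 * bu - c x0 * bv) <=
    P1 * P2 * (a * (if `|x0| < R1 then N0 else 0))].
Proof.
move=> s00 s1T /andP[s0t0 t0s1] /andP[s0tau0 tau0s1] thC qC q0 pen a0 mx pt p1 p2 P1 P2 bu bv.
have [psiC psi0 _ _ [C10 N00 _]] := pen.
have t0I : s0 <= t0 <= s1 by rewrite ltW.
have tau0I : s0 <= tau0 <= s1 by rewrite ltW.
have t0S : 0 <= t0 < T by lra.
have tau0S : 0 <= tau0 < T by lra.
have hC := C11D (C11_shift y0 qC) (C11Z a psiC).
have gC := C11D (C11_lin gam 0) (C11_shift tau0 thC).
have h2C := C11_refl x0 qC.
have g2C := C11D (C11_lin gam 0) (C11_refl t0 thC).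
have hB (x : R) : - (0 : R) <= q (x - y0) + a * psi x.
  by rewrite oppr0 addr_ge0// mulr_ge0//; have [] := psi0 x.
have h2B (y : R) : - (0 : R) <= q (x0 - y) by rewrite oppr0.
have uct t x : s0 <= t <= s1 -> u (t, x) - (gam * t + 0 + th (t - tau0)) - (q (x - y0) + a * psi x) <=
   u (t0, x0) - (gam * t0 + 0 + th (t0 - tau0)) - (q (x0 - y0) + a * psi x0).
  by move=> tI; have := mx t tau0 x y0 tI tau0I; lra.
have vct tau y : s0 <= tau <= s1 -> v (tau0, y0) + (gam * tau0 + 0 + th (t0 - tau0)) + q (x0 - y0) <=
   v (tau, y) + (gam * tau + 0 + th (t0 - tau)) + q (x0 - y).
  by move=> tI; have := mx t0 tau x0 y t0I tI; lra.
have [D1 D10 HD1] := sub_ineq ucont uM usub s00 s0t0 t0s1 s1T gC hC hB uct.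
have [D2 D20 HD2] := super_ineq vcont vM vsup s00 s0tau0 tau0s1 s1T g2C h2C h2B vct.
rewrite /cst -/pt -/p2 -/p1 -/bu -/bv in HD1 HD2.
have p1I : 0 <= p1 <= L.
  apply/andP; split.
    apply: (C11_slope_ge hC) => e e0; rewrite mul0r.
    by have := uct t0 (x0 + e) t0I; have := @umono t0 x0 (x0 + e) t0S; rewrite lerDl (ltW e0) => /(_ isT); lra.
  apply: (C11_slope_le hC) => e e0.
  have := uct t0 (x0 - e) t0I; have := @ulip t0 (x0 - e) x0 t0S; rewrite gerBl (ltW e0) => /(_ isT).
  by rewrite (_ : x0 - (x0 - e) = e); [lra|ring].
have p2I : 0 <= p2 <= L.
  suff [] : - L <= - p2 /\ - p2 <= 0 by lra.
  split.
    apply: (C11_slope_ge h2C) => e e0.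
    have := vct tau0 (y0 + e) tau0I; have := @vlip tau0 y0 (y0 + e) tau0S; rewrite lerDl (ltW e0) => /(_ isT).
    by rewrite (_ : y0 + e - y0 = e); [lra|ring].
  apply: (C11_slope_le h2C) => e e0; rewrite mul0r.
  by have := vct tau0 (y0 - e) tau0I; have := @vmono tau0 (y0 - e) y0 tau0S; rewrite gerBl (ltW e0) => /(_ isT); lra.
have /andP[p10 _] := p1I; have /andP[p20 _] := p2I.
have P10 : 0 <= P1 by rewrite mulr_ge0// ltW.
have P20 : 0 <= P2 by rewrite mulr_ge0// ltW.
split => //.
- move=> p1z; apply: (@ler_of_small_errors R _ 0 D1 0 0) => // [|d Z /andP[d0 _] _ _]; first exact: ltW.
  by have := HD1 d d0; rewrite p1z mul0r; lra.
- move=> p2z; apply: (@ler_of_small_errors R _ 0 D2 0 0) => // [|d Z /andP[d0 _] _ _]; first exact: ltW.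
  by have := HD2 d d0; rewrite p2z oppr0 mul0r; lra.
set N := if _ then _ else _.
have P12 : 0 <= P1 * P2 by exact: mulr_ge0.
apply: (@ler_of_small_errors R _ _ (P2 * D1 + P1 * D2 + P1 * P2 * (a * C)) (P1 * P2 * (8 * M)) (2 * `|x0| + 2)).
- apply: addr_ge0; last by apply: mulr_ge0 => //; exact: mulr_ge0.
  by apply: addr_ge0; apply: mulr_ge0 => //; exact: ltW.
- by apply: mulr_ge0 => //; rewrite mulr_ge0.
move=> d Z d01 ZZ Z0; have n0 := normr_ge0 x0; have /andP[d0 d1] := d01.
have Z1 : 1 < Z by lra.
have xZ : 2 * `|x0| <= Z by lra.
have mu0 := slice_meas ucont t0S; have mv0 := slice_meas vcont tau0S.
have ub y : `|u (t0, y)| <= M by exact: uM.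
have vb y : `|v (tau0, y)| <= M by exact: vM.
have sd4 (f : R -> R) x z : (forall y, `|f y| <= M) -> `|sd f x z| <= 4 * M.
  move=> fb; rewrite /sd; have := fb x; have := fb (x + z); have := fb (x - z).
  by rewrite !ler_norml => /andP[? ?] /andP[? ?] /andP[? ?]; lra.
have iu := integrable_ker d0 (measurable_sd x0 mu0) (fun z => sd4 _ x0 z ub).
have iv := integrable_ker d0 (measurable_sd y0 mv0) (fun z => sd4 _ y0 z vb).
have := HD1 d d0; rewrite (A_outE x0 d0 mu0 ub).
have := HD2 d d0; rewrite (A_outE y0 d0 mv0 vb).
set Au := Rintegral _ _ _; set Av := Rintegral _ _ _ => h2 h1.
have mk : measurable_fun setT (fun z => sd (fun y => u (t0, y)) x0 z - sd (fun y => v (tau0, y)) y0 z).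
  by apply: measurable_funB; exact: measurable_sd.
have kb z : `|sd (fun y => u (t0, y)) x0 z - sd (fun y => v (tau0, y)) y0 z| <= 8 * M.
  apply: (le_trans (ler_normB _ _)); have := sd4 _ x0 z ub; have := sd4 _ y0 z vb; lra.
have kpsi z : a * sd psi x0 z <= sd (fun y => u (t0, y)) x0 z - sd (fun y => v (tau0, y)) y0 z.
  have e1 w : x0 + w - (y0 + w) = x0 - y0 by ring.
  have := mx t0 tau0 (x0 + z) (y0 + z) t0I tau0I; have := mx t0 tau0 (x0 - z) (y0 - z) t0I tau0I.
  by rewrite !e1 /sd; lra.
have := penalty_int pen a0 mk kb kpsi d01 Z1 xZ.
under eq_Rintegral do rewrite mulrBl.
rewrite (@RintegralB _ _ _ mu _ _ _ (measurable_itv _) iu iv) -/Au -/Av -/N => h3.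
have k1 := ler_wpM2l P20 h1.
have k2 := ler_wpM2l P10 h2.
have k3 := ler_wpM2l P12 h3.
move: k1 k2 k3; rewrite /P1 /P2; set Zi := Z^-1; move: (Au) (Av) (bu) (bv) (N) => A1 A2 b1 b2 n.
clear; lra.
Qed.

Definition tail_r (w : R * R -> R) := forall s0 T' rh k : R, 0 <= s0 -> T' < T -> 0 < rh -> 0 < k ->
  exists R0, forall tau t x : R, s0 <= tau -> tau + rh <= t -> t <= T' -> R0 <= x ->
    w (t, x) - w (tau, x) < k.
Definition tail_l (w : R * R -> R) := forall s0 T' rh k : R, 0 <= s0 -> T' < T -> 0 < rh -> 0 < k ->
  exists R0, forall tau t x : R, s0 <= t -> t + rh <= tau -> tau <= T' -> x <= - R0 ->
    w (t, x) - w (tau, x) < k.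
Definition runif (w : R * R -> R) := forall s k : R, 0 <= s < T -> 0 < k -> exists2 d, 0 < d &
  forall t x, s <= t < T -> t < s + d -> `|w (t, x) - w (s, x)| <= k.

End doubled_contact.

(** The parameters are chosen in this order: the time scale rh (right continuity
    at s0, so that the maximum is not attained at the initial time), the
    strength Th of the time penalty, the radius Rf from the tail estimates, the
    penalty psi, its weight a, the relative accuracy w of c on the region where
    a psi <= 2 M, and the distance eta of x and y. *)
Lemma local_comp (R : realType) (c : R -> R) (beta : R * R -> R) (T M L C0 C1 : R)
    (u v : R * R -> R) (s0 s1 E0 : R) :
  (forall x, 0 < c x) -> continuous c -> continuous beta ->
  0 <= M -> 0 <= L -> 0 <= C0 -> 0 <= C1 ->
  (forall x, (\int[@lebesgue_measure R]_y `|beta (x, y)|%:E <= C0%:E)%E) ->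
  (forall x x', x < x' ->
    (\int[@lebesgue_measure R]_y `|beta (x', y) - beta (x, y)|%:E <= (C1 * (x' - x))%:E)%E) ->
  {within strip T, continuous u} -> (forall p, strip T p -> `|u p| <= M) ->
  mono_x T u -> lip_x T L u -> tail_r T u -> runif T u ->
  viscosity_subsolution c beta T (usc_env (strip T) u) ->
  {within strip T, continuous v} -> (forall p, strip T p -> `|v p| <= M) ->
  mono_x T v -> lip_x T L v -> tail_l T v -> runif T v ->
  viscosity_supersolution c beta T (lsc_env (strip T) v) ->
  0 <= s0 -> s1 < T -> 0 < E0 ->
  (forall x, u (s0, x) - v (s0, x) <= E0) ->
  (forall t tau x, s0 <= t <= s1 -> s0 <= tau <= s1 -> `|u (t, x) - v (tau, x)| <= 2 * E0) ->
  forall t x, s0 <= t <= s1 -> u (t, x) - v (t, x) <= E0 + 2 * ((2 * L * C0 + 1) * E0) * (t - s0).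
Proof.
move=> cpos ccont cb M0 L0 C00 C10 H0 H1 ucont uM umono ulip utail urun usub
  vcont vM vmono vlip vtail vrun vsup s00 s1T E00 ini near2 t1 x1 t1I.
set gam := (2 * L * C0 + 1) * E0.
have gam0 : 0 < gam by rewrite mulr_gt0// ltr_wpDl// !mulr_ge0.
rewrite leNgt; apply/negP => gt.
pose m := u (t1, x1) - v (t1, x1) - E0 - 2 * gam * (t1 - s0).
have m0 : 0 < m by rewrite /m; lra.
have mE : u (t1, x1) - v (t1, x1) = E0 + m + 2 * gam * (t1 - s0) by rewrite /m; ring.
have /andP[st1 ts1] := t1I.
have s0S : 0 <= s0 < T by lra.
have inS t : s0 <= t <= s1 -> 0 <= t < T by move=> /andP[h1 h2]; lra.
have m4 : 0 < m / 4 by rewrite divr_gt0.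
have [du du0 Hdu] := urun s0 _ s0S m4.
have [dv dv0 Hdv] := vrun s0 _ s0S m4.
pose rh := Num.min 1 (Num.min (du / 2) (dv / 2)).
have rh0 : 0 < rh by rewrite !lt_min ltr01 !divr_gt0.
have [rh1 rhu rhv] : [/\ rh <= 1, rh <= du / 2 & rh <= dv / 2].
  by split; rewrite !ge_min lexx ?orbT.
pose K1 := 2 * M + 1; have K10 : 0 < K1 by rewrite /K1; lra.
pose Th := 2 * K1 / rh ^+ 2.
have Th0 : 0 < Th by rewrite divr_gt0 ?exprn_gt0// mulr_gt0.
have ThE : Th * (rh ^+ 2 / 2) = K1.
  by rewrite /Th; field; rewrite gt_eqF.
have grh : 0 < gam * rh by rewrite mulr_gt0.
have [Ru HRu] := utail s0 s1 _ _ s00 s1T rh0 grh.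
have [Rv HRv] := vtail s0 s1 _ _ s00 s1T rh0 grh.
pose Rf := `|Ru| + `|Rv| + `|x1| + 2.
have [nu nv nx] : [/\ 0 <= `|Ru|, 0 <= `|Rv| & 0 <= `|x1|] by split; exact: normr_ge0.
have Rf1 : 1 <= Rf by rewrite /Rf; lra.
have [psi [psi' [R1 [N0 [C pen]]]]] := exists_penalty Rf1.
have [psiC psi0 psiR coer [_ N00 _]] := pen.
have [c1 c10 Hc1] := cont_bounded R1 ccont.
have q1 : 0 < L * c1 * N0 + 1 by rewrite ltr_wpDl// !mulr_ge0// ltW.
have E4 : 0 < E0 / 4 by rewrite divr_gt0.
pose a := E0 / 4 / (L * c1 * N0 + 1).
have a0 : 0 < a by rewrite divr_gt0.
have ha : a * (L * c1 * N0) <= E0 / 4.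
  have : a * (L * c1 * N0 + 1) = E0 / 4 by rewrite /a divfK// gt_eqF.
  by move: a0; clear; lra.
have [Y HY] := coer (K1 / a).
have {}HY x : Y <= `|x| -> K1 <= a * psi x by move=> /HY; rewrite ler_pdivrMr// mulrC.
have q2 : 0 < L * C0 * M + Th + 1.
  by rewrite ltr_wpDl// addr_ge0 ?(ltW Th0)// !mulr_ge0.
pose w := E0 / 4 / (L * C0 * M + Th + 1).
have w0 : 0 < w by rewrite divr_gt0.
have hw : w * (L * C0 * M + Th) <= E0 / 4.
  have : w * (L * C0 * M + Th + 1) = E0 / 4 by rewrite /w divfK// gt_eqF.
  by move: w0; clear; lra.
have [eta1 eta10 Heta1] := c_ratio `|Y| ccont cpos w0.
have q3 : 0 < L * C1 * M + 1 by rewrite ltr_wpDl// !mulr_ge0.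
have q4 : 0 < L + 1 by rewrite ltr_wpDl.
pose eta := Num.min (Num.min 1 eta1) (Num.min (E0 / 4 / (L * C1 * M + 1)) (m / 4 / (L + 1))).
have eta0 : 0 < eta by rewrite !lt_min ltr01 eta10 !divr_gt0.
have [etaA etaB etaC etaD] : [/\ eta <= 1, eta <= eta1, eta <= E0 / 4 / (L * C1 * M + 1) & eta <= m / 4 / (L + 1)].
  by split; rewrite !ge_min lexx ?orbT.
have heta : eta * (L * C1 * M) <= E0 / 4.
  by move: etaC eta0; rewrite ler_pdivlMr//; clear; lra.
have hetaL : L * eta <= m / 4.
  by move: etaD eta0; rewrite ler_pdivlMr//; clear; lra.
pose e := eta ^+ 2 / 2 / K1.
have e0 : 0 < e by rewrite !divr_gt0 ?exprn_gt0.
have eE : e * K1 = eta ^+ 2 / 2 by rewrite /e divfK// gt_eqF.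
pose q (z : R) := e^-1 * ehub z.
have qC : C11 q (fun z => e^-1 * dehub z) := C11Z e^-1 (@C11_ehub R).
have q0 z : 0 <= q z by rewrite mulr_ge0 ?ehub_ge0// invr_ge0 ltW.
have qlt z : q z < K1 -> `|z| < eta.
  rewrite /q mulrC ltr_pdivrMr// (mulrC K1) eE => h.
  by apply: ehub_lt h; rewrite eta0.
have psi_ge x : 0 <= a * psi x by rewrite mulr_ge0 ?(ltW a0)//; have [] := psi0 x.
have uvb t x tau y : s0 <= t <= s1 -> s0 <= tau <= s1 -> u (t, x) - v (tau, y) <= 2 * M.
  move=> /inS tS /inS tauS; have := uM (t, x) tS; have := vM (tau, y) tauS.
  by rewrite !ler_norml => /andP[h1 _] /andP[_ h2]; move: h1 h2; clear; lra.
pose F (p : (R * R) * (R * R)) : R := uext u s0 s1 p.1 - uext v s0 s1 p.2 - gam * (p.1.1 + p.2.1) -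
   time_pen Th rh (p.1.1 - p.2.1) - q (p.1.2 - p.2.2) - a * psi p.1.2.
have s01 : s0 <= s1 by move: st1 ts1; exact: le_trans.
have cont_lin (f : R -> R) (l : (R * R) * (R * R) -> R) : continuous f -> continuous l -> continuous (fun p => f (l p)).
  by move=> cf cl p; apply: (@continuous_comp _ _ _ l f); [exact: cl|exact: cf].
have cp1 : continuous (fun p : (R * R) * (R * R) => p.1) by move=> p; exact: cvg_fst.
have cp2 : continuous (fun p : (R * R) * (R * R) => p.2) by move=> p; exact: cvg_snd.
have cp11 : continuous (fun p : (R * R) * (R * R) => p.1.1).
  by move=> p; apply: (@continuous_comp _ _ _ fst (fst : R * R -> R)); [exact: cp1|exact: cvg_fst].
have cp12 : continuous (fun p : (R * R) * (R * R) => p.1.2).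
  by move=> p; apply: (@continuous_comp _ _ _ fst (snd : R * R -> R)); [exact: cp1|exact: cvg_snd].
have cp21 : continuous (fun p : (R * R) * (R * R) => p.2.1).
  by move=> p; apply: (@continuous_comp _ _ _ snd (fst : R * R -> R)); [exact: cp2|exact: cvg_fst].
have cp22 : continuous (fun p : (R * R) * (R * R) => p.2.2).
  by move=> p; apply: (@continuous_comp _ _ _ snd (snd : R * R -> R)); [exact: cp2|exact: cvg_snd].
have Fc : continuous F.
  move=> p; apply: cvgB; last first.
    by apply: cvgM; [exact: cvg_cst|apply: (cont_lin psi); [exact: C11_cont psiC|exact: cp12]].
  apply: cvgB; last first.
    by apply: (cont_lin q (fun p => p.1.2 - p.2.2)); [exact: C11_cont qC|move=> r; apply: cvgB; [exact: cp12|exact: cp22]].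
  apply: cvgB; last first.
    by apply: (cont_lin (time_pen Th rh) (fun p => p.1.1 - p.2.1)); [exact: C11_cont (C11_time_pen Th rh)|move=> r; apply: cvgB; [exact: cp11|exact: cp21]].
  apply: cvgB; last first.
    by apply: cvgM; [exact: cvg_cst|apply: cvgD; [exact: cp11|exact: cp21]].
  apply: cvgB.
    by apply: (@continuous_comp _ _ _ fst (uext u s0 s1)); [exact: cp1|exact: (uext_cont ucont s00 s01 s1T)].
  by apply: (@continuous_comp _ _ _ snd (uext v s0 s1)); [exact: cp2|exact: (uext_cont vcont s00 s01 s1T)].
have FE t x tau y : s0 <= t <= s1 -> s0 <= tau <= s1 -> F ((t, x), (tau, y)) =
   u (t, x) - v (tau, y) - gam * (t + tau) - time_pen Th rh (t - tau) - q (x - y) - a * psi x.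
  by move=> tI tauI; rewrite /F /uext /= !clampt_id.
have F1 : F ((t1, x1), (t1, x1)) = E0 + m - 2 * gam * s0.
  rewrite FE// mE !subrr time_pen_eq0 ?(ltW rh0)// /q ehub0 mulr0.
  have [|-> _] := psiR x1; first by rewrite /Rf; move: nu nv; clear; lra.
  by ring.
have th0 r : 0 <= time_pen Th rh r := time_pen_ge0 rh r (ltW Th0).
have gt2 t tau : s0 <= t <= s1 -> s0 <= tau <= s1 -> 2 * gam * s0 <= gam * (t + tau).
  move=> /andP[h1 _] /andP[h2 _]; rewrite -mulrA mulrCA ler_wpM2l ?(ltW gam0)//.
  by move: h1 h2; clear; lra.
have far t x tau y : s0 <= t <= s1 -> s0 <= tau <= s1 -> `|Y| + 1 < `|x| \/ `|Y| + 1 < `|y| ->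
    F ((t, x), (tau, y)) <= F ((t1, x1), (t1, x1)).
  move=> tI tauI xy; rewrite F1 FE//.
  have g1 := gt2 _ _ tI tauI; have u1 := uvb t x tau y tI tauI.
  have g2 := th0 (t - tau); have g3 := q0 (x - y); have g4 := psi_ge x.
  suff : K1 <= q (x - y) + a * psi x.
    by rewrite /K1; move: g1 g2 g3 g4 u1 E00 m0; clear; lra.
  have YY := ler_norm Y.
  have [xY|xY] := leP `|Y| `|x|; first by have := HY x (le_trans YY xY); move: g3; clear; lra.
  have [qx|/qlt] := leP K1 (q (x - y)); first by move: qx g4; clear; lra.
  case: xy => [h|yY xye]; first by move: h xY; clear; lra.
  have := ler_normD x (- (x - y)); rewrite normrN (_ : x + - (x - y) = y); last by ring.
  by move: xY yY xye etaA; clear; lra.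
have [t0 [x0 [tau0 [y0 [t0I tau0I mx]]]]] := exists_max4 Fc t1I far.
have mx' t tau x y : s0 <= t <= s1 -> s0 <= tau <= s1 ->
    u (t, x) - v (tau, y) - gam * (t + tau) - time_pen Th rh (t - tau) - q (x - y) - a * psi x <=
    u (t0, x0) - v (tau0, y0) - gam * (t0 + tau0) - time_pen Th rh (t0 - tau0) - q (x0 - y0) - a * psi x0.
  by move=> tI tauI; have := mx t x tau y tI tauI; rewrite !FE.
have val : E0 + m - 2 * gam * s0 <= u (t0, x0) - v (tau0, y0) - gam * (t0 + tau0) -
    time_pen Th rh (t0 - tau0) - q (x0 - y0) - a * psi x0.
  by rewrite -F1 -FE//; exact: mx.
have uv0 := uvb t0 x0 tau0 y0 t0I tau0I.
have [g1 g2 g3 g4] : [/\ 2 * gam * s0 <= gam * (t0 + tau0), 0 <= time_pen Th rh (t0 - tau0), 0 <= q (x0 - y0) & 0 <= a * psi x0].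
  by split=> //; exact: gt2.
have tt : `|t0 - tau0| < 2 * rh.
  apply: (@time_pen_lt R Th rh _ (2 * M)) => //.
  - by rewrite rh0.
  - by move: val uv0 g1 g3 g4 m0 E00; clear; lra.
  - by rewrite ThE ltrDl.
have xy : `|x0 - y0| < eta.
  by apply: qlt; rewrite /K1; move: val uv0 g1 g2 g4 m0 E00; clear; lra.
have xY : `|x0| <= `|Y|.
  rewrite leNgt; apply/negP => h; have := HY x0 (le_trans (ler_norm Y) (ltW h)).
  by rewrite /K1; move: val uv0 g1 g2 g3 m0 E00; clear; lra.
have vlp : v (s0, x0) - v (s0, y0) <= m / 4.
  have [h|/ltW h] := leP x0 y0.
    by have := vmono s0 _ _ s0S h; move: m4; clear; lra.
  apply: le_trans (vlip s0 _ _ s0S h) _; apply: le_trans hetaL.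
  by rewrite ler_wpM2l//; apply: le_trans (ler_norm _) (ltW xy).
have in0 := ini x0.
have /andP[t0a t0b] := t0I; have /andP[tau0a tau0b] := tau0I.
have t0gt : s0 < t0.
  rewrite lt_neqAle t0a andbT; apply/eqP => h.
  have := Hdv tau0 y0; rewrite ler_norml tau0a; have /andP[_ ->] := inS _ tau0I; move=> /(_ isT) k1.
  have : tau0 < s0 + dv by move: tt rhv; rewrite -h ltr_norml => /andP[]; clear; lra.
  move=> /k1 /andP[k2 _]; move: val in0 vlp m0 k2; rewrite -h in g1 g2 *.
  by move: g1 g2 g3 g4; clear; lra.
have tau0gt : s0 < tau0.
  rewrite lt_neqAle tau0a andbT; apply/eqP => h.
  have := Hdu t0 x0; rewrite ler_norml t0a; have /andP[_ ->] := inS _ t0I; move=> /(_ isT) k1.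
  have : t0 < s0 + du by move: tt rhu; rewrite -h ltr_norml => /andP[]; clear; lra.
  move=> /k1 /andP[_ k2]; move: val in0 vlp m0 k2; rewrite -h in g1 g2 *.
  by move: g1 g2 g3 g4; clear; lra.
have t0J : s0 < t0 <= s1 by rewrite t0gt.
have tau0J : s0 < tau0 <= s1 by rewrite tau0gt.
have := doubled_contact cpos M0 ucont uM umono ulip usub vcont vM vmono vlip vsup s00 s1T t0J tau0J (C11_time_pen Th rh) qC q0 pen (ltW a0) mx'.
set pt := dtime_pen _ _ _; set p2 := e^-1 * _; set N := if _ then _ else _.
move=> /= [p1I p2I z1 z2 main].
have ptb : `|pt| <= Th by apply: dtime_pen_bnd; exact: ltW.
have psiS := (psi0 x0).2.
have psiz : `|x0| <= Rf -> psi' x0 = 0 by move=> /psiR[].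
(* comparing with the maximum at equal times tau0, or t0, shows that u, or v,
   changes by at least gam rh between the two times, in the direction excluded
   by the tail estimates *)
have apsi : pt * (a * psi' x0) <= 0.
  have [ptn|ptp|->] := ltgtP pt 0; last by rewrite mul0r.
    rewrite nmulr_rle0// mulr_ge0 ?(ltW a0)//.
    rewrite leNgt; apply/negP => pneg.
    have x0R : x0 <= - Rf.
      rewrite leNgt; apply/negP => h; have [h'|h'] := leP x0 Rf.
        by move: pneg; rewrite psiz ?ltxx// ler_norml h' ltW.
      move: psiS; rewrite pmulr_rge0 ?leNgt ?pneg//.
      by apply: lt_trans h'; exact: lt_le_trans Rf1.
    have tr := dtime_pen_neg (ltW Th0) ptn.
    have := mx' t0 t0 x0 y0 t0I t0I; rewrite subrr time_pen_eq0 ?(ltW rh0)// => k1.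
    have : v (t0, y0) - v (tau0, y0) < gam * rh.
      apply: HRv => //; first by move: tr; clear; lra.
      move: xy; rewrite ltr_norml => /andP[xy1 _].
      by have := ler_norm Rv; move: x0R xy1 etaA nu nx; rewrite /Rf; clear; lra.
    have : gam * rh <= gam * (tau0 - t0).
      by rewrite ler_wpM2l ?(ltW gam0)//; move: tr; clear; lra.
    by move: k1 g2; clear; lra.
  rewrite pmulr_rle0// mulr_ge0_le0 ?(ltW a0)//.
  rewrite leNgt; apply/negP => ppos.
  have x0R : Rf <= x0.
    rewrite leNgt; apply/negP => h; have [h'|h'] := leP (- Rf) x0.
      by move: ppos; rewrite psiz ?ltxx// ler_norml h' ltW.
    move: psiS; rewrite pmulr_lge0 // leNgt => /negP; apply.
    by apply: (lt_trans h'); rewrite oppr_lt0; exact: lt_le_trans Rf1.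
  have tr := dtime_pen_pos (ltW Th0) ptp.
  have := mx' tau0 tau0 x0 y0 tau0I tau0I; rewrite subrr time_pen_eq0 ?(ltW rh0)// => k1.
  have : u (t0, x0) - u (tau0, x0) < gam * rh.
    apply: HRu => //; first by move: tr; clear; lra.
    by have := ler_norm Ru; move: x0R nv nx; rewrite /Rf; clear; lra.
  have : gam * rh <= gam * (t0 - tau0).
    by rewrite ler_wpM2l ?(ltW gam0)//; move: tr; clear; lra.
  by move: k1 g2; clear; lra.
have t0S := inS _ t0I; have tau0S := inS _ tau0I.
have mu0 := slice_meas ucont t0S; have mv0 := slice_meas vcont tau0S.
have ub y : `|u (t0, y)| <= M by exact: uM.
have vb y : `|v (tau0, y)| <= M by exact: vM.
have hbv := B_bound cb H0 y0 mv0 vb.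
have hb : `|B beta x0 (fun y => u (t0, y)) - B beta y0 (fun y => v (tau0, y))| <=
    C0 * (2 * E0) + C1 * M * eta.
  have k1 := B_diff_w cb H0 x0 mu0 mv0 ub vb (fun y => near2 t0 tau0 y t0I tau0I).
  have k2 := B_lip_x cb H0 H1 x0 y0 mv0 vb.
  have k3 : C1 * M * `|x0 - y0| <= C1 * M * eta by rewrite ler_wpM2l ?mulr_ge0// ltW.
  rewrite -(subrKA (B beta x0 (fun y => v (tau0, y)))).
  apply: (le_trans (ler_normD _ _)); apply: lerD k1 _; exact: le_trans k2 k3.
have hc := Heta1 x0 y0 xY (lt_le_trans xy etaB).
have HN : N = 0 \/ (N = N0 /\ c x0 <= c1).
  by rewrite /N; case: ifP => h; [right; split => //; apply: Hc1; exact: ltW|left].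
exact: (slope_balance L0 C00 C10 M0 E00 (erefl gam) (cpos x0) (cpos y0) (ltW a0) (ltW c10) (ltW Th0) (ltW eta0)
  p1I p2I erefl z1 z2 HN N00 ha hw heta (ltW w0) hc ptb apsi hbv hb main).
Qed.

(** * Uniqueness *)

Section final.
Variable R : realType.

(** Continuous induction: the supremum of the times up to which P holds belongs
    to them by the third hypothesis and is not interior by the second. *)
Lemma barrier_induction (P : R -> Prop) (T : R) :
  P 0 ->
  (forall s, 0 <= s < T -> P s -> exists2 d, 0 < d & forall t, s <= t < T -> t < s + d -> P t) ->
  (forall s, 0 < s < T -> (forall r, 0 <= r < s -> P r) -> P s) ->
  forall t, 0 <= t < T -> P t.
Proof.
move=> P0 step lim t1 /andP[t10 t1T].
pose S := [set s | 0 <= s <= t1 /\ forall r, 0 <= r <= s -> P r].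
have S0 : S 0 by split; [rewrite lexx|move=> r /le_anti <-].
have hS : has_sup S by split; [exists 0|exists t1 => s [/andP[]]].
pose sg := sup S.
have sg0 : 0 <= sg by apply: sup_upper_bound.
have sg1 : sg <= t1 by apply: ge_sup; [exists 0|move=> s [/andP[]]].
have below r : 0 <= r < sg -> P r.
  move=> /andP[r0 rho_at]; have e0 : 0 < sg - r by rewrite subr_gt0.
  have [s [_ sP]] := sup_adherent e0 hS; rewrite -/sg => h.
  by apply: sP; rewrite r0; lra.
have Psg : P sg.
  have [e|e] := eqVneq sg 0; first by rewrite e.
  by apply: lim => //; rewrite lt_neqAle eq_sym e sg0/=; lra.
have upto r : 0 <= r <= sg -> P r.
  move=> /andP[r0]; rewrite le_eqVlt => /predU1P[->//|h].
  by apply: below; rewrite r0.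
have [->//|ne] := eqVneq t1 sg.
have lt1 : sg < t1 by rewrite lt_neqAle eq_sym ne.
have [|d d0 H] := step sg _ Psg; first by rewrite sg0; lra.
pose s := Num.min t1 (sg + d / 2).
have s1 : s <= t1 by rewrite ge_min lexx.
have s2 : s <= sg + d / 2 by rewrite ge_min lexx orbT.
have s3 : sg < s by rewrite lt_min lt1; lra.
have : S s.
  split=> [|r /andP[r0 rho_at]]; first by apply/andP; split; lra.
  have [h|h] := leP r sg; first by apply: upto; rewrite r0.
  by apply: H; [apply/andP; split; lra|lra].
by move=> /(sup_upper_bound hS); rewrite -/sg; lra.
Qed.

Lemma bounded_bound (D : set (R * R)) (u : R * R -> R) : [bounded u p | p in D] ->
  exists M, forall p, D p -> `|u p| <= M.
Proof.
move=> [M [_ H]]; exists (M + 1) => p Dp.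
by apply: (H (M + 1)) => //; rewrite ltrDl.
Qed.

Lemma within_contN (D : set (R * R)) (u : R * R -> R) : {within D, continuous u} ->
  {within D, continuous (fun p => - u p)}.
Proof. by move=> uc p; apply: cvgN; exact: uc. Qed.

Section uniq.
Variables (c : R -> R) (beta : R * R -> R) (T M L C0 C1 : R).
Local Notation mu := (@lebesgue_measure R).
Hypothesis cpos : forall x, 0 < c x.
Hypothesis ccont : continuous c.
Hypothesis cb : continuous beta.
Hypothesis M0 : 0 <= M.
Hypothesis L0 : 0 <= L.
Hypothesis C00 : 0 <= C0.
Hypothesis C10 : 0 <= C1.
Hypothesis H0 : forall x, (\int[mu]_y `|beta (x, y)|%:E <= C0%:E)%E.
Hypothesis H1 : forall x x', x < x' ->
    (\int[mu]_y `|beta (x', y) - beta (x, y)|%:E <= (C1 * (x' - x))%:E)%E.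

Definition sol (u : R * R -> R) :=
  [/\ {within strip T, continuous u}, (forall p, strip T p -> `|u p| <= M), lip_x T L u,
    viscosity_subsolution c beta T (usc_env (strip T) u) &
    viscosity_supersolution c beta T (lsc_env (strip T) u)].

Lemma sol_facts u : sol u -> [/\ near_prop T u, mono_x T u, tail_r T u, tail_l T u & runif T u].
Proof.
move=> [uc uM ul us uS].
have um : mono_x T u.
  by move=> t a b tT ab; exact: (u_mono uc uM cpos us tT ab).
have un : near_prop T u by move=> t1 x1 e; exact: u_near.
have ud : decr_prop T u.
  move=> s t K s0 st tT H x.
  exact: (sup_decr ccont cpos M0 C00 uc uM (sub_pen cpos cb H0 M0 uc uM um us) s0 st tT H).
have ui : decr_prop T (fun p => - u p).
  move=> s t K s0 st tT H x.
  have nM p : strip T p -> `|- u p| <= M by rewrite normrN; exact: uM.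
  exact: (sup_decr ccont cpos M0 C00 (within_contN uc) nM (super_pen cpos cb H0 M0 uc uM um uS) s0 st tT H).
split => //.
- by move=> s0 T' rh k; exact: (tail_right un uM um ud).
- by move=> s0 T' rh k; exact: (tail_left un uM um ui).
- by move=> s k; exact: (uniform_right_time un uM um ud ui).
Qed.

(** Within a short time each solution moves by at most E0 / 2, hence the two stay
    within 2 E0 of each other, also at different times. *)
Lemma one_side (u v : R * R -> R) (s0 s1 E0 : R) : sol u -> sol v -> 0 <= s0 -> s1 < T -> 0 < E0 ->
  (forall x, `|u (s0, x) - v (s0, x)| <= E0) ->
  (forall t x, s0 <= t <= s1 -> `|u (t, x) - u (s0, x)| <= E0 / 2) ->
  (forall t x, s0 <= t <= s1 -> `|v (t, x) - v (s0, x)| <= E0 / 2) ->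
  forall t x, s0 <= t <= s1 -> u (t, x) - v (t, x) <= E0 + 2 * ((2 * L * C0 + 1) * E0) * (t - s0).
Proof.
move=> su sv s00 s1T E00 ini hu hv.
have [un um utr utl ur] := sol_facts su; have [vn vm vtr vtl vr] := sol_facts sv.
case: su sv => [uc uM ul us uS] [vc vM vl vs vS].
apply: (local_comp cpos ccont cb M0 L0 C00 C10 H0 H1 uc uM um ul utr ur us vc vM vm vl vtl vr vS s00 s1T E00).
  by move=> x; have := ini x; rewrite ler_norml => /andP[].
move=> t tau x tI tauI; have := hu t x tI; have := hv tau x tauI; have := ini x.
by rewrite !ler_norml => /andP[? ?] /andP[? ?] /andP[? ?]; lra.
Qed.

(** The rate lam is chosen so that E0 (1 + lam (t - s)) <= E0 exp(lam (t - s))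
    absorbs the growth allowed by [one_side]. *)
Lemma uniqueness (u v : R * R -> R) : sol u -> sol v -> (forall x, u (0, x) = v (0, x)) ->
  forall t x, 0 <= t < T -> u (t, x) = v (t, x).
Proof.
move=> su sv uv0 t1 x1 t1T.
pose lam := 2 * (2 * L * C0 + 1).
have lam0 : 0 <= lam by rewrite mulr_ge0// addr_ge0// !mulr_ge0.
have barrier (eps : R) : 0 < eps -> forall t, 0 <= t < T -> forall x, `|u (t, x) - v (t, x)| <= eps * expR (lam * t).
  move=> eps0; apply: barrier_induction.
  - by move=> x; rewrite uv0 subrr normr0 mulr_ge0 ?expR_ge0// ltW.
  - move=> s sT Hs; set E0 := eps * expR (lam * s) in Hs.
    have E00 : 0 < E0 by rewrite mulr_gt0 ?expR_gt0.
    have E2 : 0 < E0 / 2 by rewrite divr_gt0.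
    have [_ _ _ _ ur] := sol_facts su; have [_ _ _ _ vr] := sol_facts sv.
    have [d1 d10 Hu] := ur s (E0 / 2) sT E2; have [d2 d20 Hv] := vr s (E0 / 2) sT E2.
    have /andP[s0 sT'] := sT.
    exists (Num.min d1 d2) => [|t /andP[st tT] ts x]; first by rewrite lt_min d10.
    have tI : s <= t <= t by rewrite st lexx.
    have [td1 td2] : t < s + d1 /\ t < s + d2.
      by move: ts; rewrite -ltrBlDl lt_min => /andP[]; split; lra.
    have hu r y : s <= r <= t -> `|u (r, y) - u (s, y)| <= E0 / 2.
      by move=> /andP[h1 h2]; apply: Hu; [apply/andP; split; lra|lra].
    have hv r y : s <= r <= t -> `|v (r, y) - v (s, y)| <= E0 / 2.
      by move=> /andP[h1 h2]; apply: Hv; [apply/andP; split; lra|lra].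
    have Hs' y : `|v (s, y) - u (s, y)| <= E0 by rewrite distrC.
    have a1 := one_side su sv s0 tT E00 Hs hu hv x tI.
    have a2 := one_side sv su s0 tT E00 Hs' hv hu x tI.
    have gr : E0 + 2 * ((2 * L * C0 + 1) * E0) * (t - s) <= eps * expR (lam * t).
      have -> : lam * t = lam * s + lam * (t - s) by ring.
      rewrite expRD [leRHS]mulrA -/E0.
      have -> : E0 + 2 * ((2 * L * C0 + 1) * E0) * (t - s) = E0 * (1 + lam * (t - s)) by rewrite /lam; ring.
      by rewrite ler_wpM2l ?(ltW E00)// expR_ge1Dx.
    by rewrite ler_norml; lra.
  move=> s /andP[s0 sT] below x.
  case: su sv => [uc _ _ _ _] [vc _ _ _ _].
  apply/ler_addgt0Pr => k k0; have k2 : 0 < k / 2 by rewrite divr_gt0.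
  have sS : 0 <= s < T by rewrite ltW.
  have [d1 d10 Hu] := u_near uc x sS k2; have [d2 d20 Hv] := u_near vc x sS k2.
  pose d := Num.min (Num.min d1 d2) s / 2.
  have mm : 0 < Num.min (Num.min d1 d2) s by rewrite !lt_min d10 d20.
  have [m1 m2 m3] : [/\ Num.min (Num.min d1 d2) s <= d1, Num.min (Num.min d1 d2) s <= d2 & Num.min (Num.min d1 d2) s <= s].
    by split; rewrite !ge_min lexx ?orbT.
  have d0 : 0 < d by rewrite divr_gt0.
  have dE : 2 * d = Num.min (Num.min d1 d2) s by rewrite /d mulrC divfK.
  have rS : 0 <= s - d < T by apply/andP; split; lra.
  have rho_at : `|s - d - s| = d by rewrite addrAC subrr add0r normrN gtr0_norm.
  have xx (e : R) : 0 < e -> `|x - x| < e by rewrite subrr normr0.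
  have := Hu (s - d) x rS; rewrite rho_at => /(_ (ltac:(lra)) (xx _ d10)).
  have := Hv (s - d) x rS; rewrite rho_at => /(_ (ltac:(lra)) (xx _ d20)).
  have := below (s - d) (ltac:(apply/andP; split; lra)) x.
  have : eps * expR (lam * (s - d)) <= eps * expR (lam * s).
    rewrite ler_wpM2l ?(ltW eps0)// ler_expR ler_wpM2l//; lra.
  rewrite !ltr_norml !ler_norml => ? /andP[? ?] /andP[? ?] /andP[? ?]; lra.
apply/eqP; rewrite -subr_eq0 -normr_le0; apply/ler_addgt0Pr => k k0; rewrite add0r.
have := barrier (k / expR (lam * t1)) _ t1 t1T x1; rewrite divfK ?gt_eqF ?expR_gt0//; apply.
by rewrite divr_gt0// expR_gt0.
Qed.

End uniq.
End final.

Unset Implicit Arguments.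

Theorem theorem5p1 (R : realType) (c : R -> R) (beta : R * R -> R) (T : R)
    (u1 u2 : R * R -> R)
    (c_smooth : smooth c)
    (c_pos : forall x, 0 < c x)
    (c_inf : 0 < inf (range c))
    (beta_smooth : smooth beta)
    (beta_L : Linfty_L1 beta)
    (d1beta_L : Linfty_L1 (d1 beta))
    (d11beta_L : Linfty_L1 (d1 (d1 beta)))
    (T_gt0 : 0 < T)
    (u1_sol : viscosity_solution c beta T u1)
    (u2_sol : viscosity_solution c beta T u2)
    (u1_x : weak_d2_Linfty (open_strip T) u1)
    (u2_x : weak_d2_Linfty (open_strip T) u2)
    (u1_cont : {within strip T, continuous u1})
    (u2_cont : {within strip T, continuous u2})
    (u1_bnd : [bounded u1 p | p in strip T])
    (u2_bnd : [bounded u2 p | p in strip T])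
    (u_init : forall x, u1 (0, x) = u2 (0, x)) :
  forall t x, 0 <= t < T -> u1 (t, x) = u2 (t, x).
Proof.
have ccont : continuous c by move=> x; apply: differentiable_continuous; exact: (c_smooth [::] x).
have [C0 [C1 [C00 C10 H0 H1]]] := beta_bounds beta_smooth beta_L d1beta_L.
have [M1 b1] := bounded_bound u1_bnd; have [M2 b2] := bounded_bound u2_bnd.
pose M := Num.max M1 M2.
have {}b1 p : strip T p -> `|u1 p| <= M by move=> /b1 h; rewrite le_max h.
have {}b2 p : strip T p -> `|u2 p| <= M by move=> /b2 h; rewrite le_max h orbT.
have M0 : 0 <= M by apply: le_trans (b1 (0, 0) _) => //; rewrite /strip/= lexx.
have [L1 L10 l1] := u_lip u1_cont b1 u1_x; have [L2 L20 l2] := u_lip u2_cont b2 u2_x.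
pose L := Num.max L1 L2.
have L0 : 0 <= L by rewrite le_max L10.
have lip u L' : L' <= L -> (forall t a b : R, 0 <= t < T -> a <= b -> u (t, b) - u (t, a) <= L' * (b - a)) -> lip_x T L u.
  move=> LL h t a b tT ab; apply: le_trans (h t a b tT ab) _.
  by rewrite ler_wpM2r// subr_ge0.
have s1 : sol c beta T M L u1.
  have [_ ? ?] := u1_sol; split=> //; apply: lip l1; by rewrite le_max lexx.
have s2 : sol c beta T M L u2.
  have [_ ? ?] := u2_sol; split=> //; apply: lip l2; by rewrite le_max lexx orbT.
exact: (uniqueness c_pos ccont (smooth_cont beta_smooth) M0 L0 C00 C10 H0 H1 s1 s2 u_init).
Qed.
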